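(* Let $G$ be a compact Abelian group, let $(\mathcal{A},G,\alpha)$ be a free C$^*$-dynamical system with fixed point algebra $\mathcal{B}$, and let $\beta$ be a $*$-automorphism of $\mathcal{B}$. Let $(\mathfrak{H},\gamma,\omega)$ be the factor system associated with isometries $s(\sigma)$, $\sigma\in\hat G$. Suppose that $\gamma$ and $\gamma^\beta$ are conjugated, i.e. for every $\sigma\in\hat G$ there is a partial isometry $v(\sigma)\in\mathcal{B}\otimes\mathcal{L}(\mathfrak{H}_\sigma)$ with $\gamma^\beta_\sigma=v(\sigma)\gamma_\sigma(\cdot)v(\sigma)^*$ and $\gamma_\sigma=v(\sigma)^*\gamma^\beta_\sigma(\cdot)v(\sigma)$, where $\gamma_\sigma^\beta:=\beta\circ\gamma_\sigma\circ\beta^{-1}$. Let $u:\hat G\times\hat G\to\mathcal{U}Z(\mathcal{B})$ be the corresponding $2$-cocycle $$u(\sigma,\pi):=s(\sigma+\pi)^*\,\beta^{-1}\big(v(\sigma+\pi)\,\omega(\pi,\sigma)^*\,\gamma_\pi(v(\sigma)^* )\,v(\pi)^*\big)\,s(\pi)s(\sigma).$$ Then $\beta$ lifts to $\mathcal{A}$ if and only if the cohomology class of $u$ in $H^2(\hat G,\mathcal{U}Z(\mathcal{B}))_\Delta$ vanishes.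
   Context: A C$^*$-dynamical system $(\mathcal{A},G,\alpha)$ consists of a unital C$^*$-algebra $\mathcal{A}$ and a compact group $G$ acting by $*$-automorphisms $\alpha_g$ such that $(g,x)\mapsto\alpha_g(x)$ is continuous; $\mathcal{B}:=\mathcal{A}^G$. It is free if the map $\mathcal{A}\otimes_{\mathrm{alg}}\mathcal{A}\to C(G,\mathcal{A})$, $x\otimes y\mapsto(g\mapsto x\alpha_g(y))$, has dense range. For $G$ compact Abelian with (additively written) dual group $\hat G=\mathrm{Hom}(G,\mathbb{T})$, freeness is equivalent to the existence, for each $\sigma\in\hat G$, of a finite-dimensional Hilbert space $\mathfrak{H}_\sigma$ and an isometry $s(\sigma)\in\mathcal{A}\otimes\mathcal{L}(\mathbb{C},\mathfrak{H}_\sigma)$ with $\alpha_g(s(\sigma))=\sigma(g)\cdot s(\sigma)$ for all $g\in G$. One chooses $\mathfrak{H}_0=\mathbb{C}$ and $s(0)=1_{\mathcal{A}}$ for the trivial character $0$. $\mathcal{L}(V,W)$ denotes linear maps $V\to W$; maps on $\mathcal{A}$ or $\mathcal{B}$ are applied to the first tensor leg, and operators are amplified by identities on missing legs; $s(\pi)s(\sigma)\in\mathcal{A}\otimes\mathcal{L}(\mathbb{C},\mathfrak{H}_\pi\otimes\mathfrak{H}_\sigma)$ multiplies the $\mathcal{A}$-legs and tensors the operator legs. The associated factor system $(\mathfrak{H},\gamma,\omega)$ is $\gamma_\sigma(b):=s(\sigma)\,b\,s(\sigma)^*\in\mathcal{B}\otimes\mathcal{L}(\mathfrak{H}_\sigma)$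 for $b\in\mathcal{B}$, and $\omega(\sigma,\pi):=s(\sigma)s(\pi)s(\sigma+\pi)^*\in\mathcal{B}\otimes\mathcal{L}(\mathfrak{H}_{\sigma+\pi},\mathfrak{H}_\sigma\otimes\mathfrak{H}_\pi)$. The partial isometries $v(\sigma)$ are normalized to $v(0)=1_{\mathcal{B}}$ and taken with initial projection $\gamma_\sigma(1_{\mathcal{B}})$ and final projection $\gamma^\beta_\sigma(1_{\mathcal{B}})$ (this is no loss of generality). $\mathcal{U}Z(\mathcal{B})$ is the group of unitaries in the center of $\mathcal{B}$. The Fröhlich map $\Delta:\hat G\to\mathrm{Aut}(\mathcal{U}Z(\mathcal{B}))$ is $\Delta_\sigma(b):=s(\sigma)^*bs(\sigma)$. $H^2(\hat G,\mathcal{U}Z(\mathcal{B}))_\Delta$ is second group cohomology with respect to the action $\Delta$: $2$-cocycles satisfy $u(\sigma+\pi,\rho)u(\sigma,\pi)=u(\sigma,\pi+\rho)\Delta_\sigma(u(\pi,\rho))$, and $2$-coboundaries are the maps $(\sigma,\pi)\mapsto\Delta_\sigma(c(\pi))c(\sigma)c(\sigma+\pi)^*$ for maps $c:\hat G\to\mathcal{U}Z(\mathcal{B})$. $\beta$ lifts to $\mathcal{A}$ if there is a $*$-automorphism of $\mathcal{A}$ that extends $\beta$ and commutes with all $\alpha_g$, $g\in G$. *)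

(* Defs.v *)
From HB Require Import structures.
From mathcomp Require Import all_boot all_order all_algebra.
From mathcomp Require Import all_classical all_reals all_analysis.
From mathcomp Require Import complex mxtens.

Set Implicit Arguments.
Unset Strict Implicit.
Unset Printing Implicit Defensive.

Import Order.TTheory GRing.Theory Num.Theory.
Import numFieldNormedType.Exports.

Local Open Scope classical_set_scope.
Local Open Scope ring_scope.

(* As for the library's `Lmodule_isNormed`, the norm takes its (nonnegative
   real) values in R[i].  The normed module structure is derived from `cnorm`
   below rather than inherited, because Hierarchy Builder has no common
   ancestor joining rings and normed modules. *)
HB.mixin Record isPreCStarAlgebra (R : realType) A & GRing.Algebra R[i] A := {
  star : A -> A ;
  starK : involutive star ;
  starD : forall x y : A, star (x + y) = star x + star y ;
  starZ : forall (a : R[i]) (x : A), star (a *: x) = a^*%C *: star x ;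
  starM : forall x y : A, star (x * y) = star y * star x ;
  cnorm : A -> R[i] ;
  cnormD : forall x y : A, cnorm (x + y) <= cnorm x + cnorm y ;
  cnormZ : forall (a : R[i]) (x : A), cnorm (a *: x) = `|a| * cnorm x ;
  cnorm0_eq0 : forall x : A, cnorm x = 0 -> x = 0 ;
  cnormM : forall x y : A, cnorm (x * y) <= cnorm x * cnorm y ;
  cnorm_starM : forall x : A, cnorm (star x * x) = cnorm x ^+ 2
}.

#[short(type="preCStarAlgType")]
HB.structure Definition PreCStarAlgebra (R : realType) :=
  {A of isPreCStarAlgebra R A & GRing.Algebra R[i] A}.

#[non_forgetful_inheritance]
HB.instance Definition _ (R : realType) (A : preCStarAlgType R) :=
  Lmodule_isNormed.Build R[i] (PreCStarAlgebra.sort A)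
    cnormD cnormZ cnorm0_eq0.

Definition norm_complete (R : realType) (A : preCStarAlgType R) :=
  forall F : set_system A, ProperFilter F -> cauchy F -> cvg F.

HB.mixin Record PreCStarAlgebra_isComplete (R : realType) A
    & PreCStarAlgebra R A := {
  cstar_complete : norm_complete (A : preCStarAlgType R)
}.

#[short(type="cstarAlgType")]
HB.structure Definition CStarAlgebra (R : realType) :=
  {A of PreCStarAlgebra_isComplete R A & PreCStarAlgebra R A}.

#[non_forgetful_inheritance]
HB.instance Definition _ (R : realType) (A : cstarAlgType R) :=
  NormedModule.copy (CStarAlgebra.sort A) (PreCStarAlgebra.sort A).
#[non_forgetful_inheritance]
HB.instance Definition _ (R : realType) (A : cstarAlgType R) :=
  Uniform_isComplete.Build (CStarAlgebra.sort A) cstar_complete.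

Section DualGroup.
Variables (R : realType) (G : topologicalZmodType).

(* The group G is written additively; a character is a continuous homomorphism
   from G to the unit circle of R[i]. *)
Record dualGroup := Character {
  char_fun :> G -> R[i] ;
  char_continuous : continuous (char_fun : G -> R[i]^o) ;
  charD : forall g h, char_fun (g + h) = char_fun g * char_fun h ;
  char_norm : forall g, `|char_fun g| = 1
}.

Lemma dualGroup_eq (sigma pi : dualGroup) :
  (forall g, sigma g = pi g) -> sigma = pi.
Proof.
case: sigma pi => [f fc fD fn] [f' fc' fD' fn'] /= /funext ff'.
by subst f'; congr Character; exact: Prop_irrelevance.
Qed.

HB.instance Definition _ := gen_eqMixin dualGroup.
HB.instance Definition _ := gen_choiceMixin dualGroup.

Lemma char_unit (sigma : dualGroup) g : sigma g != 0.
Proof. by rewrite -normr_eq0 char_norm oner_neq0. Qed.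

Definition char_zero : dualGroup.
Proof.
exists (fun=> 1) => [|g h|g]; last by rewrite normr1.
  exact: cst_continuous.
by rewrite mulr1.
Defined.

Definition char_add (sigma pi : dualGroup) : dualGroup.
Proof.
exists (fun g => sigma g * pi g) => [|g h|g].
- by move=> g; apply: (@cvgM R[i]); apply: char_continuous.
- by rewrite !charD mulrACA.
- by rewrite normrM !char_norm mulr1.
Defined.

Definition char_opp (sigma : dualGroup) : dualGroup.
Proof.
exists (fun g => (sigma g)^-1) => [|g h|g].
- move=> g; apply: (@cvgV R[i]); first exact: char_unit.
  exact: char_continuous.
- by rewrite charD invfM.
- by rewrite normfV char_norm invr1.
Defined.

Lemma char_addA : associative char_add.
Proof. by move=> ? ? ?; apply: dualGroup_eq => g /=; rewrite mulrA. Qed.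

Lemma char_addC : commutative char_add.
Proof. by move=> ? ?; apply: dualGroup_eq => g /=; rewrite mulrC. Qed.

Lemma char_add0 : left_id char_zero char_add.
Proof. by move=> ?; apply: dualGroup_eq => g /=; rewrite mul1r. Qed.

Lemma char_addN : left_inverse char_zero char_opp char_add.
Proof.
by move=> sigma; apply: dualGroup_eq => g /=; rewrite mulVf ?char_unit.
Qed.

HB.instance Definition _ := GRing.isZmodule.Build dualGroup
  char_addA char_addC char_add0 char_addN.

End DualGroup.

Section Dynamics.
Variables (R : realType) (A : cstarAlgType R).

(* *-automorphisms of a *-subalgebra B of A are represented by maps A -> A, of
   which only the values on B matter. *)
Definition star_automorphism (B : set A) (f : A -> A) :=
  [/\ set_bij B B f,
      forall (a : R[i]) x y, B x -> B y -> f (a *: x + y) = a *: f x + f y,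
      forall x y, B x -> B y -> f (x * y) = f x * f y &
      forall x, B x -> f (star x) = star (f x)].

Definition inv_on (B : set A) (f : A -> A) : A -> A := 'pinv_(fun=> 0) B f.

Variable G : topologicalZmodType.
Implicit Type alpha : G -> A -> A.

Record dynamical_system alpha : Prop := {
  action_aut : forall g, star_automorphism setT (alpha g) ;
  action0 : forall x, alpha 0 x = x ;
  actionD : forall g h x, alpha (g + h) x = alpha g (alpha h x) ;
  action_continuous : continuous (fun gx : G * A => alpha gx.1 gx.2)
}.

Definition fixed_algebra alpha : set A := [set x | forall g, alpha g x = x].

(* The elements of the algebraic tensor product are represented by the finite
   sequences of elementary tensors. *)
Definition free_action alpha :=
  [set f : {uniform G -> A} | continuous (f : G -> A)] `<=`
  closure [set f : {uniform G -> A} | exists t : seq (A * A),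
             f = (fun g => \sum_(xy <- t) xy.1 * alpha g xy.2)].

Definition lifts alpha (beta : A -> A) :=
  exists betahat : A -> A,
    [/\ star_automorphism setT betahat,
        forall b, fixed_algebra alpha b -> betahat b = beta b &
        forall g x, betahat (alpha g x) = alpha g (betahat x)].

Definition central_unitaries (B : set A) : set A :=
  [set z | [/\ B z, star z * z = 1, z * star z = 1 &
              forall b, B b -> z * b = b * z]].

End Dynamics.

(* Hilbert spaces are the standard ones C^n, so that `'M[A]_(m, n)` is the
   tensor product of A with L(C^n, C^m), and C^m (x) C^n is C^(m * n) by means
   of `mxtens_index`.  For matrices over A, `*t` multiplies the A-legs and
   tensors the operator legs. *)
Section Matrices.
Variables (R : realType) (A : cstarAlgType R).

Definition adjmx m n (x : 'M[A]_(m, n)) : 'M[A]_(n, m) := (map_mx star x)^T.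

(* f applied to the A-leg of x, the new operator leg coming first. *)
Definition apply_leg n (f : A -> 'M[A]_n) p q (x : 'M[A]_(p, q)) :
    'M[A]_(n * p, n * q) :=
  \matrix_(i, j) f (x (mxtens_unindex i).2 (mxtens_unindex j).2)
                   (mxtens_unindex i).1 (mxtens_unindex j).1.

End Matrices.

Section FactorSystem.
Variables (R : realType) (G : topologicalZmodType) (A : cstarAlgType R).
Variable alpha : G -> A -> A.
Variable d : dualGroup R G -> nat.
Variable s : forall sigma : dualGroup R G, 'cV[A]_(d sigma).
Implicit Types sigma pi : dualGroup R G.

Record equivariant_isometries : Prop := {
  iso_isometry : forall sigma, adjmx (s sigma) *m s sigma = 1%:M ;
  iso_equivariant : forall sigma g,
    map_mx (alpha g) (s sigma) = map_mx ( *:%R (sigma g)) (s sigma) ;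
  iso_dim0 : d 0 = 1%N ;
  iso0 : s 0 = const_mx 1
}.

Definition smul sigma pi : 'cV[A]_(d sigma * d pi) := s sigma *t s pi.

Definition fs_gamma sigma (b : A) : 'M[A]_(d sigma) :=
  s sigma *m b%:M *m adjmx (s sigma).

Definition fs_omega sigma pi : 'M[A]_(d sigma * d pi, d (sigma + pi)) :=
  smul sigma pi *m adjmx (s (sigma + pi)).

Definition frohlich sigma (b : A) : A :=
  (adjmx (s sigma) *m b%:M *m s sigma) 0 0.

Variable beta : A -> A.
Let betaV := inv_on (fixed_algebra alpha) beta.

Definition fs_gamma_beta sigma (b : A) : 'M[A]_(d sigma) :=
  map_mx beta (fs_gamma sigma (betaV b)).

Variable v : forall sigma, 'M[A]_(d sigma).

Record conjugating : Prop := {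
  conj_base : forall sigma i j, fixed_algebra alpha (v sigma i j) ;
  conj_partial_isometry : forall sigma,
    v sigma *m adjmx (v sigma) *m v sigma = v sigma ;
  conj_initial : forall sigma,
    adjmx (v sigma) *m v sigma = fs_gamma sigma 1 ;
  conj_final : forall sigma,
    v sigma *m adjmx (v sigma) = fs_gamma_beta sigma 1 ;
  conj_gamma_beta : forall sigma b, fixed_algebra alpha b ->
    fs_gamma_beta sigma b = v sigma *m fs_gamma sigma b *m adjmx (v sigma) ;
  conj_gamma : forall sigma b, fixed_algebra alpha b ->
    fs_gamma sigma b = adjmx (v sigma) *m fs_gamma_beta sigma b *m v sigma ;
  conj0 : v 0 = 1%:M
}.

(* The index sigma + pi is written pi + sigma for the dimensions to match
   definitionally those of `fs_omega pi sigma`. *)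
Definition lift_cocycle sigma pi : A :=
  (adjmx (s (pi + sigma)) *m
   map_mx betaV
     (v (pi + sigma) *m adjmx (fs_omega pi sigma) *m
      apply_leg (fs_gamma pi) (adjmx (v sigma)) *m
      (adjmx (v pi) *t (1%:M : 'M[A]_(d sigma)))) *m
   smul pi sigma) 0 0.

End FactorSystem.

(* Second cohomology of a group Gam with values in a group U of commuting
   unitaries of A, on which Gam acts through Delta. *)
Section Cohomology.
Variables (R : realType) (A : cstarAlgType R) (Gam : zmodType).
Variables (U : set A) (Delta : Gam -> A -> A).
Implicit Types u : Gam -> Gam -> A.

Definition Z2 : set (Gam -> Gam -> A) :=
  [set u | (forall sigma pi, U (u sigma pi)) /\
           forall sigma pi rho,
             u (sigma + pi) rho * u sigma pi =
             u sigma (pi + rho) * Delta sigma (u pi rho)].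

Definition B2 : set (Gam -> Gam -> A) :=
  [set u | exists2 c : Gam -> A, (forall sigma, U (c sigma)) &
           forall sigma pi,
             u sigma pi = Delta sigma (c pi) * c sigma * star (c (sigma + pi))].

(* The coset of u modulo B2. *)
Definition H2_class u : set (Gam -> Gam -> A) :=
  [set w | Z2 w /\ exists2 b, B2 b &
           forall sigma pi, w sigma pi = u sigma pi * b sigma pi].

Definition H2_vanishes u := H2_class u = H2_class (fun _ _ => 1).

End Cohomology.

(* Main.v *)
Require Import Defs.
From HB Require Import structures.
From mathcomp Require Import all_boot all_order all_algebra.
From mathcomp Require Import all_classical all_reals all_analysis.
From mathcomp Require Import complex mxtens.
From mathcomp Require Import ring lra.

Set Implicit Arguments.
Unset Strict Implicit.
Unset Printing Implicit Defensive.

Import Order.TTheory GRing.Theory Num.Theory.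
Import numFieldNormedType.Exports.
Import Normc.

Local Open Scope classical_set_scope.
Local Open Scope ring_scope.

Local Notation Re := complex.Re.
Local Notation Im := complex.Im.

(* Put t(sigma) := v(sigma) s(sigma).  On the isotypic component of sigma the
   map phi_sigma(x) := beta(x s(sigma)^* ) t(sigma) is a bijective beta-bimodule
   map, and phi_{pi + sigma}(x y) = phi_pi(x) phi_sigma(y) beta(u(sigma, pi)):
   the cocycle u is the defect of multiplicativity.  A lift of beta must be
   phi_sigma( . ) beta(c(sigma)) on the component of sigma with c(sigma) a
   central unitary, and such a family is multiplicative iff c trivialises u.

   It remains to extend a family trivialising u from the algebraic sum of the
   components to A.  It is contractive there: the powers of y = x^* x are
   supported on polynomially many characters, since the dual group is abelian,
   so ||phi(y)||^n = ||phi(y^n)|| <= p(n) ||y||^n for n = 2^k.  The algebraic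
   sum is dense by the theorem of Peter and Weyl for G, for which the convolution
   powers h^{2n} of a hermitian continuous function h, divided by the growth rate
   of ||h^n||_2^2, converge uniformly to an idempotent; the minimal idempotents
   are the multiples of characters. *)

(** * Norms *)

(** The isometry s(sigma) has no inverse, so nothing can be divided by it. Its entries form a finite
    family s_i of degree sigma with the sum of [star s_i * s_i] equal to 1. Hence x is recovered
    from the coefficients [x * star s_i], which lie in the fixed algebra, where beta is defined; and
    an element killed by left multiplication with every s_i is 0. The entries t_i of v(sigma)
    s(sigma) form a second such family, with t_i beta(b) [star t_j] = beta(s_i b [star s_j]). Two
    families of one degree that implement the same map of the fixed algebra differ by a central
    unitary. This one fact produces u from the products of entries, and c from a given lift.

    On the analytic side, a sum over n characters a priori grows in norm by a factor at most n under
    phi, one contractive spectral projection for each character; multiplicativity and the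
    C*-identity then remove the factor. Integration over G is von Neumann's mean: total boundedness
    yields finite averages of translates that are almost constant, and the construction is the same
    for scalar and for A-valued functions. *)

Record complete_norm (R : realType) (E : lmodType R[i]) (N : E -> R) : Prop := {
  cn_triangle : forall x y, N (x + y) <= N x + N y ;
  cn_scale : forall a x, N (a *: x) = normc a * N x ;
  cn_eq0 : forall x, N x = 0 -> x = 0 ;
  cn_complete : forall w : nat -> E,
    (forall e, 0 < e -> exists n, forall i j, (n <= i)%N -> (n <= j)%N ->
       N (w i - w j) <= e) ->
    exists l, forall e, 0 < e -> exists n, forall i, (n <= i)%N ->
       N (w i - l) <= e
}.

Section ComplexModulus.
Variable R : realType.
Implicit Types z w : R[i].

Lemma normr_normc z : `|z| = (normc z)%:C%C. Proof. by []. Qed.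

Lemma normc_ge0 z : 0 <= normc z.
Proof. by rewrite -lecR -normr_normc normr_ge0. Qed.

Lemma normc_opp z : normc (- z) = normc z.
Proof. by apply: (@complexI R); rewrite -!normr_normc normrN. Qed.

Lemma normcD z w : normc (z + w) <= normc z + normc w.
Proof. by rewrite -lecR rmorphD -!normr_normc ler_normD. Qed.

Lemma normcX z n : normc (z ^+ n) = normc z ^+ n.
Proof. by apply: (@complexI R); rewrite rmorphXn -!normr_normc normrX. Qed.

Lemma normc_real (x : R) : normc x%:C%C = `|x|.
Proof. by rewrite /= expr0n /= addr0 sqrtr_sqr. Qed.

Lemma normc_nat n : normc (n%:R : R[i]) = n%:R.
Proof.
by rewrite -(rmorph_nat (real_complex R)) normc_real ger0_norm ?ler0n.
Qed.

Lemma normc_conj z : normc z^*%C = normc z.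
Proof. by case: z => x y /=; rewrite sqrrN. Qed.

Lemma normc_eq0 z : (normc z == 0) = (z == 0).
Proof. by apply/eqP/eqP => [/eq0_normc //|->]; rewrite normc0. Qed.

Lemma mulc_conj z : z * z^*%C = (normc z ^+ 2)%:C%C.
Proof. by rewrite -sqr_normc normr_normc rmorphXn. Qed.

Lemma Re_le_normc z : Re z <= normc z.
Proof.
apply: le_trans (ler_norm _) _.
by case: z => x y /=; rewrite -sqrtr_sqr ler_sqrt ?lerDl ?sqr_ge0 // addr_ge0 ?sqr_ge0.
Qed.

Lemma Im_le_normc z : `|Im z| <= normc z.
Proof.
by case: z => x y /=; rewrite -sqrtr_sqr ler_sqrt ?lerDr ?sqr_ge0 // addr_ge0 ?sqr_ge0.
Qed.

Lemma Re_abs_le_normc z : `|Re z| <= normc z.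
Proof.
by case: z => x y /=; rewrite -sqrtr_sqr ler_sqrt ?lerDl ?sqr_ge0 // addr_ge0 ?sqr_ge0.
Qed.

Lemma normc_le_Re_Im z : normc z <= `|Re z| + `|Im z|.
Proof.
case: z => x y /=; rewrite -[leRHS]ger0_norm ?addr_ge0 // -sqrtr_sqr ler_sqrt ?sqr_ge0 //.
by rewrite sqrrD !real_normK ?num_real // addrAC lerDl mulrn_wge0 // mulr_ge0.
Qed.

Lemma realcM (x y : R) : (x * y)%:C%C = x%:C%C * y%:C%C :> R[i].
Proof. exact: rmorphM. Qed.

Lemma realcD (x y : R) : (x + y)%:C%C = x%:C%C + y%:C%C :> R[i].
Proof. exact: rmorphD. Qed.

Lemma realcB (x y : R) : (x - y)%:C%C = x%:C%C - y%:C%C :> R[i].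
Proof. exact: rmorphB. Qed.

Lemma realcN (x : R) : (- x)%:C%C = - x%:C%C :> R[i].
Proof. exact: rmorphN. Qed.

Lemma realc_sum I (r : seq I) (P : pred I) (F : I -> R) :
  (\sum_(i <- r | P i) F i)%:C%C = \sum_(i <- r | P i) (F i)%:C%C :> R[i].
Proof. exact: rmorph_sum. Qed.

Lemma realcX (x : R) n : (x ^+ n)%:C%C = x%:C%C ^+ n :> R[i].
Proof. exact: rmorphXn. Qed.

Lemma ReB z w : Re (z - w) = Re z - Re w.
Proof. by case: z w => [? ?] []. Qed.

Lemma ImB z w : Im (z - w) = Im z - Im w.
Proof. by case: z w => [? ?] []. Qed.

End ComplexModulus.

Section RealCauchy.
Variable R : realType.

Lemma real_cauchy (w : nat -> R) :
  (forall e, 0 < e -> exists n, forall i j, (n <= i)%N -> (n <= j)%N ->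
     `|w i - w j| <= e) ->
  exists l, forall e, 0 < e -> exists n, forall i, (n <= i)%N -> `|w i - l| <= e.
Proof.
move=> hw.
have : cvg (w @ \oo).
  apply/cauchy_cvgP/cauchy_exP => e e0.
  have [n hn] := hw _ (divr_gt0 e0 (ltr0Sn _ 1)).
  exists (w n); exists n => // i /= ni.
  rewrite /ball /=; apply: le_lt_trans (hn _ _ (leqnn n) ni) _.
  by rewrite ltr_pdivrMr // ltr_pMr // (ltr_nat R 1 2).
move=> /cvg_ex[l wl]; exists l => e e0.
have /cvgrPdist_le/(_ e e0)[n _ hn] := wl.
by exists n => i ni; rewrite distrC; apply: hn.
Qed.

End RealCauchy.

Section CompleteNormTheory.
Variables (R : realType) (E : lmodType R[i]) (N : E -> R).
Hypothesis hN : complete_norm N.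

Lemma cn_0 : N 0 = 0.
Proof. by rewrite -(scale0r 0) (cn_scale hN) normc0 mul0r. Qed.

Lemma cn_opp x : N (- x) = N x.
Proof. by rewrite -scaleN1r (cn_scale hN) normc_opp normc1 mul1r. Qed.

Lemma cn_ge0 x : 0 <= N x.
Proof.
have := cn_triangle hN x (- x).
by rewrite subrr cn_0 cn_opp -mulr2n pmulrn_lge0.
Qed.

Lemma cn_distC x y : N (x - y) = N (y - x).
Proof. by rewrite -cn_opp opprB. Qed.

Lemma cn_sub x y : N (x - y) <= N x + N y.
Proof. by rewrite -(cn_opp y) (cn_triangle hN). Qed.

Lemma cn_dist3 z x y : N (x - y) <= N (x - z) + N (z - y).
Proof. by rewrite -{1}(subrK z x) -addrA (cn_triangle hN). Qed.

Lemma cn_sum I (r : seq I) (P : pred I) (F : I -> E) :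
  N (\sum_(i <- r | P i) F i) <= \sum_(i <- r | P i) N (F i).
Proof.
elim/big_rec2: _ => [|i y x _ h]; first by rewrite cn_0.
exact: le_trans (cn_triangle hN _ _) (lerD _ _).
Qed.

Lemma cn_small_eq0 x : (forall e, 0 < e -> N x <= e) -> x = 0.
Proof.
move=> h; apply: (cn_eq0 hN); apply/eqP.
rewrite eq_le cn_ge0 andbT leNgt; apply/negP => x0.
have := h _ (divr_gt0 x0 (ltr0Sn _ 1)).
by rewrite ler_pdivlMr // mulrDr mulr1 gerDl leNgt x0.
Qed.

Lemma cn_small_mul K x : (forall e, 0 < e -> N x <= K * e) -> x = 0.
Proof.
move=> h; apply: cn_small_eq0 => e e0.
have K0 : 0 < `|K| + 1 by rewrite ltr_wpDl.
have e1 : 0 < e / (`|K| + 1) by rewrite divr_gt0.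
apply: le_trans (h _ e1) _.
rewrite mulrA ler_pdivrMr // mulrC ler_pM2l //.
by apply: le_trans (ler_norm _) _; rewrite lerDl.
Qed.

Lemma cn_close_eq x y : (forall e, 0 < e -> N (x - y) <= e) -> x = y.
Proof. by move/cn_small_eq0/eqP; rewrite subr_eq0 => /eqP. Qed.

End CompleteNormTheory.

Lemma complete_normc (R : realType) : @complete_norm R (R[i]^o) (@normc R).
Proof.
split=> [x y|a x|x|w hw].
- exact: normcD.
- by rewrite normcM.
- exact: eq0_normc.
have [e e0|l hl] := @real_cauchy R (fun n => Re (w n)).
  have [n hn] := hw _ e0; exists n => i j ni nj /=.
  by apply: le_trans (hn _ _ ni nj); rewrite -ReB Re_abs_le_normc.
have [e e0|m hm] := @real_cauchy R (fun n => Im (w n)).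
  have [n hn] := hw _ e0; exists n => i j ni nj /=.
  by apply: le_trans (hn _ _ ni nj); rewrite -ImB Im_le_normc.
exists (l +i* m)%C => e e0.
have e20 : 0 < e / 2 by rewrite divr_gt0.
have [n1 h1] := hl _ e20; have [n2 h2] := hm _ e20.
exists (maxn n1 n2) => i; rewrite geq_max => /andP[i1 i2].
apply: le_trans (normc_le_Re_Im _) _; rewrite ReB ImB /= [leRHS](splitr e).
by apply: lerD; [exact: h1|exact: h2].
Qed.

Section CStarNorm.
Variables (R : realType) (A : cstarAlgType R).
Implicit Types x y : A.

Definition rnorm x : R := Re (cnorm x).

Lemma cnorm_ge0 x : 0 <= cnorm x.
Proof. exact: (@normr_ge0 _ A x). Qed.

Lemma cnormE x : cnorm x = (rnorm x)%:C%C.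
Proof. by rewrite RRe_real // ger0_real // cnorm_ge0. Qed.

Lemma rnormM x y : rnorm (x * y) <= rnorm x * rnorm y.
Proof. by rewrite -lecR realcM -!cnormE cnormM. Qed.

Lemma rnorm_starM x : rnorm (star x * x) = rnorm x ^+ 2.
Proof. by apply: (@complexI R); rewrite realcX -!cnormE cnorm_starM. Qed.

(** Completeness for filters becomes completeness for sequences, with real norm values. With
    [complete_normc], scalars and A satisfy the same hypotheses, so one theory of means serves
    both. *)
Lemma complete_rnorm : complete_norm (rnorm : A -> R).
Proof.
split=> [x y|a x|x x0|w hw].
- by rewrite -lecR realcD -!cnormE cnormD.
- by apply: (@complexI R); rewrite realcM -!cnormE -normr_normc cnormZ.
- by apply: cnorm0_eq0; rewrite cnormE x0.
have : cvg ((w : nat -> A) @ \oo).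
  apply: cstar_complete; apply: cauchy_exP => e e0.
  have eE : e = (Re e)%:C%C by rewrite RRe_real // gtr0_real.
  have e0' : 0 < Re e by rewrite -ltcR -eE.
  have [n hn] := hw _ (divr_gt0 e0' (ltr0Sn _ 1)).
  exists (w n); exists n => // i /= ni.
  rewrite -ball_normE /ball_ /=.
  rewrite -[X in X < _]/(cnorm (w n - w i)) cnormE eE ltcR.
  apply: le_lt_trans (hn _ _ (leqnn n) ni) _.
  by rewrite ltr_pdivrMr // ltr_pMr // (ltr_nat R 1 2).
move=> /cvg_ex[l wl]; exists l => e e0.
have /cvgrPdist_le/(_ e%:C%C) := wl.
rewrite ltcR => /(_ e0)[n _ hn]; exists n => i ni.
have := hn _ ni.
rewrite -[X in X <= _]/(cnorm (l - w i)) cnormE lecR -(opprB (w i)).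
suff -> : rnorm (- (w i - l)) = rnorm (w i - l) by [].
by apply: (@complexI R); rewrite -!cnormE -scaleN1r cnormZ normrN normr1 mul1r.
Qed.

Let hN := complete_rnorm.

Lemma star0 : star (0 : A) = 0.
Proof. by apply: (addrI (star 0)); rewrite -starD !addr0. Qed.

Lemma starN x : star (- x) = - star x.
Proof. by apply: (addrI (star x)); rewrite -starD !subrr star0. Qed.

Lemma starB x y : star (x - y) = star x - star y.
Proof. by rewrite starD starN. Qed.

Lemma star1 : star (1 : A) = 1.
Proof. by rewrite -[LHS]mulr1 -{2}(starK 1) -starM mulr1 starK. Qed.

Lemma star_sum I (r : seq I) (P : pred I) (F : I -> A) :
  star (\sum_(i <- r | P i) F i) = \sum_(i <- r | P i) star (F i).
Proof. by apply: (big_morph _ starD star0). Qed.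

(** The C*-identity and submultiplicativity give [rnorm z ^+ 2 <= rnorm (star z) * rnorm z]. Cancel
    [rnorm z], then exchange z and [star z]. *)
Lemma rnorm_star x : rnorm (star x) = rnorm x.
Proof.
have h z : rnorm z <= rnorm (star z).
  have := cn_ge0 hN z; rewrite le_eqVlt => /orP[/eqP <-|z0]; first exact: cn_ge0.
  by rewrite -(ler_pM2r z0) -expr2 -rnorm_starM rnormM.
by apply/eqP; rewrite eq_le; rewrite -{2}(starK x) !h.
Qed.

Lemma rnorm_sqr_sa x : star x = x -> rnorm (x ^+ 2) = rnorm x ^+ 2.
Proof. by move=> xE; rewrite -rnorm_starM xE expr2. Qed.

Lemma starX x n : star (x ^+ n) = star x ^+ n.
Proof. by elim: n => [|n IH]; rewrite ?star1 // exprSr starM IH -exprS. Qed.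

(** The C*-identity squares the norm of a self-adjoint element exactly, so equality propagates along
    exponents [2 ^ k]. This is why growth is compared along these exponents below. *)
Lemma rnorm_pow_sa x k : star x = x -> rnorm (x ^+ (2 ^ k)) = rnorm x ^+ (2 ^ k).
Proof.
move=> xE; elim: k => [//|k IH].
by rewrite expnSr !exprM rnorm_sqr_sa ?IH // starX xE.
Qed.

Lemma rnorm1_le : rnorm (1 : A) <= 1.
Proof.
have := rnorm_starM 1; rewrite star1 mulr1.
have := cn_ge0 hN 1; rewrite le_eqVlt => /orP[/eqP <- //|h].
by move=> /eqP; rewrite expr2 -subr_eq0 -{1}(mulr1 (rnorm 1)) -mulrBr mulf_eq0 (gt_eqF h) /= subr_eq0 => /eqP <-.
Qed.

Lemma rnorm_unitary x : star x * x = 1 -> rnorm x <= 1.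
Proof.
move=> xx; have := rnorm_starM x; rewrite xx => h.
by rewrite -(@expr_le1 _ 2) ?(cn_ge0 hN) // -h rnorm1_le.
Qed.

End CStarNorm.

(** * Automorphisms of closed subalgebras are isometric *)

Section Growth.
Variable R : realType.

Lemma bernoulli (d : R) n : 0 <= d -> 1 + n%:R * d <= (1 + d) ^+ n.
Proof.
move=> d0; elim: n => [|n IH]; first by rewrite mul0r addr0 expr0.
rewrite exprS; apply: le_trans (ler_wpM2l _ IH); last by rewrite addr_ge0.
have : 0 <= n%:R * d ^+ 2 by rewrite mulr_ge0 // sqr_ge0.
by rewrite -natr1; nra.
Qed.

Lemma expr_unbounded (x K : R) : 1 < x -> exists n, K < x ^+ n.
Proof.
move=> x1; have d0 : 0 < x - 1 by rewrite subr_gt0.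
exists (Num.truncn (K / (x - 1))).+1.
have := @bernoulli (x - 1) (Num.truncn (K / (x - 1))).+1 (ltW d0).
rewrite [1 + (x - 1)]addrC subrK; apply: lt_le_trans.
have := truncnS_gt (K / (x - 1)); rewrite ltr_pdivrMr // => /lt_trans; apply.
by rewrite ltrDr ltr01.
Qed.

(** If [a / b > 1], its powers of exponent [2 ^ k] are doubly exponential in k, while the allowed
    factor is only exponential in k. A factor [M ^+ k] is polynomial in the exponent [2 ^ k]. *)
Lemma pow2_growth_le (a b D M : R) : 0 <= a -> 0 <= b -> 1 <= M ->
  (forall k, a ^+ (2 ^ k) <= D * M ^+ k * b ^+ (2 ^ k)) -> a <= b.
Proof.
move=> a0 b0 M1 h; rewrite leNgt; apply/negP => ab.
have [b00|bN0] := eqVneq b 0.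
  by have := h 0%N; rewrite expn0 !expr1 expr0 mulr1 b00 mulr0 leNgt -b00 ab.
have bp : 0 < b by rewrite lt_def bN0.
have r1 : 1 < a / b by rewrite ltr_pdivlMr // mul1r.
have M0 : 0 < M by apply: lt_le_trans M1.
have {}h k : (a / b) ^+ (2 ^ k) <= D * M ^+ k.
  by rewrite expr_div_n ler_pdivrMr ?exprn_gt0.
have [j jP] := expr_unbounded (2 * M) r1.
set x := (a / b) ^+ (2 ^ j).
have xM : 2 * M <= x.
  apply: le_trans (ltW jP) _; apply: ler_weXn2l; first exact: ltW.
  exact/ltnW/ltn_expl.
have M2 : 0 <= 2 * M by rewrite mulr_ge0 // ltW.
have x1 : 1 <= x.
  by apply: le_trans xM; move: M1; lra.
(* Since [x >= 2 * M] at stage j, stage j + k yields at least [(2 * M) ^+ k]. The surplus [2 ^+ k]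
   is made larger than [D * M ^+ j]. *)
have [k kP] : exists k, D * M ^+ j < 2 ^+ k by apply: expr_unbounded; rewrite ltr1n.
have := h (j + k)%N; rewrite expnD exprM -/x leNgt => /negP; apply.
apply: (@lt_le_trans _ _ ((2 * M) ^+ k)).
  by rewrite exprD mulrA exprMn ltr_pM2r ?exprn_gt0.
apply: (@le_trans _ _ (x ^+ k)); last first.
  by apply: ler_weXn2l => //; exact/ltnW/ltn_expl.
by rewrite lerXn2r // nnegrE; apply: le_trans x1.
Qed.

End Growth.

Section Automorphism.
Variables (R : realType) (A : cstarAlgType R).
Implicit Types x y h : A.
Let hN := complete_rnorm A.

(** Covers the whole algebra, on which each [alpha g] acts, and the fixed algebra, on which beta
    acts. Closedness keeps limits of polynomials, such as the square root below, inside B. *)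
Record closed_subalgebra (B : set A) : Prop := {
  csub1 : B 1 ;
  csubD : forall x y, B x -> B y -> B (x + y) ;
  csubZ : forall a x, B x -> B (a *: x) ;
  csubM : forall x y, B x -> B y -> B (x * y) ;
  csubS : forall x, B x -> B (star x) ;
  csub_closed : forall x,
    (forall e, 0 < e -> exists2 y, B y & rnorm (y - x) <= e) -> B x
}.

Section Sub.
Variable B : set A.
Hypothesis hB : closed_subalgebra B.

Lemma csubN x : B x -> B (- x).
Proof. by move=> Bx; rewrite -scaleN1r; apply: csubZ. Qed.

Lemma csubB x y : B x -> B y -> B (x - y).
Proof. by move=> Bx By; apply: csubD => //; apply: csubN. Qed.

Lemma csub0 : B 0.
Proof. by rewrite -(subrr 1); apply: csubB; apply: csub1. Qed.

Lemma csubX x n : B x -> B (x ^+ n).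
Proof.
by move=> Bx; elim: n => [|n IH]; [apply: csub1|rewrite exprS; apply: csubM].
Qed.

Lemma csub_sum I (r : seq I) (P : pred I) (F : I -> A) :
  (forall i, P i -> B (F i)) -> B (\sum_(i <- r | P i) F i).
Proof.
by move=> h; elim/big_ind: _ => // [|x y]; [apply: csub0|apply: csubD].
Qed.

Fixpoint half_iter x n : A :=
  if n is n'.+1 then (2^-1 : R[i]) *: (x + half_iter x n' ^+ 2) else 0.

Lemma normc_half : normc (2^-1 : R[i]) = 2^-1.
Proof. by rewrite normcV normc_nat. Qed.

Lemma sqr_subE x y : x ^+ 2 - y ^+ 2 = x * (x - y) + (x - y) * y.
Proof. by rewrite mulrBr mulrBl !expr2 addrA subrK. Qed.

(* [1 - x] is the square of [1 - y] for the fixed point [y] of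
   [y |-> (x + y ^+ 2) / 2], a contraction on the ball of radius 1/2. *)
Lemma sqrt_sub x : B x -> star x = x -> rnorm x <= 4^-1 ->
  exists y, [/\ B y, star y = y, (1 - y) ^+ 2 = 1 - x &
    forall z, z * x = x * z -> z * y = y * z].
Proof.
move=> Bx xE x4.
set w := half_iter x.
have wB n : B (w n).
  elim: n => [|n IH] /=; first exact: csub0.
  by apply: (csubZ hB); apply: (csubD hB) => //; apply: csubX.
have wS n : star (w n) = w n.
  elim: n => [|n IH] /=; first exact: star0.
  rewrite starZ starD starX IH xE; congr (_ *: _).
  by rewrite conjc_inv conjc_nat.
(* One step sends the ball of radius 1/2 to radius (1/4 + 1/4)/2; here the bound [4^-1] on x
   enters. *)
have w2 n : rnorm (w n) <= 2^-1.
  elim: n => [|n IH] /=; first by rewrite (cn_0 hN) invr_ge0.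
  rewrite (cn_scale hN) normc_half.
  have := cn_triangle hN x (w n ^+ 2); have := rnormM (w n) (w n).
  have := cn_ge0 hN (w n); rewrite expr2; nra.
(* By [sqr_subE] squaring expands distances by at most 1/2 + 1/2 on this ball, and the leading
   factor 1/2 turns the step into a contraction. *)
have wd n : rnorm (w n.+1 - w n) <= (2^-1) ^+ n.
  elim: n => [|n IH].
    by rewrite /= subr0 expr0; apply: le_trans (w2 1%N) _; lra.
  rewrite -[w n.+2]/(2^-1 *: (x + w n.+1 ^+ 2)) -[in X in _ - X]/(2^-1 *: (x + w n ^+ 2)).
  rewrite -[w n.+1 in X in _ - X]/(2^-1 *: (x + w n ^+ 2)).
  rewrite -scalerBr opprD addrACA subrr add0r sqr_subE (cn_scale hN) normc_half exprS.
  apply: ler_wpM2l; first by rewrite invr_ge0.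
  apply: le_trans (cn_triangle hN _ _) _.
  have := rnormM (w n.+1) (w n.+1 - w n); have := rnormM (w n.+1 - w n) (w n).
  have := w2 n; have := w2 n.+1; have := cn_ge0 hN (w n.+1 - w n).
  have := cn_ge0 hN (w n.+1); have := cn_ge0 hN (w n).
  move: IH; nra.
(* The right side is the exact geometric sum of the bounds [wd]; without the subtracted term the
   induction on m would not close. *)
have wc n m : rnorm (w (n + m)%N - w n) <= 2 * (2^-1) ^+ n - 2 * 2^-1 ^+ (n + m).
  elim: m => [|m IH]; first by rewrite addn0 !subrr (cn_0 hN).
  rewrite addnS; apply: le_trans (cn_dist3 hN (w (n + m)%N) _ _) _.
  by have := wd (n + m)%N; rewrite exprS; move: IH; lra.
have small (e : R) : 0 < e -> exists n, 2 * (2^-1) ^+ n <= e.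
  move=> e0; have [n hn] : exists n, 2 / e < 2 ^+ n by apply: expr_unbounded; rewrite ltr1n.
  exists n; rewrite exprVn ler_pdivrMr ?exprn_gt0 //.
  by rewrite mulrC -ler_pdivrMr // ltW.
have wc' n i : (n <= i)%N -> rnorm (w i - w n) <= 2 * (2^-1) ^+ n.
  move=> ni; rewrite -(subnKC ni); apply: le_trans (wc _ _) _.
  by rewrite gerBl mulr_ge0 // exprn_ge0 // invr_ge0.
have [e e0|y hy] := @cn_complete _ _ _ hN w.
  have [n hn] := small _ (divr_gt0 e0 (ltr0Sn _ 1)).
  exists n => i j ni nj; rewrite (splitr e).
  apply: le_trans (cn_dist3 hN (w n) _ _) _; apply: lerD.
    exact: le_trans (wc' _ _ ni) hn.
  by rewrite (cn_distC hN); exact: le_trans (wc' _ _ nj) hn.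
have y2 : rnorm y <= 2^-1.
  apply/ler_addgt0Pl => e e0; have [n hn] := hy _ e0.
  rewrite -(subrK (w n) y); apply: le_trans (cn_triangle hN _ _) _.
  by rewrite lerD // (cn_distC hN) hn.
have yP : y = (2^-1 : R[i]) *: (x + y ^+ 2).
  apply/eqP; rewrite -subr_eq0; apply/eqP; apply: (cn_small_mul hN (K := 2)) => e e0.
  have [n hn] := hy _ e0.
  have h1 := hn _ (leqnn n); have h2 := hn _ (leqnSn n).
  rewrite mulr2n mulrDl mul1r; apply: le_trans (cn_dist3 hN (w n.+1) _ _) _.
  rewrite (cn_distC hN) lerD //.
  rewrite -[w n.+1]/(2^-1 *: (x + w n ^+ 2)) -scalerBr opprD addrACA subrr add0r.
  rewrite sqr_subE (cn_scale hN) normc_half.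
  have := cn_triangle hN (w n * (w n - y)) ((w n - y) * y).
  have := rnormM (w n) (w n - y); have := rnormM (w n - y) y.
  have := w2 n; have := cn_ge0 hN (w n - y).
  have := cn_ge0 hN (w n); have := cn_ge0 hN y.
  move: h1 y2; nra.
exists y; split.
- apply: (csub_closed hB) => e e0; have [n hn] := hy _ e0.
  by exists (w n) => //; apply: hn.
- apply/eqP; rewrite -subr_eq0; apply/eqP; apply: (cn_small_mul hN (K := 2)) => e e0.
  have [n hn] := hy _ e0; rewrite mulr2n mulrDl mul1r.
  apply: le_trans (cn_dist3 hN (w n) _ _) _; rewrite lerD ?hn //.
  by rewrite -(wS n) -starB rnorm_star (cn_distC hN) hn.
- have : y + y = x + y ^+ 2.
    by rewrite -mulr2n -scaler_nat [in LHS]yP scalerA divff ?scale1r // pnatr_eq0.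
  move=> yy; rewrite expr2 mulrBl mul1r mulrBr mulr1 -expr2 opprB addrA addrAC.
  by rewrite -(addrA 1) -opprD yy opprD addrA subrK.
(* The iterates are polynomials in x, so they commute with z and the limit inherits this. It is
   applied to z = h when x is the square of h. *)
- move=> z zx; apply/eqP; rewrite -subr_eq0; apply/eqP.
  apply: (cn_small_mul hN (K := 2 * rnorm z)) => e e0.
  have [n hn] := hy _ e0.
  have -> : z * y - y * z = (w n - y) * z - z * (w n - y).
    suff zw : z * w n = w n * z.
      by rewrite mulrBl mulrBr zw opprB [RHS]addrC addrA subrK.
    elim: n {hn} => [|n IH] /=; first by rewrite mulr0 mul0r.
    rewrite -scalerAl -scalerAr mulrDl mulrDr zx; congr (_ *: (_ + _)).
    by rewrite !expr2 mulrA IH -mulrA IH mulrA.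
  apply: le_trans (cn_sub hN _ _) _.
  have := rnormM (w n - y) z; have := rnormM z (w n - y).
  have := hn _ (leqnn n); have := cn_ge0 hN z; nra.
Qed.

(* [h] is the real part of [h + i sqrt (1 - h ^+ 2)]. *)
Lemma self_adjoint_unitary h : B h -> star h = h -> rnorm h <= 2^-1 ->
  exists U, [/\ B U, star U * U = 1, U * star U = 1 &
                h = (2^-1 : R[i]) *: (U + star U)].
Proof.
move=> Bh hE h2.
have [||y [By yE y2 yc]] := @sqrt_sub (h ^+ 2) (csubX 2 Bh).
- by rewrite starX hE.
- by rewrite rnorm_sqr_sa //; have := cn_ge0 hN h; nra.
have hy : h * (1 - y) = (1 - y) * h.
  by rewrite mulrBr mulrBl mulr1 mul1r yc // -exprSr -exprS.
have iJ : ('i%C : R[i])^*%C = - 'i%C by apply/eqP; rewrite eq_complex /= oppr0 !eqxx.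
have i2 : ('i%C : R[i]) * 'i%C = -1 by rewrite -expr2 sqr_i.
pose U : A := h + ('i%C : R[i]) *: (1 - y).
have US : star U = h - ('i%C : R[i]) *: (1 - y).
  by rewrite starD hE starZ starB star1 yE iJ scaleNr.
have sq (a b : A) : a * b = b * a -> (a - b) * (a + b) = a ^+ 2 - b ^+ 2.
  by move=> ab; rewrite mulrBl !mulrDr ab !expr2 opprD addrA addrK.
have ci : h * (('i%C : R[i]) *: (1 - y)) = (('i%C : R[i]) *: (1 - y)) * h.
  by rewrite -scalerAl -scalerAr hy.
have i2y : (('i%C : R[i]) *: (1 - y)) ^+ 2 = - (1 - h ^+ 2).
  by rewrite expr2 -scalerAl -scalerAr scalerA i2 scaleN1r -expr2 y2.
exists U; split.
- by apply: (csubD hB) => //; apply: (csubZ hB); apply: csubB => //; apply: csub1.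
- by rewrite US sq // i2y opprK addrC subrK.
- rewrite US /U -{1}[_ *: _]opprK sq ?sqrrN ?i2y ?opprK; first by rewrite addrC subrK.
  by rewrite mulrN mulNr ci.
- rewrite US /U addrACA subrr addr0 -mulr2n -(scaler_nat 2 h) scalerA mulVf ?scale1r //.
Qed.

Variable f : A -> A.
Hypothesis hf : star_automorphism B f.

Lemma auto_in x : B x -> B (f x).
Proof. by case: hf => -[h _ _] _ _ _; apply: h. Qed.

Lemma auto_inj x y : B x -> B y -> f x = f y -> x = y.
Proof. by case: hf => -[_ h _] _ _ _ Bx By; apply: h; rewrite inE. Qed.

Lemma auto_surj y : B y -> exists2 x, B x & f x = y.
Proof. by case: hf => -[_ _ h] _ _ _ /h[x Bx <-]; exists x. Qed.

Lemma auto_lin a x y : B x -> B y -> f (a *: x + y) = a *: f x + f y.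
Proof. by case: hf => _ h _ _; apply: h. Qed.

Lemma auto_mul x y : B x -> B y -> f (x * y) = f x * f y.
Proof. by case: hf => _ _ h _; apply: h. Qed.

Lemma auto_star x : B x -> f (star x) = star (f x).
Proof. by case: hf => _ _ _; apply. Qed.

Lemma auto_add x y : B x -> B y -> f (x + y) = f x + f y.
Proof. by move=> Bx By; rewrite -{1}(scale1r x) auto_lin // scale1r. Qed.

Lemma auto0 : f 0 = 0.
Proof.
by have /eqP := auto_add csub0 csub0; rewrite addr0 -subr_eq subrr => /eqP.
Qed.

Lemma auto_scale a x : B x -> f (a *: x) = a *: f x.
Proof.
by move=> Bx; rewrite -[a *: x]addr0 auto_lin //; [rewrite auto0 addr0|apply: csub0].
Qed.

Lemma auto_sum I (r : seq I) (P : pred I) (F : I -> A) :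
  (forall i, P i -> B (F i)) ->
  f (\sum_(i <- r | P i) F i) = \sum_(i <- r | P i) f (F i).
Proof.
move=> h; suff [] : B (\sum_(i <- r | P i) F i) /\
  f (\sum_(i <- r | P i) F i) = \sum_(i <- r | P i) f (F i) by [].
elim/big_rec2: _ => [|i y x Pi [By <-]]; first by split; [apply: csub0|apply: auto0].
by split; [apply: csubD => //; apply: h|apply: auto_add => //; apply: h].
Qed.

Lemma auto1 : f 1 = 1.
Proof.
have B1 := csub1 hB.
have [x Bx fx] := auto_surj B1.
by rewrite -[LHS]mulr1 -[X in _ * X = _]fx -auto_mul // mul1r.
Qed.

Lemma autoX x n : B x -> f (x ^+ n) = f x ^+ n.
Proof.
move=> Bx; elim: n => [|n IH]; first by rewrite auto1.
by rewrite !exprS auto_mul ?IH //; apply: csubX.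
Qed.

(* Unitaries have norm at most 1 and are mapped to unitaries. *)
Lemma auto_sa_bound h : B h -> star h = h -> rnorm (f h) <= 2 * rnorm h.
Proof.
move=> Bh hE.
have := cn_ge0 hN h; rewrite le_eqVlt => /orP[/eqP/esym h0|h0].
  by rewrite (cn_eq0 hN h0) auto0 (cn_0 hN) mulr0.
set c := ((2 * rnorm h)^-1)%:C%C : R[i].
have cE : normc c = (2 * rnorm h)^-1.
  by rewrite normc_real ger0_norm // invr_ge0 mulr_ge0 // ltW.
have [|||U [BU U1 U2 hU]] := @self_adjoint_unitary (c *: h).
- exact: (csubZ hB).
- by rewrite starZ hE conjc_real.
- by rewrite (cn_scale hN) cE invfM -mulrA mulVf ?mulr1 // gt_eqF.
have BUS := csubS hB BU.
have U3 : rnorm (f U) <= 1.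
  by apply: rnorm_unitary; rewrite -auto_star // -auto_mul // U1 auto1.
have : rnorm (f (c *: h)) <= 1.
  rewrite hU auto_scale ?auto_add ?auto_star //; last exact: (csubD hB).
  rewrite (cn_scale hN) normc_half.
  by have := cn_triangle hN (f U) (star (f U)); rewrite rnorm_star; lra.
by rewrite auto_scale // (cn_scale hN) cE -ler_pdivlMl ?invrK ?mulr1 ?invr_gt0 ?mulr_gt0.
Qed.

(** The factor 2 of [auto_sa_bound] is removed by applying it to the powers of exponent [2 ^ k]. A
    general x is reduced to the self-adjoint [star x * x]. *)
Lemma auto_le x : B x -> rnorm (f x) <= rnorm x.
Proof.
move=> Bx.
suff sa h : B h -> star h = h -> rnorm (f h) <= rnorm h.
  rewrite -(@ler_pXn2r _ 2) ?nnegrE ?(cn_ge0 hN) // -!rnorm_starM.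
  rewrite -auto_star // -auto_mul //; last exact: (csubS hB).
  apply: sa; first by apply: (csubM hB) => //; apply: (csubS hB).
  by rewrite starM starK.
move=> Bh hE; apply: (@pow2_growth_le _ _ _ 2 1); rewrite ?(cn_ge0 hN) // => k.
rewrite expr1n mulr1 -!rnorm_pow_sa // -?autoX //; last by rewrite -auto_star // hE.
apply: auto_sa_bound; first exact: csubX.
by rewrite starX hE.
Qed.

Lemma invonK x : B x -> inv_on B f (f x) = x.
Proof.
move=> Bx; case: hf => -[h1 h2 h3] _ _ _.
by rewrite /inv_on pinvKV ?inE.
Qed.

Lemma invon_in x : B x -> B (inv_on B f x).
Proof. by move=> Bx; have [y By <-] := auto_surj Bx; rewrite invonK. Qed.

Lemma invonKV x : B x -> f (inv_on B f x) = x.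
Proof. by move=> Bx; have [y By <-] := auto_surj Bx; rewrite invonK. Qed.

Lemma invon_auto : star_automorphism B (inv_on B f).
Proof.
split.
- split.
  + by move=> x Bx; apply: invon_in.
  + move=> x y; rewrite !inE => Bx By e.
    by rewrite -(invonKV Bx) e invonKV.
  + by move=> x Bx; exists (f x); [apply: auto_in|apply: invonK].
- move=> a x y Bx By; have [Bx' By'] := (invon_in Bx, invon_in By).
  apply: auto_inj; rewrite ?auto_lin ?invonKV //.
  + by apply: invon_in; apply: (csubD hB) => //; apply: (csubZ hB).
  + by apply: (csubD hB) => //; apply: (csubZ hB).
  + by apply: (csubD hB) => //; apply: (csubZ hB).
- move=> x y Bx By; have [Bx' By'] := (invon_in Bx, invon_in By).
  apply: auto_inj; rewrite ?auto_mul ?invonKV //.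
  + by apply: invon_in; apply: (csubM hB).
  + by apply: (csubM hB).
  + by apply: (csubM hB).
- move=> x Bx; have Bx' := invon_in Bx.
  have [B1 B2] := (csubS hB Bx, csubS hB Bx').
  by apply: auto_inj; rewrite ?auto_star ?invonKV //; apply: invon_in.
Qed.

End Sub.
End Automorphism.

(** * The invariant mean *)

(** The form in which compactness of G enters every later argument: finitely many translates of any
    neighbourhood of 0 cover G. *)
Definition totally_bounded (G : topologicalZmodType) :=
  forall U : set G, nbhs 0 U ->
    exists L : seq G, forall g, exists2 h, h \in L & U (g - h).

Lemma near_sub (G : topologicalZmodType) (x : G) (U : set G) :
  nbhs 0 U -> \forall y \near x, U (y - x).
Proof.
move=> U0.
have c : (fun y => (y, x)) @ x --> (x, x) by apply: cvg_pair; [exact: cvg_id|exact: cvg_cst].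
have := cvg_comp _ _ c (@tvs.sub_continuous G (x, x)).
by rewrite /= subrr => /(_ U U0).
Qed.

(** If no finite set of translates of U covers, the complements of the finite unions generate a
    proper filter. At a cluster point x it would have to meet the translate of U by x, which one of
    its members avoids. *)
Lemma compact_totally_bounded (G : topologicalZmodType) :
  compact [set: G] -> totally_bounded G.
Proof.
move=> H U U0; apply: contrapT => noL.
pose F := filter_from [set: seq G]
  (fun L => [set g | forall h, h \in L -> ~ U (g - h)]).
have FF : ProperFilter F.
  apply: filter_from_proper; first apply: filter_from_filter; first by exists [::].
    move=> L M _ _; exists (L ++ M) => // g hg.
    by split=> h hin; apply: hg; rewrite mem_cat hin ?orbT.
  move=> L _; apply: contrapT => emp; apply: noL; exists L => g.
  apply: contrapT => hg; apply: emp; exists g => h hin Uh.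
  by apply: hg; exists h.
have [|x [_ cl]] := H F FF; first exact: filterT.
have [] := cl [set g | forall h, h \in [:: x] -> ~ U (g - h)] [set g | U (g - x)].
- by exists [:: x].
- exact: near_sub.
- by move=> g [hg Ug]; apply: (hg x) => //; rewrite inE.
Qed.

(** * Averages over finite families of translates *)

Section Average.
Variables (R : realType) (G : zmodType).

Section Module.
Variable E : lmodType R[i].
Implicit Types (S T : seq G) (f : G -> E).

Definition avg S f (x : G) : E :=
  ((size S)%:R^-1 : R[i]) *: \sum_(a <- S) f (x + a).

Definition sumset S T := [seq a + b | a <- S, b <- T].

Lemma size_sumset_gt0 S T : (0 < size S)%N -> (0 < size T)%N ->
  (0 < size (sumset S T))%N.
Proof. by rewrite size_allpairs muln_gt0 => -> ->. Qed.

Lemma avg_sumset S T f x : avg (sumset S T) f x = avg S (avg T f) x.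
Proof.
rewrite /avg size_allpairs natrM invfM big_allpairs_dep /= -scalerA; congr (_ *: _).
rewrite scaler_sumr; apply: eq_bigr => a _.
by congr (_ *: _); apply: eq_bigr => b _; rewrite addrA.
Qed.

Lemma avg_comm S T f x : avg S (avg T f) x = avg T (avg S f) x.
Proof.
rewrite /avg; under eq_bigr do rewrite scaler_sumr.
under [in RHS]eq_bigr do rewrite scaler_sumr.
rewrite !scaler_sumr; under eq_bigr do rewrite scaler_sumr.
under [in RHS]eq_bigr do rewrite scaler_sumr.
rewrite exchange_big /=; apply: eq_bigr => b _; apply: eq_bigr => a _.
by rewrite !scalerA mulrC addrAC.
Qed.

Lemma avgD S f g x : avg S (fun y => f y + g y) x = avg S f x + avg S g x.
Proof. by rewrite /avg big_split scalerDr. Qed.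

Lemma avgZ S c f x : avg S (fun y => c *: f y) x = c *: avg S f x.
Proof. by rewrite /avg -scaler_sumr !scalerA mulrC. Qed.

Lemma avgB S f g x : avg S (fun y => f y - g y) x = avg S f x - avg S g x.
Proof. by rewrite /avg sumrB scalerBr. Qed.

Lemma avg_cst S (c : E) x : (0 < size S)%N -> avg S (fun=> c) x = c.
Proof.
move=> S0; rewrite /avg big_const_seq count_predT iter_addr_0 -(scaler_nat (size S) c).
by rewrite scalerA mulVf ?scale1r // pnatr_eq0 -lt0n.
Qed.

Lemma avg_shift S f x a : avg S (fun y => f (y + a)) x = avg S f (x + a).
Proof. by rewrite /avg; congr (_ *: _); apply: eq_bigr => b _; rewrite addrAC. Qed.

End Module.

Section Normed.
Variables (E : lmodType R[i]) (N : E -> R).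
Hypothesis hN : complete_norm N.
Implicit Types (S T : seq G) (f : G -> E).

Lemma avg_le S f K x : (0 < size S)%N -> (forall y, N (f y) <= K) ->
  N (avg S f x) <= K.
Proof.
move=> S0 fK; rewrite /avg (cn_scale hN) normcV normc_nat ler_pdivrMl ?ltr0n //.
apply: le_trans (cn_sum hN _ _ _) _.
apply: le_trans (ler_sum _ (fun i _ => fK _)) _.
by rewrite big_const_seq count_predT iter_addr_0 mulr_natl.
Qed.

Lemma avg_close S f c x e : (0 < size S)%N -> (forall y, N (f y - c) <= e) ->
  N (avg S f x - c) <= e.
Proof. by move=> S0 h; rewrite -{1}(avg_cst c x S0) -avgB; apply: avg_le. Qed.

Definition multiples (g : G) n := [seq g *+ k | k <- iota 0 n].

(** The two sums telescope: translation by g changes only the first and the last term. *)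
Lemma avg_multiples g n f K x : (0 < n)%N -> (forall y, N (f y) <= K) ->
  N (avg (multiples g n) f (x + g) - avg (multiples g n) f x) <= 2 * K / n%:R.
Proof.
move=> n0 fK; rewrite /avg /multiples size_map size_iota -scalerBr (cn_scale hN).
rewrite normcV normc_nat mulrC ler_pM2r ?invr_gt0 ?ltr0n //.
rewrite !big_map -sumrB.
under eq_bigr => k _ do rewrite -addrA -mulrS.
rewrite -[n]subn0 -/(index_iota 0 n) telescope_sumr //.
by rewrite mulr2n mulrDl mul1r; apply: le_trans (cn_sub hN _ _) (lerD _ _).
Qed.

(** A Følner set of the subgroup generated by L, kept as a list with repetitions: all combinations
    of elements of L with coefficients in 0, ..., n - 1. *)
Definition folner (L : seq G) n :=
  foldr (fun g S => sumset (multiples g n) S) [:: 0] L.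

Lemma size_folner L n : (0 < n)%N -> (0 < size (folner L n))%N.
Proof.
move=> n0; elim: L => [//|g L IH] /=; apply: size_sumset_gt0 => //.
by rewrite size_map size_iota.
Qed.

Lemma avg_folner L n f K h x : (0 < n)%N -> (forall y, N (f y) <= K) ->
  h \in L -> N (avg (folner L n) f (x + h) - avg (folner L n) f x) <= 2 * K / n%:R.
Proof.
move=> n0 fK; elim: L x => [//|g L IH] x; rewrite inE /= !avg_sumset.
have m0 : (0 < size (multiples g n))%N by rewrite size_map size_iota.
move=> /orP[/eqP -> |hL].
  by apply: avg_multiples => // y; apply: avg_le => //; apply: size_folner.
by rewrite -avg_shift -avgB; apply: avg_le => // y; apply: IH.
Qed.

End Normed.
End Average.

(** * The mean of a uniformly continuous function *)

Section Mean.
Variables (R : realType) (G : topologicalZmodType).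
Hypothesis tb : totally_bounded G.

Section Normed.
Variables (E : lmodType R[i]) (N : E -> R).
Hypothesis hN : complete_norm N.
Implicit Types (S T : seq G) (f g : G -> E).

Definition ucont f := forall e : R, 0 < e ->
  exists2 U : set G, nbhs 0 U & forall a, U a -> forall x, N (f (x + a) - f x) <= e.

Lemma ucont_bounded f : ucont f -> exists K, forall x, N (f x) <= K.
Proof.
move=> /(_ 1 ltr01)[U U0 hU]; have [L hL] := tb U0.
exists (1 + \sum_(h <- L) N (f h)) => x; have [h hIn Uh] := hL x.
rewrite -(subrK (f h) (f x)); apply: le_trans (cn_triangle hN _ _) _.
apply: lerD; first by have := hU _ Uh h; rewrite [h + _]addrC subrK.
by rewrite (big_rem h) //= lerDl sumr_ge0 // => i _; apply: (cn_ge0 hN).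
Qed.

(* The finite set of translates depends only on the modulus of continuity and
   on the bound, not on [f]. *)
Lemma almost_invariant (U : set G) (K e : R) : nbhs 0 U -> 0 < e ->
  exists2 S : seq G, (0 < size S)%N & forall f,
    (forall a, U a -> forall x, N (f (x + a) - f x) <= e) ->
    (forall x, N (f x) <= K) ->
    forall x y, N (avg S f x - avg S f y) <= 2 * e.
Proof.
move=> U0 e0; have [L hL] := tb U0.
pose n := (Num.truncn (2 * K / e)).+1.
exists (folner L n); first exact: size_folner.
move=> f fU fK x y.
(* The point x is within U of y + h, which costs e by the modulus of continuity. Passing from y + h
   to y costs another e because the Følner average is almost invariant under h in L; n was chosen
   with [2 * K / n <= e]. *)
have [h hIn Uh] := hL (x - y).
apply: le_trans (cn_dist3 hN (avg (folner L n) f (y + h)) _ _) _.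
rewrite mulr2n mulrDl mul1r; apply: lerD.
  have -> : x = y + h + (x - y - h) by rewrite -(addrA x) -opprD [RHS]addrC subrK.
  rewrite -avg_shift -avgB; apply: (avg_le hN) => [|z]; first exact: size_folner.
  exact: fU.
apply: le_trans (avg_folner hN _ _ fK hIn) _ => //.
rewrite ler_pdivrMr ?ltr0n // [e * _]mulrC -ler_pdivrMr //.
exact/ltW/truncnS_gt.
Qed.

(** Von Neumann's description of the Haar integral: the constant that is a uniform limit of finite
    averages of translates of f. *)
Definition is_mean f (c : E) := forall e, 0 < e ->
  exists2 S : seq G, (0 < size S)%N & forall x, N (avg S f x - c) <= e.

(** Averages over S and over T commute because G is abelian, so the double average is close to both
    constants. *)
Lemma is_mean_unique f c d : is_mean f c -> is_mean f d -> c = d.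
Proof.
move=> hc hd; apply: (cn_close_eq hN) => e e0.
have e2 : 0 < e / 2 by rewrite divr_gt0.
have [S S0 hS] := hc _ e2; have [T T0 hT] := hd _ e2.
rewrite (splitr e); apply: le_trans (cn_dist3 hN (avg S (avg T f) 0) _ _) _.
apply: lerD; last by apply: avg_close.
by rewrite (cn_distC hN) avg_comm; apply: avg_close.
Qed.

(** Averages with oscillation at most 1/(n + 1) exist by [almost_invariant]. Averaging the n-th one
    over the m-th set compares their values at 0, which therefore form a Cauchy sequence. *)
Lemma is_mean_ex f : ucont f -> exists c, is_mean f c.
Proof.
move=> fu; have [K fK] := ucont_bounded fu.
have osc e : 0 < e -> exists S : seq G, (0 < size S)%N /\
    forall x y, N (avg S f x - avg S f y) <= e.
  move=> e0; have e2 : 0 < e / 2 by rewrite divr_gt0.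
  have [U U0 fU] := fu _ e2; have [S S0 hS] := almost_invariant K U0 e2.
  by exists S; split=> // x y; have := hS f fU fK x y; rewrite mulrC divfK.
have {}osc (n : nat) : exists S : seq G, (0 < size S)%N /\
    forall x y, N (avg S f x - avg S f y) <= n.+1%:R^-1.
  by apply: osc; rewrite invr_gt0 ltr0n.
have [S hS] := choice osc.
pose c n := avg (S n) f 0.
have cP n m : N (c n - c m) <= n.+1%:R^-1 + m.+1%:R^-1.
  apply: le_trans (cn_dist3 hN (avg (S m) (avg (S n) f) 0) _ _) _; apply: lerD.
    rewrite (cn_distC hN); apply: avg_close => //; first by have [] := hS m.
    by move=> y; have [_] := hS n; apply.
  rewrite avg_comm; apply: avg_close => //; first by have [] := hS n.
  by move=> y; have [_] := hS m; apply.
have small e : 0 < e -> exists n, forall i, (n <= i)%N -> i.+1%:R^-1 <= e :> R.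
  move=> e0; exists (Num.truncn e^-1) => i hi.
  rewrite -[e]invrK lef_pV2 ?posrE ?invr_gt0 ?ltr0n //.
  by apply/ltW/(lt_le_trans (truncnS_gt _)); rewrite ler_nat.
have [e e0|l hl] := cn_complete hN (w := c).
  have [n hn] := small _ (divr_gt0 e0 (ltr0Sn _ 1)).
  exists n => i j ni nj; apply: le_trans (cP _ _) _; rewrite [leRHS](splitr e).
  by apply: lerD; apply: hn.
exists l => e e0; have e2 : 0 < e / 2 by rewrite divr_gt0.
have [n1 h1] := hl _ e2; have [n2 h2] := small _ e2.
pose n := maxn n1 n2; have [Sn0 hSn] := hS n.
exists (S n) => // x; rewrite (splitr e).
apply: le_trans (cn_dist3 hN (c n) _ _) _; apply: lerD.
  by apply: le_trans (hSn _ _) _; apply: h2; rewrite leq_maxr.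
by apply: h1; rewrite leq_maxl.
Qed.

Definition mean f : E := xget 0 (is_mean f).

Lemma meanP f : ucont f -> is_mean f (mean f).
Proof. by move=> /is_mean_ex[c hc]; apply: xgetPex; exists c. Qed.

Lemma meanE f c : is_mean f c -> mean f = c.
Proof.
by move=> h; apply: (is_mean_unique _ h); apply: xgetPex; exists c.
Qed.

(** One S serves all functions with a common bound and a common modulus; [mean_fubini] applies it to
    all sections at once. The 3 is an oscillation 2 e of the average plus e for the comparison with
    the mean. *)
Lemma mean_approx (U : set G) (K e : R) : nbhs 0 U -> 0 < e ->
  exists2 S : seq G, (0 < size S)%N & forall f, ucont f ->
    (forall a, U a -> forall x, N (f (x + a) - f x) <= e) ->
    (forall x, N (f x) <= K) ->
    forall x, N (avg S f x - mean f) <= 3 * e.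
Proof.
move=> U0 e0; have [S S0 hS] := almost_invariant K U0 e0.
exists S => // f fu fU fK x; have [T T0 hT] := meanP fu e0.
have -> : 3 * e = 2 * e + e by rewrite -natr1 mulrDl mul1r.
apply: le_trans (cn_dist3 hN (avg T (avg S f) x) _ _) _; apply: lerD.
  by rewrite (cn_distC hN); apply: avg_close => // y; apply: hS.
by rewrite avg_comm; apply: avg_close.
Qed.

Lemma mean_cst c : mean (fun=> c) = c.
Proof.
apply: meanE => e e0; exists [:: 0] => // x.
by rewrite avg_cst // subrr (cn_0 hN) ltW.
Qed.

Lemma mean_le f K : ucont f -> (forall x, N (f x) <= K) -> N (mean f) <= K.
Proof.
move=> fu fK; apply/ler_addgt0Pl => e e0; have [S S0 hS] := meanP fu e0.
rewrite -(subrK (avg S f 0) (mean f)); apply: le_trans (cn_triangle hN _ _) _.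
by apply: lerD; [rewrite (cn_distC hN) hS|apply: (avg_le hN)].
Qed.

Lemma is_mean_shift f c a : is_mean f c -> is_mean (fun x => f (x + a)) c.
Proof.
move=> h e e0; have [S S0 hS] := h _ e0.
by exists S => // x; rewrite avg_shift.
Qed.

Lemma mean_shift f a : ucont f -> mean (fun x => f (x + a)) = mean f.
Proof. by move=> fu; apply/meanE/is_mean_shift/meanP. Qed.

Lemma mean_opp f : ucont f -> mean (fun x => f (- x)) = mean f.
Proof.
move=> fu; apply: meanE => e e0; have [S S0 hS] := meanP fu e0.
exists [seq - a | a <- S]; first by rewrite size_map.
move=> x; have := hS (- x); rewrite /avg size_map big_map.
by under [in X in _ -> X]eq_bigr do rewrite opprD opprK.
Qed.

Lemma mean_scale c f : ucont f -> mean (fun x => c *: f x) = c *: mean f.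
Proof.
move=> fu; apply: meanE => e e0.
have c0 : 0 < normc c + 1 by rewrite ltr_wpDl ?normc_ge0.
have [S S0 hS] := meanP fu (divr_gt0 e0 c0).
exists S => // x; rewrite avgZ -scalerBr (cn_scale hN).
apply: le_trans (_ : (normc c + 1) * (e / (normc c + 1)) <= _); last first.
  by rewrite mulrC divfK // gt_eqF.
by apply: ler_pM; rewrite ?normc_ge0 ?(cn_ge0 hN) // lerDl.
Qed.

Lemma mean_add f g : ucont f -> ucont g ->
  mean (fun x => f x + g x) = mean f + mean g.
Proof.
move=> fu gu; apply: meanE => e e0.
have e2 : 0 < e / 2 by rewrite divr_gt0.
have [S S0 hS] := meanP fu e2; have [T T0 hT] := meanP gu e2.
exists (sumset S T); first exact: size_sumset_gt0.
move=> x; rewrite avgD opprD addrACA (splitr e).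
apply: le_trans (cn_triangle hN _ _) _; rewrite !avg_sumset; apply: lerD.
  by rewrite avg_comm; apply: avg_close.
by apply: avg_close.
Qed.

Lemma ucontD f g : ucont f -> ucont g -> ucont (fun x => f x + g x).
Proof.
move=> fu gu e e0; have e2 : 0 < e / 2 by rewrite divr_gt0.
have [U U0 hU] := fu _ e2; have [V V0 hV] := gu _ e2.
exists (U `&` V); first exact: filterI.
move=> a [Ua Va] x; rewrite opprD addrACA (splitr e).
by apply: le_trans (cn_triangle hN _ _) (lerD (hU _ Ua _) (hV _ Va _)).
Qed.

Lemma ucont_cst c : ucont (fun=> c).
Proof.
move=> e e0; exists setT; first exact: filterT.
by move=> a _ x; rewrite subrr (cn_0 hN) ltW.
Qed.

Lemma ucont_shift f a : ucont f -> ucont (fun x => f (x + a)).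
Proof.
move=> fu e e0; have [U U0 hU] := fu _ e0; exists U => // b Ub x.
by rewrite addrAC hU.
Qed.

Lemma ucont_opp f : ucont f -> ucont (fun x => f (- x)).
Proof.
move=> fu e e0; have [U U0 hU] := fu _ e0; exists U => // b Ub x.
by rewrite (cn_distC hN); have := hU b Ub (- (x + b)); rewrite opprD subrK.
Qed.

End Normed.

Section Change.
Variables (E F : lmodType R[i]) (N : E -> R) (M : F -> R).
Hypotheses (hN : complete_norm N) (hM : complete_norm M).
Variables (T : E -> F) (K : R).
Hypotheses (TD : forall x y, T (x - y) = T x - T y)
  (TV : forall (n : nat) x, T ((n%:R^-1 : R[i]) *: x) = (n%:R^-1 : R[i]) *: T x)
  (TK : forall x, M (T x) <= K * N x).

Let T0 : T 0 = 0. Proof. by rewrite -(subrr 0) TD subrr. Qed.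

Let TA x y : T (x + y) = T x + T y.
Proof. by rewrite -[y in LHS]opprK TD -[- y]sub0r TD T0 sub0r opprK. Qed.

Let bound e : 0 < e -> exists2 d, 0 < d & K * d <= e.
Proof.
move=> e0; have K0 : 0 < `|K| + 1 by rewrite ltr_wpDl.
exists (e / (`|K| + 1)); first by rewrite divr_gt0.
rewrite mulrA ler_pdivrMr // mulrC ler_pM2l //.
by apply: le_trans (ler_norm _) _; rewrite lerDl.
Qed.

Let TKe x e d : 0 < d -> K * d <= e -> N x <= d -> 0 < e -> M (T x) <= e.
Proof.
move=> d0 Kd xd e0; apply: le_trans (TK x) _.
have [K0|K0] := lerP 0 K; first exact: le_trans (ler_wpM2l K0 xd) Kd.
by apply: le_trans (ltW e0); rewrite mulr_le0_ge0 ?(cn_ge0 hN) // ltW.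
Qed.

Lemma ucont_linear f : ucont N f -> ucont M (fun x => T (f x)).
Proof.
move=> fu e e0; have [d d0 hd] := bound e0.
have [U U0 hU] := fu _ d0; exists U => // a Ua x.
by rewrite -TD; apply: (TKe d0 hd) => //; apply: hU.
Qed.

(** An average involves only sums and the scalars 1/n, so T need only respect these. This admits
    complex conjugation, which is not linear over [R[i]]. *)
Lemma mean_linear f : ucont N f -> mean M (fun x => T (f x)) = T (mean N f).
Proof.
move=> fu; apply: (meanE hM) => e e0; have [d d0 hd] := bound e0.
have [S S0 hS] := meanP hN fu d0; exists S => // x.
have -> : avg S (fun x => T (f x)) x = T (avg S f x).
  by rewrite /avg TV (big_morph T TA T0).
by rewrite -TD; apply: (TKe d0 hd) => //; apply: hS.
Qed.

End Change.

Section Bilinear.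
Variables (E F H : lmodType R[i]) (N : E -> R) (M : F -> R) (P : H -> R).
Hypotheses (hN : complete_norm N) (hM : complete_norm M) (hP : complete_norm P).
Variable m : E -> F -> H.
Hypotheses (mBl : forall x x' y, m (x - x') y = m x y - m x' y)
  (mBr : forall x y y', m x (y - y') = m x y - m x y')
  (mK : forall x y, P (m x y) <= N x * M y).

Lemma ucont_bilinear f g : ucont N f -> ucont M g ->
  ucont P (fun x => m (f x) (g x)).
Proof.
move=> fu gu e e0.
have [K fK] := ucont_bounded hN fu; have [L gL] := ucont_bounded hM gu.
have K0 : 0 <= K by apply: le_trans (fK 0); apply: (cn_ge0 hN).
have L0 : 0 <= L by apply: le_trans (gL 0); apply: (cn_ge0 hM).
have p1 : 0 < K + L + 1 by rewrite ltr_wpDl ?addr_ge0.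
have d0 : 0 < e / (K + L + 1) by rewrite divr_gt0.
set d := e / _ in d0.
have [U U0 hU] := fu _ d0; have [V V0 hV] := gu _ d0.
exists (U `&` V); first exact: filterI.
move=> a [Ua Va] x.
have -> : m (f (x + a)) (g (x + a)) - m (f x) (g x) =
    m (f (x + a) - f x) (g (x + a)) + m (f x) (g (x + a) - g x).
  by rewrite mBl mBr addrA subrK.
apply: le_trans (cn_triangle hP _ _) _.
have -> : e = (K + L + 1) * d by rewrite mulrC divfK // gt_eqF.
apply: le_trans (lerD (mK _ _) (mK _ _)) _.
have h1 : N (f (x + a) - f x) * M (g (x + a)) <= d * L.
  by apply: ler_pM; rewrite ?(cn_ge0 hN) ?(cn_ge0 hM) ?hU ?gL.
have h2 : N (f x) * M (g (x + a) - g x) <= K * d.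
  by apply: ler_pM; rewrite ?(cn_ge0 hN) ?(cn_ge0 hM) ?hV ?fK.
by apply: le_trans (lerD h1 h2) _; move: d0; lra.
Qed.

End Bilinear.
End Mean.

(** * Exchange of two means *)

Section Fubini.
Variables (R : realType) (G : topologicalZmodType).
Hypothesis tb : totally_bounded G.
Variables (E : lmodType R[i]) (N : E -> R).
Hypothesis hN : complete_norm N.

Lemma mean_sum I (r : seq I) (F : I -> G -> E) :
  (forall i, ucont N (F i)) ->
  ucont N (fun x => \sum_(i <- r) F i x) /\
  mean N (fun x => \sum_(i <- r) F i x) = \sum_(i <- r) mean N (F i).
Proof.
move=> Fu; elim: r => [|i r [IHu IH]].
  have -> : (fun x => \sum_(i <- [::]) F i x) = (fun=> 0).
    by apply: funext => x; rewrite big_nil.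
  by rewrite big_nil (mean_cst _ hN); split=> //; apply: ucont_cst.
have -> : (fun x => \sum_(i <- i :: r) F i x) = (fun x => F i x + \sum_(i <- r) F i x).
  by apply: funext => x; rewrite big_cons.
by rewrite big_cons -IH (mean_add tb hN) //; split=> //; apply: ucontD.
Qed.

Lemma ucont_scale c (f : G -> E) : ucont N f -> ucont N (fun x => c *: f x).
Proof.
move=> fu; apply: (ucont_linear hN (T := fun x => c *: x) (K := normc c)) fu.
- by move=> x y; rewrite scalerBr.
- by move=> x; rewrite (cn_scale hN).
Qed.

Definition jointly_ucont (F : G -> G -> E) :=
  (exists K, forall x y, N (F x y) <= K) /\
  forall e, 0 < e -> exists2 U : set G, nbhs 0 U &
    forall a b, U a -> U b -> forall x y, N (F (x + a) (y + b) - F x y) <= e.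

Lemma jointly_ucont_swap F : jointly_ucont F -> jointly_ucont (fun x y => F y x).
Proof.
move=> [[K FK] Fu]; split; first by exists K.
by move=> e /Fu[U U0 hU]; exists U => // a b Ua Ub x y; apply: hU.
Qed.

Lemma jointly_ucont_section F x : jointly_ucont F -> ucont N (F x).
Proof.
move=> [_ Fu] e /Fu[U U0 hU]; exists U => // b Ub y.
by have := hU 0 b (nbhs_singleton U0) Ub x y; rewrite addr0.
Qed.

Lemma jointly_ucont_mean F : jointly_ucont F -> ucont N (fun x => mean N (F x)).
Proof.
move=> hF e e0; have [_ /(_ _ e0)[U U0 hU]] := hF; exists U => // a Ua x.
have hF' z := jointly_ucont_section z hF.
rewrite -scaleN1r -(mean_scale tb hN) // -(mean_add tb hN) //; last exact: ucont_scale.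
apply: (mean_le tb hN) => [|y]; first by apply: ucontD => //; apply: ucont_scale.
by rewrite scaleN1r; have := hU a 0 Ua (nbhs_singleton U0) x y; rewrite addr0.
Qed.

(** A single finite set S approximates the mean of every section up to 3 e. A finite sum commutes
    with the outer mean, so the two iterated means differ by at most 3 e + 3 e. *)
Lemma mean_fubini F : jointly_ucont F ->
  mean N (fun x => mean N (F x)) = mean N (fun y => mean N (fun x => F x y)).
Proof.
move=> hF; have hF' := jointly_ucont_swap hF.
have [[K FK] Fu] := hF.
have u1 := jointly_ucont_mean hF; have u2 := jointly_ucont_mean hF'.
have su x := jointly_ucont_section x hF.
have su' y := jointly_ucont_section y hF'.
apply/eqP; rewrite -subr_eq0; apply/eqP; apply: (cn_small_mul hN (K := 6)) => e e0.
have [U U0 hU] := Fu _ e0.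
have U00 := nbhs_singleton U0.
have [S S0 hS] := mean_approx tb hN K U0 e0.
have -> : 6 * e = 3 * e + 3 * e by rewrite -mulrDl -natrD.
apply: le_trans (cn_dist3 hN (avg S (fun y => mean N (fun x => F x y)) 0) _ _) _.
apply: lerD; last first.
  apply: hS => //.
    move=> a Ua y.
    rewrite -scaleN1r -(mean_scale tb hN) // -(mean_add tb hN) //; last exact: ucont_scale.
    apply: (mean_le tb hN) => [|x]; first by apply: ucontD => //; apply: ucont_scale.
    by rewrite scaleN1r; have := hU 0 a U00 Ua x y; rewrite addr0.
  by move=> y; apply: (mean_le tb hN).
have [us ms] := mean_sum S (fun a => su' (0 + a)).
rewrite /avg -ms -(mean_scale tb hN) // (cn_distC hN).
have us' := ucont_scale ((size S)%:R^-1) us.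
rewrite -[X in _ - X]scale1r -scaleNr -(mean_scale tb hN) // -(mean_add tb hN) //; last exact: ucont_scale.
apply: (mean_le tb hN) => [|x]; first by apply: ucontD => //; apply: ucont_scale.
rewrite scaleN1r; apply: (hS (F x)) => // a Ua y.
by have := hU 0 a U00 Ua x y; rewrite addr0.
Qed.

End Fubini.

Section Convolution.
Variables (R : realType) (G : topologicalZmodType).
Local Notation C := (R[i]^o).
Local Notation ucs := (@ucont R G C (@normc R)).
Let hC := complete_normc R.

Definition ucont_pred : {pred G -> C} := fun f => `[< ucs f >].

Lemma ucont_submod_closed : submod_closed ucont_pred.
Proof.
split=> [|c f g /asboolP fu /asboolP gu]; apply/asboolP; first exact: ucont_cst.
by apply: (ucontD hC) => //; apply: (ucont_scale hC).
Qed.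

HB.instance Definition _ := GRing.isSubmodClosed.Build _ _ ucont_pred
  ucont_submod_closed.

Record ucfun := UCFun { uc_val :> G -> C ; uc_valP : uc_val \in ucont_pred }.
HB.instance Definition _ := [isSub for uc_val].
HB.instance Definition _ := [Choice of ucfun by <:].
HB.instance Definition _ := [SubChoice_isSubLmodule of ucfun by <:].

End Convolution.

(** * The convolution algebra *)

Section ConvolutionTheory.
Variables (R : realType) (G : topologicalZmodType).
Hypothesis tb : totally_bounded G.
Local Notation C := (R[i]^o).
Local Notation ucs := (@ucont R G C (@normc R)).
Local Notation T := (ucfun R G).
Local Notation mu := (@mean R G C (@normc R)).
Let hC := complete_normc R.
Implicit Types f g h : T.

Lemma uc_ucont f : ucs f.
Proof. exact/asboolP/(uc_valP f). Qed.
Hint Resolve uc_ucont : core.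

Lemma ucfunP f g : (forall x, f x = g x) -> f = g.
Proof. by move=> h; apply/val_inj/funext. Qed.

(** The lock keeps conversion from unfolding into means; values are read off by [mkucE]. *)
Definition mkuc (f : G -> C) (fu : ucs f) : T :=
  locked (UCFun (asboolT fu : f \in @ucont_pred R G)).

Lemma mkucE (f : G -> C) (fu : ucs f) x : mkuc fu x = f x.
Proof. by rewrite /mkuc -lock. Qed.

Lemma ucDE f g x : (f + g) x = f x + g x. Proof. by []. Qed.
Lemma ucBE f g x : (f - g) x = f x - g x. Proof. by []. Qed.
Lemma ucZE (c : R[i]) f x : (c *: f) x = c * f x. Proof. by []. Qed.
Lemma uc0E x : (0 : T) x = 0. Proof. by []. Qed.
Lemma uc_bounded f : exists2 K, 0 <= K & forall x, normc (f x) <= K.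
Proof.
have [K fK] := ucont_bounded tb hC (uc_ucont f); exists K => //.
exact: le_trans (normc_ge0 _) (fK 0).
Qed.

Lemma ucont_mul (f g : G -> C) : ucs f -> ucs g -> ucs (fun x => f x * g x).
Proof.
apply: (ucont_bilinear tb hC hC hC) => [x x' y|x y y'|x y].
- by rewrite mulrBl.
- by rewrite mulrBr.
- by rewrite normcM.
Qed.

Lemma ucont_conj (f : G -> C) : ucs f -> ucs (fun x => (f x)^*%C).
Proof.
apply: (ucont_linear hC (T := fun z : C => z^*%C : C) (K := 1)) => [x y|x].
  by rewrite rmorphB.
by rewrite normc_conj mul1r.
Qed.

Lemma mean_conj (f : G -> C) : ucs f -> mu (fun x => (f x)^*%C) = (mu f)^*%C.
Proof.
apply: (mean_linear tb hC hC (T := fun z : C => z^*%C : C) (K := 1)) => [x y|n x|x].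
- by rewrite rmorphB.
- have nE : (n%:R^-1 : R[i])^*%C = n%:R^-1 by rewrite conjc_inv conjc_nat.
  transitivity ((n%:R^-1 : R[i])^*%C * x^*%C); first exact: rmorphM.
  by rewrite nE.
- by rewrite normc_conj mul1r.
Qed.

Lemma mean_scalar (f : G -> C) (c : R[i]) : ucs f -> mu (fun x => c * f x) = c * mu f.
Proof. exact: (mean_scale tb hC). Qed.

Lemma ucont_reflect (f : G -> C) x : ucs f -> ucs (fun y => f (x - y)).
Proof.
move=> fu; have := ucont_opp hC (ucont_shift (- x) fu).
have : ucs (fun y => f (- y + x)).
  exact: (ucont_opp hC (ucont_shift x fu)).
by move=> h _; under eq_fun do rewrite addrC.
Qed.

Lemma convol_ucont f g : ucs (fun x => mu (fun y => f y * g (x - y))).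
Proof.
have [K K0 fK] := uc_bounded f.
move=> e e0; have K1 : 0 < K + 1 by rewrite ltr_wpDl.
have [U U0 hU] := uc_ucont g (divr_gt0 e0 K1).
exists U => // a Ua x.
have u z : ucs (fun y => f y * g (z - y)) by apply: ucont_mul => //; apply: ucont_reflect.
rewrite -scaleN1r -(mean_scale tb hC) // -(mean_add tb hC) //; last exact: (ucont_scale hC).
apply: (mean_le tb hC) => [|y]; first by apply: (ucontD hC) => //; apply: (ucont_scale hC).
rewrite scaleN1r -mulrBr normcM addrAC.
have -> : e = (K + 1) * (e / (K + 1)) by rewrite mulrC divfK // gt_eqF.
by apply: ler_pM; rewrite ?normc_ge0 ?hU //; apply: le_trans (fK _) _; rewrite lerDl.
Qed.

Definition convol f g : T := mkuc (convol_ucont f g).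
Local Notation "f ** g" := (convol f g) (at level 40, left associativity).

Lemma convolE f g x : (f ** g) x = mu (fun y => f y * g (x - y)).
Proof. exact: mkucE. Qed.

Lemma convol_integrand f g x : ucs (fun y => f y * g (x - y)).
Proof. by apply: ucont_mul => //; apply: ucont_reflect. Qed.
Hint Resolve convol_integrand : core.

(** The substitution of x - y for y is a translation by x followed by a reflection, and the mean is
    invariant under both. *)
Lemma convolC f g : f ** g = g ** f.
Proof.
apply: ucfunP => x; rewrite !convolE.
rewrite -(mean_shift tb hC x (convol_integrand g f x)).
rewrite -[RHS](mean_opp tb hC); last exact: (ucont_shift x (convol_integrand g f x)).
congr (mean _ _); apply: funext => y.
by rewrite [- y + x]addrC subKr mulrC.
Qed.

Lemma convolDl f g h : (f + g) ** h = f ** h + g ** h.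
Proof.
apply: ucfunP => x; rewrite ucDE !convolE -(mean_add tb hC); [|exact: convol_integrand..].
by congr (mean _ _); apply: funext => y; rewrite ucDE mulrDl.
Qed.

Lemma convolZl (c : R[i]) f g : (c *: f) ** g = c *: (f ** g).
Proof.
apply: ucfunP => x; rewrite ucZE !convolE -mean_scalar; last exact: convol_integrand.
by congr (mean _ _); apply: funext => y; rewrite ucZE mulrA.
Qed.

Lemma convolDr f g h : h ** (f + g) = h ** f + h ** g.
Proof. by rewrite convolC convolDl ![_ ** h]convolC. Qed.

Lemma convolZr (c : R[i]) f g : g ** (c *: f) = c *: (g ** f).
Proof. by rewrite convolC convolZl [f ** _]convolC. Qed.

Lemma convolNl f g : (- f) ** g = - (f ** g).
Proof. by rewrite -scaleN1r convolZl scaleN1r. Qed.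

Lemma convolBl f g h : (f - g) ** h = f ** h - g ** h.
Proof. by rewrite convolDl convolNl. Qed.

Lemma convolBr f g h : h ** (f - g) = h ** f - h ** g.
Proof. by rewrite convolC convolBl ![_ ** h]convolC. Qed.

Lemma convol0l f : 0 ** f = 0.
Proof. by rewrite -(scale0r (0 : T)) convolZl !scale0r. Qed.

Lemma convol0r f : f ** 0 = 0.
Proof. by rewrite convolC convol0l. Qed.

Local Notation juc := (@jointly_ucont R G C (@normc R)).

Lemma jointly_ucont_mul F F' : juc F -> juc F' -> juc (fun x y => F x y * F' x y).
Proof.
move=> [[K FK] Fu] [[K' FK'] Fu'].
have K0 : 0 <= K by apply: le_trans (FK 0 0); apply: normc_ge0.
have K'0 : 0 <= K' by apply: le_trans (FK' 0 0); apply: normc_ge0.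
split.
  by exists (K * K') => x y; rewrite normcM; apply: ler_pM; rewrite ?normc_ge0.
move=> e e0; have p1 : 0 < K + K' + 1 by rewrite ltr_wpDl ?addr_ge0.
have d0 : 0 < e / (K + K' + 1) by rewrite divr_gt0.
have eE : e = (K + K' + 1) * (e / (K + K' + 1)) by rewrite mulrC divfK // gt_eqF.
set d := e / _ in d0 eE.
have [U U0 hU] := Fu _ d0; have [V V0 hV] := Fu' _ d0.
exists (U `&` V); first exact: filterI.
move=> a b [Ua Va] [Ub Vb] x y.
set p := F (x + a) _; set q := F' (x + a) _.
have -> : p * q - F x y * F' x y = (p - F x y) * q + F x y * (q - F' x y).
  by rewrite mulrBl mulrBr addrA subrK.
apply: le_trans (normcD _ _) _; rewrite !normcM.
have h1 : normc (p - F x y) * normc q <= d * K' by apply: ler_pM; rewrite ?normc_ge0 ?hU ?FK'.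
have h2 : normc (F x y) * normc (q - F' x y) <= K * d by apply: ler_pM; rewrite ?normc_ge0 ?hV ?FK.
by apply: le_trans (lerD h1 h2) _; move: d0 eE; lra.
Qed.

Lemma jointly_ucont_fst f : juc (fun x _ => f x).
Proof.
have [K K0 fK] := uc_bounded f; split; first by exists K.
by move=> e /(uc_ucont f)[U U0 hU]; exists U => // a b Ua _ x y; apply: hU.
Qed.

Lemma jointly_ucont_snd f x : juc (fun _ y => f (x - y)).
Proof.
have [K K0 fK] := uc_bounded f; split; first by exists K.
move=> e /(ucont_reflect x (uc_ucont f))[U U0 hU].
by exists U => // a b _ Ub z y; apply: hU.
Qed.

Lemma jointly_ucont_sub f : juc (fun x y => f (y - x)).
Proof.
have [K K0 fK] := uc_bounded f; split; first by exists K.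
move=> e e0; have e2 : 0 < e / 2 by rewrite divr_gt0.
have [U U0 hU] := uc_ucont f e2.
exists U => // a b Ua Ub x y.
rewrite (splitr e).
have -> : y + b - (x + a) = y - x - a + b by rewrite opprD addrA (addrAC y) addrAC.
apply: le_trans (cn_dist3 hC (f (y - x - a)) _ _) _; apply: lerD.
  exact: hU.
by rewrite (cn_distC hC); have := hU a Ua (y - x - a); rewrite subrK.
Qed.

(** After the inner variable is translated by z, the two sides are the iterated means of the same
    jointly uniformly continuous function of z and y, in the two orders. *)
Lemma convolA f g h : f ** (g ** h) = (f ** g) ** h.
Proof.
apply: ucfunP => x; rewrite !convolE.
pose F z y := f z * g (y - z) * h (x - y).
have hF : juc F.
  by do 2?apply: jointly_ucont_mul; [apply: jointly_ucont_fst|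
    apply: jointly_ucont_sub|apply: jointly_ucont_snd].
transitivity (mu (fun z => mu (F z))).
  congr (mean _ _); apply: funext => z.
  rewrite convolE -mean_scalar; last exact: convol_integrand.
  rewrite -[RHS](mean_shift tb hC z); last exact: jointly_ucont_section hF.
  congr (mean _ _); apply: funext => w.
  by rewrite /F addrK mulrA opprD addrA addrAC.
rewrite (mean_fubini tb hC hF); congr (mean _ _); apply: funext => y.
rewrite convolE mulrC -mean_scalar; last exact: convol_integrand.
congr (mean _ _); apply: funext => z.
by rewrite /F mulrC.
Qed.

Definition sh a f : T := mkuc (ucont_shift a (uc_ucont f)).

Lemma shE a f x : sh a f x = f (x + a). Proof. exact: mkucE. Qed.

Lemma ucadj_ucont f : ucs (fun x => (f (- x))^*%C).
Proof. exact/ucont_conj/(ucont_opp hC). Qed.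

Definition ucadj f : T := mkuc (ucadj_ucont f).

Lemma ucadjE f x : ucadj f x = (f (- x))^*%C. Proof. exact: mkucE. Qed.

Lemma ucadjK f : ucadj (ucadj f) = f.
Proof. by apply: ucfunP => x; rewrite !ucadjE opprK conjcK. Qed.

Lemma ucadjD f g : ucadj (f + g) = ucadj f + ucadj g.
Proof. by apply: ucfunP => x; rewrite ucDE !ucadjE ucDE rmorphD. Qed.

Lemma ucadjB f g : ucadj (f - g) = ucadj f - ucadj g.
Proof. by apply: ucfunP => x; rewrite ucBE !ucadjE ucBE rmorphB. Qed.

Lemma ucadjZ (c : R[i]) f : ucadj (c *: f) = c^*%C *: ucadj f.
Proof. by apply: ucfunP => x; rewrite ucZE !ucadjE ucZE rmorphM. Qed.

Lemma ucadj0 : ucadj 0 = 0.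
Proof. by apply: ucfunP => x; rewrite ucadjE !uc0E conjc0. Qed.

Lemma ucadj_convol f g : ucadj (f ** g) = ucadj f ** ucadj g.
Proof.
apply: ucfunP => x; rewrite ucadjE !convolE -mean_conj; last exact: convol_integrand.
rewrite -(mean_opp tb hC); last exact: ucont_conj.
congr (mean _ _); apply: funext => y.
by rewrite rmorphM /= !ucadjE opprB opprK [- x + y]addrC.
Qed.

Lemma sh_convol a f g : sh a (f ** g) = sh a f ** g.
Proof.
apply: ucfunP => x; rewrite shE !convolE.
rewrite -(mean_shift tb hC a); last exact: convol_integrand.
congr (mean _ _); apply: funext => y.
by rewrite shE opprD addrACA subrr addr0.
Qed.

Lemma shB a f g : sh a (f - g) = sh a f - sh a g.
Proof. by apply: ucfunP => x; rewrite shE ![in LHS]ucBE [RHS]ucBE !shE. Qed.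

Lemma shZ a (c : R[i]) f : sh a (c *: f) = c *: sh a f.
Proof. by apply: ucfunP => x; rewrite shE [LHS]ucZE [RHS]ucZE shE. Qed.

(** The inner product of L^2(G), written as a value of a convolution so that identities in the
    convolution algebra turn directly into identities of inner products. *)
Definition ip f g : R[i] := (f ** ucadj g) 0.
Definition n2 f : R := Re (ip f f).

Lemma n2E f : n2 f = Re (ip f f). Proof. by []. Qed.

Lemma ipE f g : ip f g = mu (fun y => f y * (g y)^*%C).
Proof.
by rewrite /ip convolE; congr (mean _ _); apply: funext => y; rewrite ucadjE sub0r opprK.
Qed.

Lemma ip_integrand f g : ucs (fun y => f y * (g y)^*%C).
Proof. by apply: ucont_mul => //; apply: ucont_conj. Qed.
Hint Resolve ip_integrand : core.

Lemma ipC f g : ip g f = (ip f g)^*%C.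
Proof.
rewrite !ipE -mean_conj; last exact: ip_integrand.
congr (mean _ _); apply: funext => y.
by rewrite rmorphM /= conjcK mulrC.
Qed.

Lemma ipBl f g h : ip (f - g) h = ip f h - ip g h.
Proof. by rewrite /ip convolBl. Qed.

Lemma ipZl (c : R[i]) f h : ip (c *: f) h = c * ip f h.
Proof. by rewrite /ip convolZl. Qed.

Lemma ipBr f g h : ip h (f - g) = ip h f - ip h g.
Proof. by rewrite /ip ucadjB convolBr. Qed.

Lemma ipZr (c : R[i]) f h : ip h (c *: f) = c^*%C * ip h f.
Proof. by rewrite /ip ucadjZ convolZr. Qed.

Lemma ip_real f : ip f f = (n2 f)%:C%C.
Proof.
have := ipC f f; rewrite /n2; case: (ip f f) => a b /= [] /eqP.
by rewrite -addr_eq0 -mulr2n mulrn_eq0 /= => /eqP ->.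
Qed.

(** Means are controlled only through [mean_le], an upper bound on moduli. A real function with
    values between k and K stays within (K - k)/2 of the midpoint, hence so does its mean, and a
    lower bound follows. *)
Lemma mean_ge (f : G -> C) (r : G -> R) k : ucs f -> (forall x, f x = (r x)%:C%C) ->
  (forall x, k <= r x) -> k <= Re (mu f).
Proof.
move=> fu fr kr; have [K fK] := ucont_bounded tb hC fu.
have Kr x : r x <= K by apply: le_trans (ler_norm _) _; rewrite -normc_real -fr.
have : normc (mu f - ((K + k) / 2)%:C%C) <= (K - k) / 2.
  have := mean_cst G hC ((- ((K + k) / 2))%:C%C : C).
  rewrite realcN => <-; rewrite -(mean_add tb hC) //; last exact: ucont_cst.
  apply: (mean_le tb hC) => [|x].
    by apply: (ucontD hC) => //; apply: ucont_cst.
  rewrite fr -realcB normc_real ler_norml.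
  by have := Kr x; have := kr x; lra.
move=> /(le_trans (Re_abs_le_normc _)).
rewrite ler_norml ReB /= => /andP[h _]; move: h; lra.
Qed.

(** The translates of U by L cover G, so the sum of the corresponding translates of the squared
    modulus of f is at least [d ^+ 2] everywhere. Its mean is [size L] times [n2 f]. *)
Lemma n2_lower f (U : set G) (L : seq G) d : 0 <= d ->
  (forall x, exists2 y, y \in L & U (x - y)) ->
  (forall a, U a -> d <= normc (f a)) -> d ^+ 2 <= (size L)%:R * n2 f.
Proof.
move=> d0 hL hU.
have fE y : f y * (f y)^*%C = (normc (f y) ^+ 2)%:C%C by apply: mulc_conj.
pose F (h : G) y : C := f (y - h) * (f (y - h))^*%C.
have Fu (z : G) : ucs (F z) by apply: (ucont_shift (- z) (ip_integrand f f)).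
have [Su Sm] := mean_sum tb hC L Fu.
have : d ^+ 2 <= Re (mu (fun y => \sum_(z <- L) F z y)).
  apply: (mean_ge (r := fun y => \sum_(z <- L) normc (f (y - z)) ^+ 2)) => // y.
    by rewrite realc_sum; apply: eq_bigr => z _; rewrite /F fE.
  have [z zin Uz] := hL y.
  rewrite (big_rem z) //=; apply: le_trans (_ : normc (f (y - z)) ^+ 2 <= _).
    by rewrite lerXn2r ?nnegrE ?normc_ge0 ?hU.
  by rewrite lerDl sumr_ge0 // => i _; apply: sqr_ge0.
have -> : mu (fun y => \sum_(z <- L) F z y) = \sum_(z <- L) (n2 f)%:C%C.
  rewrite Sm; apply: eq_bigr => z _.
  by rewrite (mean_shift tb hC (- z) (ip_integrand f f)) -ipE ip_real.
by rewrite -realc_sum /= big_const_seq count_predT iter_addr_0 mulr_natl.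
Qed.

Lemma n2_ge0 f : 0 <= n2 f.
Proof.
rewrite /n2 ipE; apply: (mean_ge (r := fun y => normc (f y) ^+ 2)) => // y.
  exact: mulc_conj.
exact: sqr_ge0.
Qed.

Lemma n2_le f K : (forall x, normc (f x) <= K) -> n2 f <= K ^+ 2.
Proof.
move=> fK; apply: le_trans (Re_le_normc _) _; rewrite ipE.
apply: (mean_le tb hC) => // x; rewrite normcM normc_conj -expr2.
by rewrite lerXn2r ?nnegrE ?normc_ge0 //; apply: le_trans (fK 0); apply: normc_ge0.
Qed.

Lemma n2_sh a f : n2 (sh a f) = n2 f.
Proof.
rewrite /n2 !ipE -(mean_shift tb hC a (ip_integrand f f)).
by congr (Re (mean _ _)); apply: funext => y; rewrite shE.
Qed.

Lemma n2_adj f : n2 (ucadj f) = n2 f.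
Proof. by rewrite /n2 /ip ucadjK convolC. Qed.

Lemma n2_eq0 f : n2 f = 0 -> f = 0.
Proof.
move=> f0; apply: ucfunP => a; rewrite uc0E; apply/eqP; rewrite -normc_eq0.
rewrite eq_le normc_ge0 andbT leNgt; apply/negP => fa.
have d0 : 0 < normc (f a) / 2 by rewrite divr_gt0.
(* The translate is at least half of its value at 0 on U, so [n2_lower] forces [n2 f] to be
   positive. *)
have [U U0 hU] := uc_ucont (sh a f) d0.
have [L hL] := tb U0.
have := @n2_lower (sh a f) U L _ (ltW d0) hL; rewrite n2_sh f0 mulr0.
rewrite leNgt exprn_gt0 // => h; suff : false by []; apply: h => b Ub.
have := hU b Ub 0; rewrite !shE !add0r => h.
have := normcD (f (b + a)) (f a - f (b + a)); rewrite addrC subrK.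
by move: h; rewrite (cn_distC hC); move: fa; lra.
Qed.

Lemma n2_gt0 f : f != 0 -> 0 < n2 f.
Proof.
move=> f0; rewrite lt_def n2_ge0 andbT; apply: contraNneq f0 => /n2_eq0 ->.
exact: eqxx.
Qed.

Lemma n2Z (c : R[i]) f : n2 (c *: f) = normc c ^+ 2 * n2 f.
Proof.
apply: (@complexI R); rewrite -ip_real ipZl ipZr mulrA mulc_conj ip_real.
by rewrite -realcM.
Qed.

Lemma n2B f g : n2 (f - g) = n2 f + n2 g - 2 * Re (ip f g).
Proof.
rewrite /n2 ipBl !ipBr !ReB (ipC f g).
by case: (ip f g) => a b /=; ring.
Qed.

Lemma cauchy_schwarz f g : normc (ip f g) ^+ 2 <= n2 f * n2 g.
Proof.
have [->|g0] := eqVneq g 0.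
  by rewrite /ip ucadj0 convol0r uc0E normc0 expr0n mulr_ge0 ?n2_ge0.
have n0 := n2_gt0 g0.
have := n2_ge0 ((n2 g)%:C%C *: f - ip f g *: g).
rewrite n2B !n2Z normc_real ger0_norm ?n2_ge0 // ipZl ipZr.
rewrite [_^*%C * _]mulrC mulc_conj -realcM /=.
rewrite -subr_ge0 => h; rewrite -subr_ge0 -(pmulr_rge0 _ n0).
by move: h; congr (0 <= _); ring.
Qed.

(** The value at x is the inner product of f with a translated adjoint of g, so Cauchy-Schwarz
    applies. This turns L^2 estimates into uniform ones throughout. *)
Lemma convol_bound f g x : normc ((f ** g) x) ^+ 2 <= n2 f * n2 g.
Proof.
have -> : (f ** g) x = ip f (ucadj (sh x g)).
  by rewrite /ip ucadjK [f ** sh x g]convolC -sh_convol shE add0r convolC.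
by rewrite -(n2_sh x g) -(n2_adj (sh x g)); apply: cauchy_schwarz.
Qed.

Lemma convol_sup f g e K x : (forall y, normc (f y) <= e) ->
  (forall y, normc (g y) <= K) -> normc ((f ** g) x) <= e * K.
Proof.
move=> fe gK; rewrite convolE.
apply: (mean_le tb hC) => [|y]; first exact: convol_integrand.
by rewrite normcM; apply: ler_pM; rewrite ?normc_ge0.
Qed.

End ConvolutionTheory.

(** * Idempotents and characters *)

Section TopIdempotent.
Variables (R : realType) (G : topologicalZmodType).
Hypothesis tb : totally_bounded G.
Local Notation C := (R[i]^o).
Local Notation T := (ucfun R G).
Local Notation "f ** g" := (convol tb f g) (at level 40, left associativity).
Local Notation ucadj := (@ucadj R G).
Local Notation n2 := (n2 tb).
Local Notation ip := (ip tb).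
Let hC := complete_normc R.
Implicit Types f g h p : T.

Definition tends (F : nat -> T) f := forall e : R, 0 < e ->
  exists n, forall i, (n <= i)%N -> forall x, normc (F i x - f x) <= e.

Lemma tends_unique F f g : tends F f -> tends F g -> f = g.
Proof.
move=> hf hg; apply: ucfunP => x; apply: (cn_close_eq hC) => e e0.
have e2 : 0 < e / 2 by rewrite divr_gt0.
have [n1 h1] := hf _ e2; have [n2 h2] := hg _ e2.
rewrite (splitr e); apply: le_trans (cn_dist3 hC (F (maxn n1 n2) x) _ _) _.
by apply: lerD; [rewrite (cn_distC hC) h1 ?leq_maxl|rewrite h2 ?leq_maxr].
Qed.

Lemma tends_sub F f (k : nat -> nat) : (forall n, (n <= k n)%N) -> tends F f ->
  tends (fun n => F (k n)) f.
Proof.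
by move=> hk hf e /hf[n hn]; exists n => i ni; apply: hn; apply: leq_trans (hk i).
Qed.

Lemma tends_cst f : tends (fun=> f) f.
Proof. by move=> e e0; exists 0%N => i _ x; rewrite subrr normc0 ltW. Qed.

Lemma tends_conv F F' f f' : tends F f -> tends F' f' ->
  tends (fun n => F n ** F' n) (f ** f').
Proof.
move=> hf hf' e e0.
have [K K0 fK] := uc_bounded tb f; have [K' K'0 fK'] := uc_bounded tb f'.
have p1 : 0 < K + K' + 1 by rewrite ltr_wpDl ?addr_ge0.
have d0 : 0 < Num.min 1 (e / (K + K' + 1)) by rewrite lt_min ltr01 divr_gt0.
set d := Num.min _ _ in d0.
have d1 : d <= 1 by rewrite ge_min lexx.
have dE : (K + K' + 1) * d <= e.
  by rewrite mulrC -ler_pdivlMr // ge_min lexx orbT.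
have [n1 h1] := hf _ d0; have [m2 h2] := hf' _ d0.
exists (maxn n1 m2) => i; rewrite geq_max => /andP[i1 i2] x.
have -> : (F i ** F' i) x - (f ** f') x =
    ((F i - f) ** F' i) x + (f ** (F' i - f')) x.
  by rewrite convolBl convolBr !ucBE addrA subrK.
apply: le_trans (normcD _ _) _.
have c1 : normc (((F i - f) ** F' i) x) <= d * (K' + d).
  apply: convol_sup => y; first by rewrite ucBE h1.
  rewrite -(subrK (f' y) (F' i y)) addrC; apply: le_trans (normcD _ _) _.
  by rewrite lerD ?h2.
have c2 : normc ((f ** (F' i - f')) x) <= K * d.
  by apply: convol_sup => // y; rewrite ucBE h2.
apply: le_trans (lerD c1 c2) _; move: dE d1 d0 K0; nra.
Qed.

Lemma tends_scale F f (c : R[i]) : tends F f -> tends (fun n => c *: F n) (c *: f).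
Proof.
move=> hf e e0; have c0 : 0 < normc c + 1 by rewrite ltr_wpDl ?normc_ge0.
have [n hn] := hf _ (divr_gt0 e0 c0); exists n => i ni x.
rewrite !ucZE -mulrBr normcM -[leRHS](divfK (lt0r_neq0 c0)) [leRHS]mulrC.
by rewrite ler_pM ?normc_ge0 ?hn // lerDl.
Qed.

Lemma tends_adj F f : tends F f -> tends (fun n => ucadj (F n)) (ucadj f).
Proof.
move=> hf e /hf[n hn]; exists n => i ni x.
by rewrite !ucadjE -rmorphB normc_conj hn.
Qed.

Lemma tends_complete (F : nat -> T) :
  (forall e : R, 0 < e -> exists n, forall i j, (n <= i)%N -> (n <= j)%N ->
    forall x : G, normc (F i x - F j x) <= e) -> exists f, tends F f.
Proof.
move=> hF.
have lim x : exists l : C, forall e : R, 0 < e -> exists n, forall i, (n <= i)%N ->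
    normc (F i x - l) <= e.
  apply: (cn_complete hC) => e /hF[n hn]; exists n => i j ni nj.
  exact: hn.
have [f hf] := choice lim.
have unif (e : R) : 0 < e -> exists n, forall i, (n <= i)%N -> forall x,
    normc (F i x - f x) <= e.
  move=> /hF[n hn]; exists n => i ni x; apply/ler_addgt0Pl => d /(hf x)[m hm].
  apply: le_trans (cn_dist3 hC (F (maxn n m) x) _ _) _.
  by rewrite addrC lerD ?hm ?leq_maxr // hn // leq_maxl.
have fu : @ucont R G C (@normc R) f.
  move=> e e0; have e3 : 0 < e / 3 by rewrite divr_gt0.
  have [n hn] := unif _ e3; have [U U0 hU] := uc_ucont (F n) e3.
  exists U => // a Ua x.
  have -> : e = e / 3 + (e / 3 + e / 3) by field.
  apply: le_trans (cn_dist3 hC (F n (x + a)) _ _) (lerD _ _).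
    by rewrite (cn_distC hC) hn.
  by apply: le_trans (cn_dist3 hC (F n x) _ _) (lerD _ _); [apply: hU|apply: hn].
exists (mkuc fu) => e /unif[n hn]; exists n => i ni x; rewrite mkucE; exact: hn.
Qed.

Section Powers.
Variable h : T.
Hypotheses (hE : ucadj h = h) (h0 : h != 0).

(* [pw n] is the convolution power of exponent [n.+1]. *)
Fixpoint pw n : T := if n is n'.+1 then h ** pw n' else h.

Lemma pw_conv n m : pw n ** pw m = pw (n + m).+1.
Proof. by elim: n => [//|n IH]; rewrite addSn /= -convolA IH. Qed.

Lemma ucadj_pw n : ucadj (pw n) = pw n.
Proof. by elim: n => [//|n IH] /=; rewrite ucadj_convol hE IH. Qed.

(** In terms of the Fourier coefficients of h, which are real, this is the sum of their powers of
    exponent 2 n + 2. The proof uses only that the sequence is logarithmically convex and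
    submultiplicative. *)
Let a n := n2 (pw n).

Let ip_pw n m : ip (pw n) (pw m) = pw (n + m).+1 0.
Proof. by rewrite /ip ucadj_pw pw_conv. Qed.

Let pw_odd n : pw (n + n).+1 0 = (a n)%:C%C.
Proof. by rewrite -ip_pw ip_real. Qed.

Let a_ge0 n : 0 <= a n. Proof. exact: n2_ge0. Qed.

Let a_log n : a n.+1 ^+ 2 <= a n * a n.+2.
Proof.
have := cauchy_schwarz tb (pw n) (pw n.+2).
rewrite ip_pw addnS -addSn pw_odd.
by rewrite normc_real ger0_norm ?a_ge0.
Qed.

Let a_gt0 n : 0 < a n.
Proof.
have a0 : 0 < a 0 by apply: n2_gt0.
have a1 : 0 < a 1.
  apply: n2_gt0; apply/eqP => p0; have := pw_odd 0.
  by rewrite p0 uc0E => /eqP; rewrite eq_sym -normc_eq0 normc_real normr_eq0 gt_eqF.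
suff : 0 < a n /\ 0 < a n.+1 by case.
elim: n => [//|n [IH1 IH2]]; split=> //.
rewrite lt_def a_ge0 andbT; apply/eqP => e.
by have := a_log n; rewrite e mulr0 leNgt exprn_gt0.
Qed.

(** The power of exponent 2 k + 2 is a convolution square, so its sup norm, and with it its L^2
    norm, is at most [a k]. Cauchy-Schwarz is then applied to two such powers. *)
Let a_submul n m : a (n + m).+1 <= a n * a m.
Proof.
have n2a k : n2 (pw (k + k).+1) <= a k ^+ 2.
  apply: n2_le => x; rewrite -(@ler_pXn2r _ 2) ?nnegrE ?normc_ge0 ?a_ge0 //.
  by rewrite -pw_conv; apply: convol_bound.
have := cauchy_schwarz tb (pw (n + n).+1) (pw (m + m).+1).
rewrite ip_pw.
have -> : ((n + n).+1 + (m + m).+1).+1 = ((n + m).+1 + (n + m).+1).+1.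
  by rewrite !addSn !addnS addnACA.
rewrite pw_odd normc_real ger0_norm ?a_ge0 // => H.
rewrite -(@ler_pXn2r _ 2) ?nnegrE ?mulr_ge0 ?a_ge0 //.
apply: le_trans H _; rewrite exprMn; apply: ler_pM; rewrite ?n2_ge0 //.
Qed.

Let r n := a n.+1 / a n.

Let r_gt0 n : 0 < r n. Proof. by rewrite divr_gt0. Qed.

Let r_mono : {homo r : n m / (n <= m)%N >-> n <= m}.
Proof.
apply: homo_leq => [//|x y z|n]; first exact: le_trans.
rewrite /r ler_pdivlMr // mulrAC ler_pdivrMr //.
by rewrite -expr2 mulrC a_log.
Qed.

(** Increasing ratios give [a m * r m ^+ n.+1 <= a (m + n.+1)], submultiplicativity bounds the right
    side by [a n * a m], and [a m] cancels. *)
Let r_prod n m : r m ^+ n.+1 <= a n.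
Proof.
have H k : r m ^+ k * a m <= a (m + k)%N.
  elim: k => [|k IH]; first by rewrite expr0 mul1r addn0.
  rewrite exprS -mulrA addnS -[leRHS](divfK (lt0r_neq0 (a_gt0 (m + k)))).
  apply: ler_pM IH; first exact: ltW.
    by rewrite mulr_ge0 // exprn_ge0 // ltW.
  exact: (r_mono (leq_addr k m)).
rewrite -(ler_pM2r (a_gt0 m)); apply: le_trans (H _) _.
by rewrite addnS mulrC; apply: a_submul.
Qed.

Let r_bounded : has_ubound (range r).
Proof. by exists (a 0) => _ [n _ <-]; have := r_prod 0 n; rewrite expr1. Qed.

(** The largest squared modulus of a Fourier coefficient of h, obtained as a growth rate before any
    character is known. *)
Definition top_ratio := sup (range r).
Local Notation lam := top_ratio.

Let r_cvg : r @ \oo --> lam.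
Proof. exact: nondecreasing_cvgn. Qed.

Let r_le n : r n <= lam.
Proof. by apply: (ub_le_sup r_bounded); exists n. Qed.

Lemma top_ratio_gt0 : 0 < lam.
Proof. exact: lt_le_trans (r_gt0 0) (r_le 0). Qed.
Let lam_gt0 := top_ratio_gt0.

Lemma top_ratio_ge : n2 (h ** h) <= lam * n2 h.
Proof. by have := r_le 0; rewrite /r ler_pdivrMr. Qed.

Let lam_pow n : lam ^+ n.+1 <= a n.
Proof.
have c : (fun m => r m ^+ n.+1) @ \oo --> lam ^+ n.+1.
  by apply: (@continuous_cvg _ _ _ _ _ _ (fun x : R => x ^+ n.+1)) => //;
    apply: exprn_continuous.
by apply: (cvgr_to_le c); apply: nearW => m; apply: r_prod.
Qed.

(** The normalised sequence decreases and stays at least 1: the first makes [psi] a Cauchy sequence,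
    the second keeps its limit away from 0. *)
Let b n := a n / lam ^+ n.+1.

Let b_ge1 n : 1 <= b n.
Proof. by rewrite ler_pdivlMr ?exprn_gt0 // mul1r lam_pow. Qed.

Let b_mono : {homo b : n m / (n <= m)%N >-> n >= m}.
Proof.
apply: homo_leq => [//|y x z xy yz|n]; first exact: le_trans yz xy.
rewrite /b [lam ^+ n.+2]exprS invfM mulrA ler_pM2r ?invr_gt0 ?exprn_gt0 //.
by rewrite ler_pdivrMr // mulrC -ler_pdivrMr //; apply: r_le.
Qed.

Let b_cvg : exists l, forall e, 0 < e -> exists n, forall i, (n <= i)%N -> `|b i - l| <= e.
Proof.
have : cvg (b @ \oo).
  apply: nonincreasing_is_cvgn; first exact: b_mono.
  by exists 1 => _ [n _ <-]; apply: b_ge1.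
move=> /cvg_ex[l bl]; exists l => e e0.
have /cvgrPdist_le/(_ e e0)[n _ hn] := bl.
by exists n => i ni; rewrite distrC; apply: hn.
Qed.

Let psi n : T := ((lam ^+ n.+1)^-1)%:C%C *: pw (n + n).+1.

(** The inner product depends only on n + m, so convergence of [b] alone makes the L^2 distances of
    [psi] tend to 0. *)
Let ip_psi n m : ip (psi n) (psi m) = (b (n + m).+1)%:C%C.
Proof.
rewrite /psi ipZl ipZr conjc_real ip_pw.
have -> : ((n + n).+1 + (m + m).+1).+1 = ((n + m).+1 + (n + m).+1).+1.
  by rewrite !addSn !addnS addnACA.
rewrite pw_odd -!realcM; congr (real_complex _ _).
rewrite mulrA -invfM -exprD mulrC /b; congr (_ / _ ^+ _).
by rewrite addSn addnS.
Qed.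

Let psi_dist n m : n2 (psi n - psi m) = b (n + n).+1 + b (m + m).+1 - 2 * b (n + m).+1.
Proof. by rewrite n2B !n2E !ip_psi. Qed.

Let psi_step n : psi n.+1 = (lam^-1)%:C%C *: (h ** h ** psi n).
Proof.
rewrite /psi convolZr scalerA -realcM -invfM -exprS -[h ** h]/(pw 1) pw_conv.
by rewrite addSn addnS add1n.
Qed.

Let psi_adj n : ucadj (psi n) = psi n.
Proof. by rewrite /psi ucadjZ conjc_real ucadj_pw. Qed.

Let psi_sqr n : psi n ** psi n = psi (n + n).+1.
Proof.
rewrite /psi convolZl convolZr scalerA -realcM -invfM -exprD pw_conv.
by rewrite addSn addnS !addSn !addnS.
Qed.

Let psi_0 n : 1 <= normc (psi n 0).
Proof.
rewrite /psi ucZE pw_odd -realcM normc_real mulrC; apply: le_trans (ler_norm _).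
exact: b_ge1.
Qed.

Lemma top_idempotent : exists f, [/\ f != 0, ucadj f = f, f ** f = f,
  h ** h ** f = (top_ratio)%:C%C *: f & forall p, p ** h = h -> p ** f = f].
Proof.
have [l hl] := b_cvg.
(* The shift by one writes each term as a convolution with [h ** h] through [psi_step], so
   [convol_bound] upgrades the L^2 Cauchy property to a uniform one. *)
have [|f hf] := @tends_complete (fun n => psi n.+1).
  move=> e e0.
  have n2h : 0 < n2 (h ** h) by apply: (a_gt0 1).
  pose d := (e * lam) ^+ 2 / n2 (h ** h).
  have d0 : 0 < d by rewrite divr_gt0 // exprn_gt0 // mulr_gt0.
  have [n hn] := hl _ (divr_gt0 d0 (ltr0n _ 4 : 0 < 4%:R)).
  exists n => i j ni nj x.
  rewrite !psi_step !ucZE -mulrBr -ucBE -convolBr normcM normc_real.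
  rewrite ger0_norm ?invr_ge0 ?(ltW lam_gt0) // ler_pdivrMl //.
  rewrite -(@ler_pXn2r _ 2) ?nnegrE ?normc_ge0 ?mulr_ge0 ?(ltW e0) ?(ltW lam_gt0) //.
  apply: le_trans (convol_bound _ _ _ _) _.
  rewrite mulrC -ler_pdivlMr // [lam * e]mulrC -/d psi_dist.
  have h1 : `|b (i + i).+1 - l| <= d / 4 by apply/hn/(leq_trans ni)/leqW/leq_addr.
  have h2 : `|b (j + j).+1 - l| <= d / 4 by apply/hn/(leq_trans nj)/leqW/leq_addr.
  have h3 : `|b (i + j).+1 - l| <= d / 4 by apply/hn/(leq_trans ni)/leqW/leq_addr.
  move: h1 h2 h3; rewrite !ler_norml => /andP[? ?] /andP[? ?] /andP[? ?]; lra.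
have fA : ucadj f = f.
  by apply: (tends_unique _ hf); have := tends_adj hf; under eq_fun do rewrite psi_adj.
exists f; split=> //.
- apply/eqP => f0; have [n hn] := hf _ (divr_gt0 ltr01 (ltr0n R 2 : 0 < 2%:R)).
  have := hn n (leqnn n) 0; rewrite f0 uc0E subr0.
  by have := psi_0 n.+1; lra.
- apply: tends_unique (tends_conv hf hf) _; under eq_fun do rewrite psi_sqr.
  apply: (tends_sub (k := fun n => (n.+1 + n.+1)%N) _ hf) => n.
  by rewrite addSn leqW // leq_addr.
- have := tends_conv (tends_cst (h ** h)) hf.
  have -> : (fun n => h ** h ** psi n.+1) = (fun n => lam%:C%C *: psi n.+2).
    apply: funext => n; rewrite [psi n.+2]psi_step scalerA -realcM divff ?gt_eqF //.
    by rewrite scale1r.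
  move=> H; apply: tends_unique H _; apply: tends_scale.
  exact: (tends_sub (k := fun n => n.+1) _ hf).
- move=> p ph; apply: (tends_unique _ hf).
  have := tends_conv (tends_cst p) hf.
  have pp n : p ** pw n = pw n by elim: n => [|n IH] //=; rewrite convolA ph.
  by under eq_fun do rewrite convolZr pp.
Qed.

End Powers.
End TopIdempotent.

(** * Minimal idempotents are multiples of characters *)

Section MinimalIdempotent.
Variables (R : realType) (G : topologicalZmodType).
Hypothesis tb : totally_bounded G.
Local Notation C := (R[i]^o).
Local Notation T := (ucfun R G).
Local Notation "f ** g" := (convol tb f g) (at level 40, left associativity).
Local Notation n2 := (n2 tb).
Local Notation ip := (ip tb).
Let hC := complete_normc R.
Implicit Types f g h p q : T.

Definition idem p := ucadj p = p /\ p ** p = p.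

Lemma idem_val0 p : idem p -> p 0 = (n2 p)%:C%C.
Proof. by move=> [pA pp]; rewrite -ip_real /ip pA pp. Qed.

Lemma idem_le p x : idem p -> normc (p x) <= n2 p.
Proof.
move=> [pA pp]; rewrite -(@ler_pXn2r _ 2) ?nnegrE ?normc_ge0 ?n2_ge0 //.
by rewrite -[in leLHS]pp; apply: convol_bound.
Qed.

(** The sup norm of p is at most [n2 p], hence [n2 p] is at most its own square. In Fourier terms
    [n2 p] counts the characters in p. *)
Lemma idem_ge1 p : idem p -> p != 0 -> 1 <= n2 p.
Proof.
move=> hp /(n2_gt0 tb) p0.
have := n2_le tb (fun x => idem_le x hp).
by rewrite expr2 -{1}[n2 p]mul1r ler_pM2r.
Qed.

Lemma idem_sub p q : idem p -> idem q -> p ** q = q -> idem (p - q) /\ n2 (p - q) = n2 p - n2 q.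
Proof.
move=> [pA pp] [qA qq] pq; split.
  split; first by rewrite ucadjB pA qA.
  by rewrite convolBl !convolBr pp pq qq [q ** p]convolC pq subrr subr0.
rewrite n2B /ip qA pq.
have -> : q 0 = (n2 q)%:C%C by apply: idem_val0.
by rewrite /=; ring.
Qed.

Definition minimal_idem p := [/\ idem p, p != 0 &
  forall q, idem q -> q != 0 -> p ** q = q -> q = p].

(** Passing to a proper nonzero subidempotent lowers [n2] by at least 1, by [idem_ge1] for the
    difference, so the descent stops. *)
Lemma minimal_idem_ex p : idem p -> p != 0 ->
  exists2 q, minimal_idem q & p ** q = q.
Proof.
move=> hp p0.
have [n] : exists n : nat, n2 p < n%:R.
  by exists (Num.truncn (n2 p)).+1; apply: truncnS_gt.
elim: n p hp p0 => [|n IH] p hp p0 pn.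
  by have := n2_ge0 tb p; rewrite leNgt pn.
have [[q [hq q0 pq qp]]|H] := pselect (exists q, [/\ idem q, q != 0, p ** q = q & q != p]).
  have [hpq n2pq] := idem_sub hp hq pq.
  have pq0 : p - q != 0 by rewrite subr_eq0 eq_sym.
  have := idem_ge1 hpq pq0; rewrite n2pq => h1.
  have [|q' mq' qq'] := IH q hq q0; first by move: pn h1; rewrite -natr1; lra.
  by exists q' => //; rewrite -qq' convolA pq.
exists p; last by case: hp.
split=> // q hq q0 pq; apply/eqP; apply: contrapT => /negP qp.
by apply: H; exists q.
Qed.

Section Minimal.
Variable p : T.
Hypothesis hp : minimal_idem p.

Let pp : p ** p = p. Proof. by case: hp => -[]. Qed.
Let pA : ucadj p = p. Proof. by case: hp => -[]. Qed.
Let p0 : p != 0. Proof. by case: hp. Qed.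

(** The top idempotent of h lies below p, so it equals p by minimality, and on it [h ** h] acts as a
    scalar. *)
Lemma minimal_sqr h : ucadj h = h -> p ** h = h -> exists c : R[i], h ** h = c *: p.
Proof.
move=> hA ph; have [->|h0] := eqVneq h 0.
  by exists 0; rewrite convol0l scale0r.
have [f [f0 fA ff hf pf]] := top_idempotent tb hA h0.
have fp : f = p by case: hp => _ _; apply=> //; apply: pf.
exists (top_ratio tb h)%:C%C; rewrite -[in RHS]fp -hf fp.
by rewrite -convolA [h ** p]convolC ph.
Qed.

(** Polarisation: p is the unit on h, so the square of h + p minus the square of h is 2 h + p, and
    both squares are multiples of p. *)
Lemma minimal_hermitian h : ucadj h = h -> p ** h = h -> exists c : R[i], h = c *: p.
Proof.
move=> hA ph; have [c hc] := minimal_sqr hA ph.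
have [||c' hc'] := @minimal_sqr (h + p).
- by rewrite ucadjD hA pA.
- by rewrite convolDr ph pp.
exists ((c' - c - 1) / 2).
have : h + h = (c' - c - 1) *: p.
  rewrite !scalerBl scale1r -hc' -hc convolDl !convolDr pp [h ** p]convolC ph.
  by rewrite addrAC addrA addrK -[_ + h + h]addrA [h ** h + _]addrC addrK.
rewrite [_ / 2]mulrC -scalerA => <-; rewrite -mulr2n -(scaler_nat 2 h) scalerA mulVf ?scale1r //.
Qed.

Lemma minimal_scalar f : p ** f = f -> exists c : R[i], f = c *: p.
Proof.
move=> pf; have pfA : p ** ucadj f = ucadj f by rewrite -{1}pA -ucadj_convol pf.
have iJ : ('i%C : R[i])^*%C = - 'i%C by apply/eqP; rewrite eq_complex /= oppr0 !eqxx.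
have i2 : ('i%C : R[i]) * 'i%C = -1 by rewrite -expr2 sqr_i.
have [||c hc] := @minimal_hermitian (f + ucadj f).
- by rewrite ucadjD ucadjK addrC.
- by rewrite convolDr pf pfA.
have [||d hd] := @minimal_hermitian (('i%C : R[i]) *: (f - ucadj f)).
- by rewrite ucadjZ ucadjB ucadjK iJ scaleNr -scalerN opprB.
- by rewrite convolZr convolBr pf pfA.
exists ((c - 'i%C * d) / 2).
have : f + f = (c - 'i%C * d) *: p.
  rewrite scalerBl -hc -scalerA -hd scalerA i2 scaleN1r opprK.
  by rewrite addrACA subrr addr0.
rewrite [_ / 2]mulrC -scalerA => <-; rewrite -mulr2n -(scaler_nat 2 f) scalerA mulVf ?scale1r //.
Qed.

Let p00 : p 0 != 0.
Proof.
have [hi _ _] := hp.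
by rewrite (idem_val0 hi) -normc_eq0 normc_real normr_eq0 gt_eqF // n2_gt0.
Qed.

(** A translate of p is again fixed by convolution with p, hence a multiple of p. Comparing values
    at 0 and at y gives multiplicativity up to [p 0]. *)
Let p_mul x y : p (x + y) * p 0 = p x * p y.
Proof.
have [|c hc] := @minimal_scalar (sh x p).
  by rewrite convolC -sh_convol pp.
have E z : p (z + x) = c * p z by rewrite -shE hc ucZE.
have := E 0; rewrite add0r => Ex; have := E y; rewrite addrC => ->.
by rewrite Ex -!mulrA [p y * _]mulrC.
Qed.

Let chi x : R[i] := p x / p 0.

Let chi_add x y : chi (x + y) = chi x * chi y.
Proof.
rewrite /chi mulrACA -p_mul.
by rewrite -mulrA [p 0 * _]mulrA divff // mul1r.
Qed.

(** Both [chi x] and [chi (- x)] have modulus at most 1 by [idem_le], and their product is 1. *)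
Let chi_norm x : `|chi x| = 1.
Proof.
have [hi _ _] := hp.
have le1 y : normc (chi y) <= 1.
  rewrite /chi normcM normcV (idem_val0 hi) normc_real ger0_norm ?n2_ge0 //.
  by rewrite ler_pdivrMr ?mul1r ?n2_gt0 // idem_le.
rewrite normr_normc; congr (real_complex _ _).
have : normc (chi x) * normc (chi (- x)) = 1.
  by rewrite -normcM -chi_add subrr /chi divff // normc1.
move=> e; apply/eqP; rewrite eq_le le1 /= -e -[leRHS]mulr1.
by rewrite ler_wpM2l ?normc_ge0.
Qed.

Let chi_cont : continuous (chi : G -> C).
Proof.
have chiE y : chi y = ((p 0)^-1 *: p : T) y by rewrite ucZE mulrC.
move=> x; apply/cvgrPdist_le => /= e e0.
have eE : e = (Re e)%:C%C by rewrite RRe_real // gtr0_real.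
have e0' : 0 < Re e by rewrite -ltcR -eE.
have [U U0 hU] := uc_ucont ((p 0)^-1 *: p) e0'.
have := near_sub x U0.
apply: filterS => y Uy.
rewrite normr_normc eE lecR (cn_distC hC) !chiE.
by have := hU _ Uy x; rewrite [x + _]addrC subrK.
Qed.

Definition minimal_character : dualGroup R G := Character chi_cont chi_add chi_norm.

Lemma minimal_characterE x : p x = p 0 * minimal_character x.
Proof. by rewrite /= mulrC divfK. Qed.

End Minimal.

(** * Uniform approximation by trigonometric polynomials *)

Section Characters.
Implicit Type chi : dualGroup R G.

Lemma char0 chi : chi 0 = 1.
Proof.
have := charD chi 0 0; rewrite addr0 => /eqP.
by rewrite -{1}[chi 0]mulr1 -subr_eq0 -mulrBr mulf_eq0 (negbTE (char_unit _ _)) /=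
  subr_eq0 => /eqP.
Qed.

Lemma char_normc chi x : normc (chi x) = 1.
Proof. by apply: (@complexI R); rewrite -normr_normc char_norm. Qed.

Lemma charN chi x : chi (- x) = (chi x)^*%C.
Proof.
apply: (mulfI (char_unit chi x)); rewrite -charD subrr char0 mulc_conj.
by rewrite char_normc expr1n.
Qed.

Lemma char_oppE chi x : (- chi) x = (chi x)^*%C.
Proof.
apply: (mulfI (char_unit chi x)); rewrite mulc_conj char_normc expr1n.
exact: (mulfV (char_unit chi x)).
Qed.

Lemma char_ucont chi : @ucont R G C (@normc R) chi.
Proof.
move=> e e0.
have /cvgrPdist_le/(_ e%:C%C) := @char_continuous _ _ chi 0.
rewrite ltcR => /(_ e0) U0.
exists [set t | `|chi 0 - chi t| <= e%:C%C]; first exact: U0.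
move=> a /=; rewrite char0 normr_normc lecR (cn_distC hC) => h x.
rewrite charD -{2}[chi x]mulr1 -mulrBr normcM char_normc mul1r.
exact: h.
Qed.

Definition uchar chi : T := mkuc (char_ucont chi).

Lemma ucharE chi x : uchar chi x = chi x. Proof. exact: mkucE. Qed.

Lemma ucadj_uchar chi : ucadj (uchar chi) = uchar chi.
Proof. by apply: ucfunP => x; rewrite ucadjE !ucharE charN conjcK. Qed.

(** The Fourier coefficient: chi at - y is the conjugate of chi at y, so the convolution at 0 is the
    mean of f against the conjugate of chi. *)
Definition coef f chi : R[i] := (f ** uchar chi) 0.

Lemma convol_uchar f chi : f ** uchar chi = coef f chi *: uchar chi.
Proof.
apply: ucfunP => x; rewrite ucZE /coef !convolE ucharE mulrC.
rewrite -(mean_scalar tb); last exact: convol_integrand.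
congr (mean _ _); apply: funext => y.
by rewrite !ucharE sub0r charD mulrCA.
Qed.

Lemma n2_uchar chi : n2 (uchar chi) = 1.
Proof.
have -> : n2 (uchar chi) = Re (mean (@normc R) (fun _ : G => 1 : C)).
  rewrite n2E ipE; congr (Re (mean _ _)); apply: funext => x.
  by rewrite !ucharE mulc_conj char_normc expr1n.
by rewrite (mean_cst _ hC).
Qed.

Lemma ip_uchar f chi : ip f (uchar chi) = coef f chi.
Proof. by rewrite /ip ucadj_uchar. Qed.

Lemma coefB f g chi : coef (f - g) chi = coef f chi - coef g chi.
Proof. by rewrite /coef convolBl ucBE. Qed.

Lemma coef_sh a f chi : coef (sh a f) chi = chi a * coef f chi.
Proof.
by rewrite {1}/coef -sh_convol shE add0r convol_uchar ucZE ucharE mulrC.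
Qed.

Lemma coef_hermitian f chi : ucadj f = f -> (coef f chi)^*%C = coef f chi.
Proof.
move=> fA; rewrite /coef -[in RHS]fA -[in RHS](ucadj_uchar chi) -ucadj_convol.
by rewrite ucadjE oppr0.
Qed.

(** A character below the top idempotent of h is an eigenvector of [h ** h] with eigenvalue
    [top_ratio], which is the square of its coefficient, and [top_ratio_ge] bounds that ratio from
    below. *)
Lemma coef_large h : ucadj h = h -> h != 0 ->
  exists chi, n2 (h ** h) <= normc (coef h chi) ^+ 2 * n2 h.
Proof.
move=> hA h0; have [f [f0 fA ff hf _]] := top_idempotent tb hA h0.
have [p mp fp] := minimal_idem_ex (conj fA ff) f0.
have pE : p = p 0 *: uchar (minimal_character mp).
  by apply: ucfunP => x; rewrite ucZE ucharE minimal_characterE.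
set chi := minimal_character mp in pE.
exists chi; apply: le_trans (top_ratio_ge tb hA h0) _.
apply: ler_wpM2r; first exact: n2_ge0.
have : h ** h ** uchar chi = (top_ratio tb h)%:C%C *: uchar chi.
  have e : h ** h ** p = (top_ratio tb h)%:C%C *: p by rewrite -fp convolA hf convolZl.
  have p0 : p 0 != 0.
    by have [_ /eqP pn0 _] := mp; apply/eqP => p0; apply: pn0; rewrite pE p0 scale0r.
  by move: e; rewrite pE convolZr scalerA mulrC -scalerA => /(scalerI p0).
rewrite -convolA !convol_uchar convolZr convol_uchar scalerA => /(congr1 (fun f : T => f 0)).
rewrite !ucZE ucharE char0 !mulr1 => e.
by rewrite expr2 -normcM e normc_real ler_norm.
Qed.

Definition trig f := exists l : seq (R[i] * dualGroup R G),
  f = \sum_(cx <- l) cx.1 *: uchar cx.2.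

Lemma trig0 : trig 0.
Proof. by exists [::]; rewrite big_nil. Qed.

Lemma trigD f g : trig f -> trig g -> trig (f + g).
Proof. by move=> [l ->] [m ->]; exists (l ++ m); rewrite big_cat. Qed.

Lemma trigZ (c : R[i]) chi : trig (c *: uchar chi).
Proof. by exists [:: (c, chi)]; rewrite big_seq1. Qed.

Lemma trig_convol f g : trig g -> trig (f ** g).
Proof.
move=> [l ->]; elim: l => [|[c chi] l IH]; first by rewrite big_nil convol0r; apply: trig0.
rewrite big_cons convolDr; apply: trigD => //=.
by rewrite convolZr convol_uchar scalerA; apply: trigZ.
Qed.

Definition deflate f chi : T := f - coef f chi *: uchar chi.

Lemma n2_deflate f chi : n2 (deflate f chi) = n2 f - normc (coef f chi) ^+ 2.
Proof.
rewrite /deflate n2B n2Z n2_uchar mulr1 ipZr ip_uchar.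
by rewrite [_^*%C * _]mulrC mulc_conj /=; ring.
Qed.

Section Greedy.
Variable k : T.
Hypothesis kA : ucadj k = k.

Let inv f := [/\ ucadj f = f, trig (k - f) &
  forall a, n2 (sh a f - f) <= n2 (sh a k - k)].

(** Characters are eigenvectors of translation, so deflation commutes with [sh a] minus the
    identity. It can only decrease [n2], so the L^2 displacement under translations never exceeds
    that of k. *)
Let inv_deflate f chi : inv f -> inv (deflate f chi).
Proof.
move=> [fA ft fk]; split.
- by rewrite /deflate ucadjB ucadjZ ucadj_uchar fA coef_hermitian.
- by rewrite opprB addrCA addrC; apply: trigD => //; apply: trigZ.
move=> a; apply: le_trans (fk a).
have -> : sh a (deflate f chi) - deflate f chi = deflate (sh a f - f) chi.
  rewrite /deflate shB shZ coefB coef_sh.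
  have -> : sh a (uchar chi) = chi a *: uchar chi.
    by apply: ucfunP => x; rewrite ucZE shE !ucharE charD mulrC.
  rewrite scalerA [coef f chi * _]mulrC scalerBl !opprB.
  by rewrite addrACA [RHS]addrACA; congr (_ + _); rewrite addrC.
by rewrite n2_deflate gerBl sqr_ge0.
Qed.

(* Deflating [f] by the character of [coef_large] lowers [n2 f] by an amount that
   is bounded below while [n2 f >= e]: the translates of [f] move no more than
   those of [k], so [f ** f] stays away from 0 on a fixed neighbourhood of 0. *)
Lemma trig_residual (e : R) : 0 < e -> exists f, [/\ ucadj f = f, trig (k - f) & n2 f < e].
Proof.
move=> e0; apply: contrapT => H.
have big f : inv f -> e <= n2 f.
  by move=> [fA ft _]; rewrite leNgt; apply/negP => fe; apply: H; exists f.
have ik : inv k by split=> //; rewrite subrr; apply: trig0.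
have k0 : 0 < n2 k := lt_le_trans e0 (big _ ik).
(* With displacement at most d and [n2 f <= n2 k], [convol_bound] moves [f ** f] by at most e/2 on
   U, while its value at 0 is [n2 f >= e]. *)
pose d := (e / 2) ^+ 2 / n2 k.
have d0 : 0 < d by rewrite divr_gt0 // exprn_gt0 // divr_gt0.
have sd0 : 0 < Num.sqrt d by rewrite sqrtr_gt0.
have [U U0 hU] := uc_ucont k sd0.
have [L hL] := tb U0.
have n2U a : U a -> n2 (sh a k - k) <= d.
  move=> Ua; rewrite -[leRHS]sqr_sqrtr; last exact: ltW.
  apply: (n2_le tb) => x.
  by rewrite ucBE shE; apply: hU.
have L0 : 0 < (size L)%:R :> R.
  by rewrite ltr0n; have [h + _] := hL 0; case: (L).
(* By [n2_lower], [n2 (f ** f)] is at least [(e / 2) ^+ 2 / size L]. Dividing by [n2 f <= n2 k] in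
   [coef_large] bounds the squared coefficient below by c, independently of f. *)
pose c := (e / 2) ^+ 2 / (size L)%:R / n2 k.
have c0 : 0 < c by rewrite !divr_gt0 // exprn_gt0 // divr_gt0.
have step f : inv f -> n2 f <= n2 k -> exists2 g, inv g & n2 g <= n2 f - c.
  move=> hf fk; have [fA ft fsh] := hf; have fe := big _ hf.
  have f0 : f != 0.
    by apply/eqP => f0; move: (lt_le_trans e0 fe); rewrite f0 n2E /ip convol0l uc0E ltxx.
  have [chi hchi] := coef_large fA f0.
  exists (deflate f chi); first exact: inv_deflate.
  rewrite n2_deflate lerD2l lerN2.
  have n2f0 : 0 < n2 f := lt_le_trans e0 fe.
  have lower a : U a -> e / 2 <= normc ((f ** f) a).
    move=> Ua.
    have v0 : normc ((f ** f) 0) = n2 f.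
      by rewrite -{2}fA -[X in normc X]/(ip f f) ip_real normc_real ger0_norm // ltW.
    have dif : normc ((f ** f) a - (f ** f) 0) <= e / 2.
      rewrite -(@ler_pXn2r _ 2) ?nnegrE ?normc_ge0 ?divr_ge0 ?(ltW e0) //.
      have -> : (f ** f) a - (f ** f) 0 = ((sh a f - f) ** f) 0.
        by rewrite convolBl ucBE -sh_convol shE add0r.
      apply: le_trans (convol_bound _ _ _ _) _.
      apply: le_trans (_ : d * n2 k <= _); last by rewrite divfK // gt_eqF.
      by apply: ler_pM; rewrite ?n2_ge0 //; apply: le_trans (fsh a) (n2U _ Ua).
    have := normcD ((f ** f) a) ((f ** f) 0 - (f ** f) a).
    by rewrite addrC subrK (cn_distC hC) v0; move: dif fe; lra.
  have := n2_lower tb (divr_ge0 (ltW e0) (ler0n _ 2)) hL lower.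
  rewrite -ler_pdivrMl // [_^-1 * _]mulrC => h1.
  rewrite /c ler_pdivrMr //; apply: le_trans h1 _; apply: le_trans hchi _.
  by apply: ler_wpM2l => //; apply: sqr_ge0.
have iter n : exists2 f, inv f & n2 f <= n2 k - n%:R * c.
  elim: n => [|n [f hf fn]]; first by exists k; rewrite // mul0r subr0.
  have [|g hg gf] := step f hf.
    by apply: le_trans fn _; rewrite gerBl mulr_ge0 // ltW.
  by exists g => //; apply: le_trans gf _; move: fn; rewrite -natr1; lra.
have [f hf] := iter (Num.truncn (n2 k / c)).+1.
have := truncnS_gt (n2 k / c); rewrite ltr_pdivrMr // => h1 h2.
by have := n2_ge0 tb f; move: h1 h2; lra.
Qed.

(** Replacing k by the trigonometric k - f in the product leaves exactly the error [f ** f], whose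
    sup norm is at most [n2 f]. Smallness in L^2 thus gives uniform approximation of the convolution
    square. *)
Lemma trig_approx (e : R) : 0 < e ->
  exists2 f, trig f & forall x, normc ((k ** k) x - f x) <= e.
Proof.
move=> /trig_residual[f [fA ft fe]].
exists (k ** (k - f) + f ** (k - f)).
  by apply: trigD; apply: trig_convol.
move=> x; rewrite -ucBE.
have -> : k ** k - (k ** (k - f) + f ** (k - f)) = f ** f.
  by rewrite !convolBr [f ** k]convolC addrA subrK subKr.
rewrite -(@ler_pXn2r _ 2) ?nnegrE ?normc_ge0 ?(le_trans (n2_ge0 tb f) (ltW fe)) //.
apply: le_trans (convol_bound _ _ _ _) _; rewrite -expr2.
by rewrite lerXn2r ?nnegrE ?n2_ge0 ?ltW // (le_lt_trans (n2_ge0 tb f) fe).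
Qed.

End Greedy.
End Characters.
End MinimalIdempotent.

(** * Spectral subspaces *)

Section NormMean.
Variables (R : realType) (G : topologicalZmodType).
Hypothesis tb : totally_bounded G.
Variables (E : lmodType R[i]) (N : E -> R).
Hypothesis hN : complete_norm N.
Local Notation C := (R[i]^o).
Let hC := complete_normc R.

(** The integral triangle inequality with a varying bound r. It holds for finite averages, and one
    double average over S and T approximates both means at once. *)
Lemma mean_norm_le (F : G -> E) (r : G -> R) : ucont N F ->
  @ucont R G C (@normc R) (fun g => (r g)%:C%C) -> (forall g, N (F g) <= r g) ->
  N (mean N F) <= normc (mean (@normc R) (fun g => (r g)%:C%C : C)).
Proof.
move=> Fu ru Fr; apply/ler_addgt0Pr => e e0.
have e2 : 0 < e / 2 by rewrite divr_gt0.
have r0 g : 0 <= r g by apply: le_trans (Fr g); apply: (cn_ge0 hN).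
have [S S0 hS] := meanP tb hN Fu e2; have [T T0 hT] := meanP tb hC ru e2.
set c := mean _ F in hS *; set d := mean _ _ in hT *.
have h1 : N (c - avg S (avg T F) 0) <= e / 2.
  by rewrite avg_comm (cn_distC hN); apply: (avg_close hN).
have h2 : normc (avg S (avg T (fun g => (r g)%:C%C : C)) 0 - d) <= e / 2.
  by apply: (avg_close hC).
have avgE L : (0 < size L)%N -> forall f : G -> R, avg L (fun g => (f g)%:C%C : C) =
    (fun x => ((size L)%:R^-1 * \sum_(a <- L) f (x + a))%:C%C).
  move=> L0 f; apply: funext => x; rewrite /avg realcM realc_sum.
  by rewrite [RHS]/= fmorphV rmorph_nat.
have avg_mono L (f : G -> E) (q : G -> R) : (0 < size L)%N -> (forall g, N (f g) <= q g) ->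
    forall x, N (avg L f x) <= (size L)%:R^-1 * \sum_(a <- L) q (x + a).
  move=> L0 fq x; rewrite /avg (cn_scale hN) normcV normc_nat.
  rewrite ler_wpM2l ?invr_ge0 //; apply: le_trans (cn_sum hN _ _ _) _.
  by apply: ler_sum => a _.
have h3 : N (avg S (avg T F) 0) <= normc (avg S (avg T (fun g => (r g)%:C%C : C)) 0).
  rewrite avgE // avgE // normc_real.
  apply: le_trans (ler_norm _).
  apply: (avg_mono S (avg T F) (fun x => (size T)%:R^-1 * \sum_(b <- T) r (x + b)) S0).
  by move=> x; apply: avg_mono.
rewrite -(subrK (avg S (avg T F) 0) c) (splitr e).
apply: le_trans (cn_triangle hN _ _) _.
have := normcD (avg S (avg T (fun g => (r g)%:C%C : C)) 0 - d) d.
by rewrite subrK; move: h1 h2 h3; lra.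
Qed.

End NormMean.

Section Spectral.
Variables (R : realType) (G : topologicalZmodType).
Hypothesis tb : totally_bounded G.
Variables (A : cstarAlgType R) (alpha : G -> A -> A).
Hypothesis alpha_dyn : dynamical_system alpha.
Local Notation C := (R[i]^o).
Let hC := complete_normc R.
Let hN := complete_rnorm A.
Implicit Types (x y : A) (sigma pi : dualGroup R G).

Lemma csub_setT : closed_subalgebra [set: A].
Proof. by []. Qed.

Let aut g := action_aut alpha_dyn g.

Lemma alphaD g x y : alpha g (x + y) = alpha g x + alpha g y.
Proof. by rewrite (auto_add (aut g)). Qed.

Lemma alphaZ g (c : R[i]) x : alpha g (c *: x) = c *: alpha g x.
Proof. by rewrite (auto_scale csub_setT (aut g)). Qed.

Lemma alphaM g x y : alpha g (x * y) = alpha g x * alpha g y.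
Proof. by rewrite (auto_mul (aut g)). Qed.

Lemma alphaS g x : alpha g (star x) = star (alpha g x).
Proof. by rewrite (auto_star (aut g)). Qed.

Lemma alpha1 g : alpha g 1 = 1.
Proof. by rewrite (auto1 csub_setT (aut g)). Qed.

Lemma alphaB g x y : alpha g (x - y) = alpha g x - alpha g y.
Proof. by rewrite alphaD -scaleN1r alphaZ scaleN1r. Qed.

Lemma alpha_sum g I (r : seq I) (P : pred I) (F : I -> A) :
  alpha g (\sum_(i <- r | P i) F i) = \sum_(i <- r | P i) alpha g (F i).
Proof. by rewrite (auto_sum csub_setT (aut g)). Qed.

Lemma rnorm_alpha g x : rnorm (alpha g x) = rnorm x.
Proof.
have le h y : rnorm (alpha h y) <= rnorm y by apply: (auto_le csub_setT (aut h)).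
apply/eqP; rewrite eq_le le /=.
have := le (- g) (alpha g x).
by rewrite -(actionD alpha_dyn) addNr (action0 alpha_dyn).
Qed.

Lemma fixed_closed_subalgebra : closed_subalgebra (fixed_algebra alpha).
Proof.
split=> [g|x y hx hy g|a x hx g|x y hx hy g|x hx g|x hx g].
- exact: alpha1.
- by rewrite alphaD hx hy.
- by rewrite alphaZ hx.
- by rewrite alphaM hx hy.
- by rewrite alphaS hx.
- apply/eqP; rewrite -subr_eq0; apply/eqP.
  apply: (cn_small_mul hN (K := 2)) => e /hx[y hy ye].
  have -> : alpha g x - x = alpha g (x - y) - (x - y).
    by rewrite alphaB hy opprB addrA subrK.
  apply: le_trans (cn_sub hN _ _) _; rewrite rnorm_alpha (cn_distC hN).
  by move: ye; lra.
Qed.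

(** Continuity of the action at 0 is enough: each [alpha g] is isometric and transports the estimate
    to g. *)
Lemma alpha_ucont x : ucont (@rnorm R A) (fun g => alpha g x).
Proof.
move=> e e0.
have c : (fun gx : G * A => alpha gx.1 gx.2) @ ((0 : G), x) --> alpha 0 x.
  exact: (@action_continuous _ _ _ _ alpha_dyn (0, x)).
have /cvgrPdist_le/(_ e%:C%C) := c.
rewrite ltcR => /(_ e0)[[U V] /= [U0 V0] UV].
exists U => // a Ua; have := UV (a, x) (conj Ua (nbhs_singleton V0)).
rewrite /= (action0 alpha_dyn).
rewrite -[X in X <= _]/(cnorm (x - alpha a x)) cnormE lecR (cn_distC hN) => h g.
by rewrite (actionD alpha_dyn) -alphaB rnorm_alpha.
Qed.

Definition spec sigma : set A := [set x | forall g, alpha g x = sigma g *: x].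

Lemma ucont_scalel (f : G -> C) (F : G -> A) :
  ucont (@normc R) f -> ucont (@rnorm R A) F -> ucont (@rnorm R A) (fun g => (f g : R[i]) *: F g).
Proof.
apply: (ucont_bilinear tb hC hN hN (m := fun (c : C) (x : A) => (c : R[i]) *: x)).
- by move=> c c' x; rewrite scalerBl.
- by move=> c x x'; rewrite scalerBr.
- by move=> c x; rewrite (cn_scale hN).
Qed.

Definition sproj sigma x : A := mean (@rnorm R A) (fun g => (sigma g)^*%C *: alpha g x).

Lemma sproj_ucont sigma x : ucont (@rnorm R A) (fun g => (sigma g)^*%C *: alpha g x).
Proof. by apply: ucont_scalel (alpha_ucont x); apply/ucont_conj/char_ucont. Qed.

Lemma sproj_spec sigma x : spec sigma (sproj sigma x).
Proof.
move=> h; rewrite /sproj.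
rewrite -(mean_linear tb hN hN (T := alpha h) (K := 1)); first last.
- exact: sproj_ucont.
- by move=> y; rewrite rnorm_alpha mul1r.
- by move=> n y; rewrite alphaZ.
- exact: alphaB.
rewrite -(mean_shift tb hN h (sproj_ucont sigma x)).
rewrite -(mean_scale tb hN); last exact: (ucont_shift h (sproj_ucont sigma x)).
congr (mean _ _); apply: funext => g.
rewrite alphaZ -(actionD alpha_dyn) [h + g]addrC charD rmorphM scalerA /=.
by rewrite mulrCA mulc_conj char_normc expr1n mulr1.
Qed.

Lemma sproj_le sigma x : rnorm (sproj sigma x) <= rnorm x.
Proof.
apply: (mean_le tb hN) => [|g]; first exact: sproj_ucont.
by rewrite (cn_scale hN) normc_conj char_normc mul1r rnorm_alpha.
Qed.

Lemma sprojD sigma x y : sproj sigma (x + y) = sproj sigma x + sproj sigma y.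
Proof.
rewrite /sproj -(mean_add tb hN); [|exact: sproj_ucont..].
by congr (mean _ _); apply: funext => g; rewrite alphaD scalerDr.
Qed.

Lemma sproj_id sigma x : spec sigma x -> sproj sigma x = x.
Proof.
move=> hx; rewrite -[RHS](mean_cst G hN); congr (mean _ _); apply: funext => g.
by rewrite hx scalerA mulrC mulc_conj char_normc expr1n scale1r.
Qed.

(** Translating the mean by an h at which the two characters differ multiplies it by a scalar c
    different from 1. *)
Lemma sproj_neq sigma pi x : spec pi x -> pi != sigma -> sproj sigma x = 0.
Proof.
move=> hx ne.
have [h hh] : exists h, pi h != sigma h.
  apply: contrapT => H; case/eqP: ne; apply: dualGroup_eq => g.
  by apply/eqP/negPn/negP => e; apply: H; exists g.
set c := (sigma h)^*%C * pi h.
have c1 : c != 1.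
  apply: contra hh => /eqP e.
  have := congr1 (fun z => sigma h * z) e.
  by rewrite mulr1 /c mulrA mulc_conj char_normc expr1n mul1r => ->.
have : sproj sigma x = c *: sproj sigma x.
  rewrite {1}/sproj -(mean_shift tb hN h (sproj_ucont sigma x)) /sproj.
  rewrite -(mean_scale tb hN); last exact: sproj_ucont.
  congr (mean _ _); apply: funext => g.
  rewrite !hx !charD rmorphM !scalerA /c /=; congr (_ *: _).
  by rewrite mulrACA mulrC.
move/eqP; rewrite -subr_eq0 -{1}(scale1r (sproj sigma x)) -scalerBl scaler_eq0.
by rewrite subr_eq0 eq_sym (negbTE c1) /= => /eqP.
Qed.

Lemma specM sigma pi x y : spec sigma x -> spec pi y -> spec (sigma + pi) (x * y).
Proof. by move=> hx hy g; rewrite alphaM hx hy -scalerAl -scalerAr scalerA. Qed.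

Lemma specS sigma x : spec sigma x -> spec (- sigma) (star x).
Proof.
by move=> hx g; rewrite alphaS hx starZ char_oppE.
Qed.

Lemma spec0 x : spec 0 x <-> fixed_algebra alpha x.
Proof. by split=> h g; rewrite h scale1r. Qed.

Lemma specD sigma x y : spec sigma x -> spec sigma y -> spec sigma (x + y).
Proof. by move=> hx hy g; rewrite alphaD hx hy scalerDr. Qed.

Lemma specZ sigma (c : R[i]) x : spec sigma x -> spec sigma (c *: x).
Proof. by move=> hx g; rewrite alphaZ hx !scalerA mulrC. Qed.

Lemma spec_sum sigma I (r : seq I) (P : pred I) (F : I -> A) :
  (forall i, P i -> spec sigma (F i)) -> spec sigma (\sum_(i <- r | P i) F i).
Proof.
move=> h g; rewrite alpha_sum scaler_sumr; apply: eq_bigr => i Pi; exact: h.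
Qed.

Definition spectral x := exists2 l : seq (dualGroup R G * A),
  (forall p, p \in l -> spec p.1 p.2) & x = \sum_(p <- l) p.2.

Lemma spectral_trig (t : ucfun R G) x : trig t ->
  spectral (mean (@rnorm R A) (fun g => (t g : R[i]) *: alpha g x)).
Proof.
move=> [l ->]; exists [seq (- cx.2, cx.1 *: sproj (- cx.2) x) | cx <- l].
  by move=> _ /mapP[cx _ ->] /=; apply: specZ; apply: sproj_spec.
rewrite big_map /=.
pose F (cx : R[i] * dualGroup R G) g := (cx.1 * cx.2 g) *: alpha g x.
have Fu cx : ucont (@rnorm R A) (F cx).
  apply: ucont_scalel (alpha_ucont x) => /=.
  apply: (ucont_scale hC _ (f := fun g => cx.2 g : C)); exact: char_ucont.
have [_ Fm] := mean_sum tb hN l Fu.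
transitivity (mean (@rnorm R A) (fun g => \sum_(cx <- l) F cx g)).
  congr (mean _ _); apply: funext => g; rewrite -scaler_suml; congr (_ *: _).
  elim: l {Fm} => [|cx l IH]; first by rewrite !big_nil uc0E.
  by rewrite !big_cons ucDE IH ucZE ucharE.
rewrite Fm; apply: eq_bigr => cx _.
rewrite /sproj -(mean_scale tb hN); last exact: sproj_ucont.
congr (mean _ _); apply: funext => g; rewrite /F scalerA; congr (_ * _ *: _).
by rewrite char_oppE conjcK.
Qed.

(** The orbit of x is averaged against a convolution square concentrated where [alpha g] barely
    moves x, normalised by its mean. Replacing the weight by a trigonometric polynomial makes the
    average spectral. *)
Lemma spectral_dense x (e : R) : 0 < e -> exists2 y, spectral y & rnorm (y - x) <= e.
Proof.
move=> e0; pose d := e / 3; have d0 : 0 < d by rewrite divr_gt0.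
pose n (g : G) : R := rnorm (alpha g x - x).
have nN g : n (- g) = n g.
  rewrite /n -(rnorm_alpha g (alpha (- g) x - x)) alphaB -(actionD alpha_dyn).
  by rewrite subrr (action0 alpha_dyn) (cn_distC hN).
have nD g h : n (g + h) <= n g + n h.
  rewrite [n g + _]addrC /n (actionD alpha_dyn); apply: le_trans (cn_dist3 hN (alpha g x) _ _) _.
  by rewrite -alphaB rnorm_alpha.
have n0 : n 0 = 0 by rewrite /n (action0 alpha_dyn) subrr (cn_0 hN).
have n_ge0 g : 0 <= n g by apply: (cn_ge0 hN).
have n_dist a g : `|n (g + a) - n g| <= n a.
  have := nD g a; have := nD (g + a) (- a); rewrite addrK nN ler_norml; lra.
(* A bump built from the displacement n of x itself: n is even and subadditive, so r is even and
   uniformly continuous. *)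
pose r (g : G) : R := Num.max 0 (d - n g).
have r_ge0 g : 0 <= r g by rewrite le_max lexx.
have r_dist a g : `|r (g + a) - r g| <= n a.
  have := n_dist a g; rewrite /r !ler_norml => /andP[? ?].
  by case: (lerP (d - n (g + a)) 0); case: (lerP (d - n g) 0); have := n_ge0 a; lra.
have ru : @ucont R G C (@normc R) (fun g => (r g)%:C%C).
  move=> b b0; have [U U0 hU] := alpha_ucont x b0; exists U => // a Ua g.
  rewrite -realcB normc_real; apply: le_trans (r_dist a g) _.
  by have := hU a Ua 0; rewrite add0r (action0 alpha_dyn).
pose k : ucfun R G := mkuc ru.
have kE g : k g = (r g)%:C%C by apply: mkucE.
have kA : ucadj k = k.
  by apply: ucfunP => g; rewrite ucadjE !kE conjc_real /r nN.
pose w (g : G) : R := Re (convol tb k k g).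
have kkE g : convol tb k k g = (w g)%:C%C.
  have E : (convol tb k k g)^*%C = convol tb k k g.
    rewrite convolE -(mean_conj tb); last exact: convol_integrand.
    by congr (mean _ _); apply: funext => y; rewrite !kE -realcM conjc_real.
  move: E; rewrite /w; case: (convol tb k k g) => a b [] /eqP.
  by rewrite eq_sym -addr_eq0 -mulr2n mulrn_eq0 /= => /eqP ->.
have w_ge0 g : 0 <= w g.
  rewrite /w convolE; apply: (@mean_ge R G tb (fun z : G => k z * k (g - z)) (fun z : G => r z * r (g - z)) 0).
  - exact: convol_integrand.
  - by move=> y; rewrite !kE realcM.
  - by move=> y; apply: mulr_ge0.
(* If [n g > 2 * d], subadditivity makes y or g - y displace x by at least d, so every factor
   product in the convolution vanishes. *)
have wn g : w g * n g <= w g * (2 * d).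
  have [gd|gd] := leP (n g) (2 * d); first by apply: ler_wpM2l.
  suff -> : w g = 0 by rewrite !mul0r.
  rewrite /w convolE.
  have -> : (fun z : G => k z * k (g - z)) = (fun _ : G => 0 : C).
    apply: funext => y; rewrite !kE -realcM; congr (real_complex _ _).
    have := nD y (g - y); rewrite addrC subrK /r => h.
    case: (lerP (d - n y) 0) => [h1|h1]; first by rewrite mul0r.
    by rewrite [X in _ * X]max_l ?mulr0 //; move: h gd h1; lra.
  by rewrite (mean_cst G hC).
pose m := mean (@normc R) (k : G -> C).
pose M := mean (@normc R) (convol tb k k : G -> C).
have coef0 f : coef tb f 0 = mean (@normc R) (f : G -> C).
  rewrite /coef convolE; congr (mean _ _); apply: funext => y.
  by rewrite ucharE /= mulr1.
(* The mean is the coefficient at the trivial character, which is multiplicative for convolution; M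
   is nonzero once m is. *)
have MM : M = m ^+ 2.
  rewrite /M -coef0 /coef -convolA !convol_uchar convolZr convol_uchar !ucZE.
  by rewrite ucharE char0 mulr1 coef0 expr2.
have m0 : 0 < Re m.
  have k0 : k != 0.
    apply/eqP => k0; have := kE 0; rewrite k0 uc0E /r n0 subr0.
    by move=> /(congr1 (@complex.Re R)) /=; rewrite max_r ?ltW // => /eqP; rewrite eq_sym gt_eqF.
  have := n2_gt0 tb k0.
  suff : n2 tb k <= d * Re m by move=> h1 h2; have := lt_le_trans h2 h1; rewrite pmulr_rgt0.
  have ukk : @ucont R G C (@normc R) (fun z : G => k z * (k z)^*%C) by apply: ip_integrand.
  have udk : @ucont R G C (@normc R) (fun z : G => d%:C%C * k z).
    by apply: (ucont_scale hC _ (f := k)); apply: uc_ucont.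
  have : 0 <= Re (mean (@normc R) (fun z : G => d%:C%C * k z + (-1) * (k z * (k z)^*%C))).
    apply: (@mean_ge R G tb (fun z : G => d%:C%C * k z + (-1) * (k z * (k z)^*%C)) (fun z : G => d * r z - r z ^+ 2) 0).
    - apply: (ucontD hC) => //; exact: (ucont_scale hC _ (f := fun z : G => k z * (k z)^*%C)).
    - move=> y; rewrite kE conjc_real mulN1r -!realcM -realcB.
      by rewrite expr2.
    - move=> y; rewrite subr_ge0 expr2 ler_wpM2r //.
      by rewrite /r ge_max (ltW d0) gerBl n_ge0.
  rewrite (mean_add tb hC) //; last exact: (ucont_scale hC _ (f := fun z : G => k z * (k z)^*%C)).
  rewrite (mean_scalar tb _ (uc_ucont k)) (mean_scalar tb _ ukk) mulN1r -(ipE tb) ReB -n2E.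
  by rewrite -/m; case: (m) => a b /=; rewrite mul0r subr0 subr_ge0.
have M0 : 0 < normc M.
  rewrite MM normcX exprn_gt0 //; apply: lt_le_trans m0 (Re_le_normc _).
have x1 : 0 < rnorm x + 1 by rewrite ltr_wpDl ?(cn_ge0 hN).
have [t tt ht] := trig_approx tb kA (divr_gt0 (mulr_gt0 d0 M0) x1).
pose Z (f : ucfun R G) := mean (@rnorm R A) (fun g => (f g : R[i]) *: alpha g x).
have Zu (f : ucfun R G) : ucont (@rnorm R A) (fun g => (f g : R[i]) *: alpha g x).
  by apply: ucont_scalel (alpha_ucont x); apply: uc_ucont.
have Fu : ucont (@rnorm R A) (fun g => (convol tb k k g : R[i]) *: (alpha g x - x)).
  apply: ucont_scalel; first exact: uc_ucont.
  by apply: (ucontD hN); [exact: alpha_ucont|exact: (ucont_cst _ hN)].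
have h1 : rnorm (Z (convol tb k k) - M *: x) <= 2 * d * normc M.
  have -> : Z (convol tb k k) - M *: x =
      mean (@rnorm R A) (fun g => (convol tb k k g : R[i]) *: (alpha g x - x)).
    have e1 : M *: x = mean (@rnorm R A) (fun g => (convol tb k k g : R[i]) *: x).
      rewrite /M (mean_linear tb hC hN (T := fun c : C => (c : R[i]) *: x) (K := rnorm x)) //.
      - by move=> c c'; rewrite scalerBl.
      - by move=> p c; rewrite scalerA.
      - by move=> c; rewrite (cn_scale hN) mulrC.
      - exact: uc_ucont.
    rewrite e1 -scaleN1r -(mean_scale tb hN); last first.
      by apply: ucont_scalel; [exact: uc_ucont|exact: (ucont_cst _ hN)].
    rewrite -(mean_add tb hN); first last.
    + by apply: (ucont_scale hN); apply: ucont_scalel; [exact: uc_ucont|exact: (ucont_cst _ hN)].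
    + exact: Zu.
    by congr (mean _ _); apply: funext => g; rewrite scaleN1r scalerBr.
  have := @mean_norm_le R G tb A _ hN _ (fun g => w g * (2 * d)) Fu.
  have -> : (fun g => (w g * (2 * d))%:C%C : C) = (fun g => (2 * d)%:C%C * convol tb k k g).
    by apply: funext => g; rewrite kkE -realcM mulrC.
  rewrite (mean_scalar tb _ (uc_ucont (convol tb k k))) normcM normc_real.
  rewrite [`|2 * d|]ger0_norm; last by rewrite mulr_ge0 // ltW.
  apply; first by apply: (ucont_scale hC _ (f := convol tb k k)); apply: uc_ucont.
  move=> g; rewrite (cn_scale hN) kkE normc_real ger0_norm //; exact: wn.
have h2 : rnorm (Z t - Z (convol tb k k)) <= d * normc M.
  rewrite /Z -[X in _ - X]scale1r -scaleNr -(mean_scale tb hN) // -(mean_add tb hN) //; last exact: (ucont_scale hN).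
  apply: (mean_le tb hN) => [|g]; first by apply: (ucontD hN) => //; apply: (ucont_scale hN).
  rewrite scaleN1r -scalerBl (cn_scale hN) rnorm_alpha (cn_distC hC).
  have := ht g; rewrite ler_pdivlMr // => h; apply: le_trans h.
  by apply: ler_wpM2l; rewrite ?normc_ge0 // lerDl.
have MN0 : M != 0 by rewrite -normc_eq0 gt_eqF.
exists (M^-1 *: Z t).
  have [l hl lE] := spectral_trig x tt.
  exists [seq (p.1, M^-1 *: p.2) | p <- l]; last by rewrite /Z lE big_map scaler_sumr.
  by move=> _ /mapP[p pl ->]; apply: specZ; apply: hl.
have -> : M^-1 *: Z t - x = M^-1 *: (Z t - M *: x).
  by rewrite scalerBr scalerA mulVf // scale1r.
rewrite (cn_scale hN) normcV ler_pdivrMl //.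
apply: le_trans (cn_dist3 hN (Z (convol tb k k)) _ _) _.
apply: le_trans (lerD h2 h1) _.
have -> : e = 3 * d by rewrite /d; field.
by rewrite -mulrDl mulrC ler_pM2l //; lra.
Qed.

End Spectral.

(** * Extending graded isomorphisms *)

Section GradedRelation.
Variables (R : realType) (G : topologicalZmodType).
Hypothesis tb : totally_bounded G.
Variables (A : cstarAlgType R) (alpha : G -> A -> A).
Hypothesis alpha_dyn : dynamical_system alpha.
Let hN := complete_rnorm A.
Implicit Types (x y : A) (sigma pi : dualGroup R G).
Local Notation D := (dualGroup R G).

(** A relation instead of a family of maps, so that the inverse is obtained by swapping two
    arguments and each result also holds for it. Single-valuedness follows from [gr_norm] and
    linearity. *)
Record graded_iso (r : D -> A -> A -> Prop) : Prop := {
  gr_spec : forall sigma x y, r sigma x y -> spec alpha sigma x /\ spec alpha sigma y ;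
  gr_add : forall sigma x y x' y', r sigma x y -> r sigma x' y' -> r sigma (x + x') (y + y') ;
  gr_scale : forall sigma (c : R[i]) x y, r sigma x y -> r sigma (c *: x) (c *: y) ;
  gr_mul : forall sigma pi x y x' y', r sigma x y -> r pi x' y' ->
    r (sigma + pi) (x * x') (y * y') ;
  gr_star : forall sigma x y, r sigma x y -> r (- sigma) (star x) (star y) ;
  gr_norm : forall sigma x y, r sigma x y -> rnorm y = rnorm x ;
  gr_total : forall sigma x, spec alpha sigma x -> exists y, r sigma x y ;
  gr_onto : forall sigma y, spec alpha sigma y -> exists x, r sigma x y
}.

Lemma graded_iso_sym r : graded_iso r -> graded_iso (fun sigma x y => r sigma y x).
Proof.
move=> [h1 h2 h3 h4 h5 h6 h7 h8]; split=> //.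
- by move=> sigma x y /h1[].
- by move=> sigma x y x' y'; apply: h2.
- by move=> sigma c x y; apply: h3.
- by move=> sigma pi x y x' y'; apply: h4.
- by move=> sigma x y; apply: h5.
- by move=> sigma x y /h6.
Qed.

(** The list F records the characters that may occur; its length is the quantity estimated in the
    norm bound. *)
Definition extend (r : D -> A -> A -> Prop) (F : seq D) x y :=
  exists l : seq (D * (A * A)),
    [/\ forall p, p \in l -> r p.1 p.2.1 p.2.2 /\ p.1 \in F,
        x = \sum_(p <- l) p.2.1 & y = \sum_(p <- l) p.2.2].

Section Iso.
Variable r : D -> A -> A -> Prop.
Hypothesis hr : graded_iso r.

Lemma gr0 sigma : r sigma 0 0.
Proof.
have [|y ry] := gr_total hr (x := 0) (sigma := sigma).
  by move=> g; rewrite scaler0 -(scale0r (0 : A)) (alphaZ alpha_dyn) !scale0r.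
by have := gr_scale hr 0 ry; rewrite !scale0r.
Qed.

Lemma extend_sub F F' x y : {subset F <= F'} -> extend r F x y -> extend r F' x y.
Proof.
move=> FF' [l [hl -> ->]]; exists l; split=> // p pl.
by have [h1 h2] := hl p pl; split=> //; apply: FF'.
Qed.

Lemma extendD F x y x' y' : extend r F x y -> extend r F x' y' ->
  extend r F (x + x') (y + y').
Proof.
move=> [l [hl -> ->]] [l' [hl' -> ->]]; exists (l ++ l'); rewrite !big_cat.
by split=> // p; rewrite mem_cat => /orP[/hl|/hl'].
Qed.

Lemma extendZ F (c : R[i]) x y : extend r F x y -> extend r F (c *: x) (c *: y).
Proof.
move=> [l [hl -> ->]]; exists [seq (p.1, (c *: p.2.1, c *: p.2.2)) | p <- l].
rewrite !big_map !scaler_sumr; split=> // _ /mapP[p /hl[h1 h2] ->] /=.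
by split=> //; apply: gr_scale.
Qed.

Lemma extendM F F' x y x' y' : extend r F x y -> extend r F' x' y' ->
  extend r (sumset F F') (x * x') (y * y').
Proof.
move=> [l [hl -> ->]] [l' [hl' -> ->]].
exists [seq (p.1 + q.1, (p.2.1 * q.2.1, p.2.2 * q.2.2)) | p <- l, q <- l'].
rewrite !big_allpairs_dep /= !mulr_suml; split.
- move=> _ /allpairsP[[p q] [/= /hl[h1 h2] /hl'[h3 h4] ->]] /=.
  by split; [apply: gr_mul|apply: allpairs_f].
- by apply: eq_bigr => p _; rewrite mulr_sumr.
- by apply: eq_bigr => p _; rewrite mulr_sumr.
Qed.

Lemma extendS F x y : extend r F x y -> extend r [seq - s | s <- F] (star x) (star y).
Proof.
move=> [l [hl -> ->]]; exists [seq (- p.1, (star p.2.1, star p.2.2)) | p <- l].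
rewrite !big_map !star_sum; split=> // _ /mapP[p /hl[h1 h2] ->] /=.
by split; [apply: gr_star|apply: map_f].
Qed.

Lemma extend_alpha F x y g : extend r F x y -> extend r F (alpha g x) (alpha g y).
Proof.
move=> [l [hl -> ->]].
exists [seq (p.1, (p.1 g *: p.2.1, p.1 g *: p.2.2)) | p : D * (A * A) <- l].
rewrite !big_map !(alpha_sum alpha_dyn); split.
- by move=> _ /mapP[p /hl[h1 h2] ->] /=; split=> //; apply: gr_scale.
- rewrite [LHS]big_seq [RHS]big_seq; apply: eq_bigr => p /hl[hp _].
  by have [h _] := gr_spec hr hp; rewrite h.
- rewrite [LHS]big_seq [RHS]big_seq; apply: eq_bigr => p /hl[hp _].
  by have [_ h] := gr_spec hr hp; rewrite h.
Qed.

Lemma gr_sum sigma (l : seq (D * (A * A))) : (forall p, p \in l -> r p.1 p.2.1 p.2.2) ->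
  r sigma (\sum_(p <- l | p.1 == sigma) p.2.1) (\sum_(p <- l | p.1 == sigma) p.2.2).
Proof.
elim: l => [|p l IH] hl; first by rewrite !big_nil; apply: gr0.
have {}IH : r sigma (\sum_(p <- l | p.1 == sigma) p.2.1) (\sum_(p <- l | p.1 == sigma) p.2.2).
  by apply: IH => q ql; apply: hl; rewrite inE ql orbT.
rewrite !big_cons; case: eqP => [e|//].
by apply: (gr_add hr) => //; rewrite -e; apply: hl; rewrite inE eqxx.
Qed.

Lemma proj_extend sigma (l : seq (D * (A * A))) (f : A * A -> A) :
  (forall p, p \in l -> spec alpha p.1 (f p.2)) ->
  sproj alpha sigma (\sum_(p <- l) f p.2) = \sum_(p <- l | p.1 == sigma) f p.2.
Proof.
elim: l => [|p l IH] hl.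
  rewrite !big_nil; apply: (cn_eq0 hN); apply/eqP.
  rewrite eq_le (cn_ge0 hN) andbT.
  by have := sproj_le tb alpha_dyn sigma (0 : A); rewrite (cn_0 hN).
rewrite !big_cons (sprojD tb alpha_dyn) IH; last by move=> q ql; apply: hl; rewrite inE ql orbT.
have hp : spec alpha p.1 (f p.2) by apply: hl; rewrite inE eqxx.
case: eqP => [e|ne]; first by rewrite -e (sproj_id hp).
by rewrite (sproj_neq tb alpha_dyn hp) ?add0r //; apply/eqP.
Qed.

(** The component of x at each character of F is a spectral projection of x, hence no larger than x,
    and its image has the same norm. *)
Lemma extend_le_size F x y : extend r F x y -> rnorm y <= (size F)%:R * rnorm x.
Proof.
move=> [l [hl xE yE]].
have hr1 p : p \in l -> r p.1 p.2.1 p.2.2 by move/hl => [].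
have sx p : p \in l -> spec alpha p.1 p.2.1 by move/hr1/(gr_spec hr) => [].
have {}yE : y = \sum_(s <- undup F) \sum_(p <- l | p.1 == s) p.2.2.
  rewrite yE (exchange_big_dep predT) //= [LHS]big_seq [RHS]big_seq.
  apply: eq_bigr => p pl; have [_ pF] := hl p pl.
  rewrite -big_filter.
  have -> : [seq s <- undup F | p.1 == s] = [:: p.1].
    have u : uniq [seq s <- undup F | p.1 == s] by rewrite filter_uniq // undup_uniq.
    have a : all (pred1 p.1) [seq s <- undup F | p.1 == s].
      by apply/allP => s; rewrite mem_filter eq_sym => /andP[].
    have i : p.1 \in [seq s <- undup F | p.1 == s] by rewrite mem_filter eqxx mem_undup.
    move: u a i; case: [seq s <- undup F | p.1 == s] => [//|s [|s' q]] /=.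
      by move=> _ /andP[/eqP -> _].
    move=> /andP[n _] /and3P[/eqP e1 /eqP e2 _].
    by move: n; rewrite e1 e2 mem_head.
  by rewrite big_seq1.
rewrite yE; apply: le_trans (cn_sum hN _ _ _) _.
apply: le_trans (_ : \sum_(s <- undup F) rnorm x <= _).
  apply: ler_sum => s _; rewrite (gr_norm hr (gr_sum s hr1)).
  by rewrite -(proj_extend s (f := fun q => q.1)) // -xE; apply: (sproj_le tb alpha_dyn).
rewrite big_const_seq count_predT iter_addr_0 -[in leLHS]mulr_natl.
by rewrite ler_wpM2r ?(cn_ge0 hN) // ler_nat size_undup.
Qed.

(** All combinations of F with coefficients in 0, ..., n. It contains the characters of an n-fold
    product, and for fixed F its length is polynomial in n because the dual group is abelian. *)
Definition combos (F : seq D) n : seq D :=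
  codom (fun k : {ffun 'I_(size F) -> 'I_n.+1} => \sum_(i < size F) nth 0 F i *+ k i).

Lemma size_combos F n : size (combos F n) = (n.+1 ^ size F)%N.
Proof. by rewrite size_codom card_ffun !card_ord. Qed.

Lemma sumset_combos F n : {subset sumset F (combos F n) <= combos F n.+1}.
Proof.
move=> _ /allpairsP[[s t] [/= sF /codomP[k ->] ->]].
have sF' : (index s F < size F)%N by rewrite index_mem.
pose j := Ordinal sF'.
have kb i : ((k i : nat) + (i == j) < n.+2)%N.
  by case: (i == j); rewrite ?addn1 ?addn0 ltnS ?ltn_ord // ltnW ?ltn_ord.
apply/codomP; exists [ffun i => Ordinal (kb i)].
rewrite (bigD1 j) //= [in RHS](bigD1 j) //= !ffunE /= eqxx addn1 mulrS -addrA.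
rewrite nth_index //; congr (_ + (_ + _)).
by apply: eq_bigr => i ij; rewrite ffunE /= (negbTE ij) addn0.
Qed.

Lemma extend1 : extend r [:: 0] 1 1 -> forall F n x y, extend r F x y ->
  extend r (combos F n) (x ^+ n) (y ^+ n).
Proof.
move=> e1 F; elim=> [|n IH] x y hxy.
  apply: extend_sub e1 => s; rewrite inE => /eqP ->.
  apply/codomP; exists [ffun=> ord0].
  by rewrite big1 // => i _; rewrite ffunE mulr0n.
rewrite !exprS; apply: extend_sub (@sumset_combos F n) _.
by apply: extendM => //; apply: IH.
Qed.

(** With 1 related to y and x to 1, the product relates x to y. Subtracting relates 0 to y - 1, so y
    = 1 by [gr_norm]. *)
Lemma gr1 : r 0 1 1.
Proof.
have s1 : spec alpha 0 1 by apply/spec0 => g; apply: (alpha1 alpha_dyn).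
have [y y1] := gr_total hr s1.
have [x x1] := gr_onto hr s1.
have := gr_mul hr y1 x1; rewrite addr0 mul1r mulr1 => xy.
have h := gr_add hr xy (gr_scale hr (-1) x1).
have : rnorm (y - 1) = 0.
  have := gr_norm hr h; rewrite !scaleN1r subrr => ->.
  exact: (cn_0 hN).
by move/(cn_eq0 hN)/eqP; rewrite subr_eq0 => /eqP y1E; rewrite y1E in y1.
Qed.

Lemma extend_one : extend r [:: 0] 1 1.
Proof.
exists [:: (0, (1, 1))]; rewrite !big_seq1; split=> // p.
by rewrite inE => /eqP -> /=; rewrite inE eqxx; split=> //; apply: gr1.
Qed.

(* The powers of an element are supported on polynomially many characters. *)
Lemma extend_le F x y : extend r F x y -> rnorm y <= rnorm x.
Proof.
move=> hxy.
rewrite -(@ler_pXn2r _ 2) ?nnegrE ?(cn_ge0 hN) // -!rnorm_starM.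
have hh := extendM (extendS hxy) hxy.
set F' := sumset _ _ in hh.
have sa z : star (star z * z) = star z * z by rewrite starM starK.
apply: (@pow2_growth_le _ _ _ (2 ^+ size F') (2 ^+ size F')); rewrite ?(cn_ge0 hN) //.
  by rewrite exprn_ege1 // ler1n.
move=> k; rewrite -!rnorm_pow_sa //.
apply: le_trans (extend_le_size (extend1 extend_one (2 ^ k) hh)) _.
rewrite ler_wpM2r ?(cn_ge0 hN) // size_combos.
(* Bounding [2 ^ k + 1] by [2 ^ k.+1] turns the count into [M * M ^+ k] with [M = 2 ^+ size F'], the
   shape required by [pow2_growth_le]. *)
apply: (@le_trans _ _ ((2 ^ k.+1) ^ size F')%N%:R); last first.
  by rewrite !natrX -exprM mulnC exprM exprS.
rewrite ler_nat; have [->//|m0] := posnP (size F').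
by rewrite leq_exp2r // expnS mul2n -addnn -addn1 leq_add2l expn_gt0.
Qed.

(** The closure of the algebraic graph in A x A. Contractivity makes it single-valued, and density
    of the spectral elements makes it total. *)
Definition extension x y := forall e : R, 0 < e ->
  exists F x' y', [/\ extend r F x' y', rnorm (x' - x) <= e & rnorm (y' - y) <= e].

Lemma extendB F x y F' x' y' : extend r F x y -> extend r F' x' y' ->
  extend r (F ++ F') (x - x') (y - y').
Proof.
move=> h h'; rewrite -(scaleN1r x') -(scaleN1r y'); apply: extendD; last apply: extendZ.
  by apply: extend_sub h => s; rewrite mem_cat => ->.
by apply: extend_sub h' => s; rewrite mem_cat => ->; rewrite orbT.
Qed.

Lemma extension_unique x y y' : extension x y -> extension x y' -> y = y'.
Proof.
move=> h h'; apply/eqP; rewrite -subr_eq0; apply/eqP.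
apply: (cn_small_mul hN (K := 4)) => e e0.
have [F [a [b [ab ax bx]]]] := h e e0; have [F' [a' [b' [ab' ax' bx']]]] := h' e e0.
have := extend_le (extendB ab ab').
have h1 : rnorm (a - a') <= e + e.
  by apply: le_trans (cn_dist3 hN x _ _) _; rewrite lerD // (cn_distC hN).
have h2 : rnorm (y - y') <= e + (rnorm (b - b') + e).
  apply: le_trans (cn_dist3 hN b _ _) _; rewrite lerD ?(cn_distC hN y) //.
  by apply: le_trans (cn_dist3 hN b' _ _) _; rewrite lerD.
by move: h1 h2; lra.
Qed.

Lemma spectral_extend x : spectral alpha x -> exists F y, extend r F x y.
Proof.
move=> [l hl ->]; elim: l hl => [|p l IH] hl.
  by exists [::], 0, [::]; rewrite !big_nil.
have [|F [y hy]] := IH; first by move=> q ql; apply: hl; rewrite inE ql orbT.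
have [|z hz] := gr_total hr (sigma := p.1) (x := p.2); first by apply: hl; rewrite inE eqxx.
exists ([:: p.1] ++ F), (z + y); rewrite big_cons; apply: extendD.
  exists [:: (p.1, (p.2, z))]; rewrite !big_seq1; split=> // q.
  by rewrite inE => /eqP -> /=; split=> //; rewrite mem_head.
by apply: extend_sub hy => s; rewrite mem_cat => ->; rewrite orbT.
Qed.

Lemma inv_small (e : R) : 0 < e -> exists n, forall i, (n <= i)%N -> i.+1%:R^-1 <= e.
Proof.
move=> e0; exists (Num.truncn e^-1) => i hi.
rewrite -[e]invrK lef_pV2 ?posrE ?invr_gt0 ?ltr0n //.
by apply/ltW/(lt_le_trans (truncnS_gt _)); rewrite ler_nat.
Qed.

Lemma extension_total x : exists y, extension x y.
Proof.
have h (n : nat) : exists q : seq D * (A * A),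
    extend r q.1 q.2.1 q.2.2 /\ rnorm (q.2.1 - x) <= n.+1%:R^-1.
  have [|a ha ax] := spectral_dense tb alpha_dyn x (e := n.+1%:R^-1).
    by rewrite invr_gt0 ltr0n.
  by have [F [b ab]] := spectral_extend ha; exists (F, (a, b)).
have [q hq] := choice h.
have [e e0|y hy] := cn_complete hN (w := fun n => (q n).2.2).
  have [n hn] := inv_small (divr_gt0 e0 (ltr0Sn _ 1)).
  exists n => i j ni nj.
  have [qi xi] := hq i; have [qj xj] := hq j.
  apply: le_trans (extend_le (extendB qi qj)) _.
  apply: le_trans (cn_dist3 hN x _ _) _; rewrite (splitr e); apply: lerD.
    exact: le_trans xi (hn _ ni).
  by rewrite (cn_distC hN); apply: le_trans xj (hn _ nj).
exists y => e e0; have [n hn] := hy _ e0; have [m hm] := inv_small e0.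
have [qi xi] := hq (maxn n m).
exists (q (maxn n m)).1, (q (maxn n m)).2.1, (q (maxn n m)).2.2; split=> //.
  by apply: le_trans xi (hm _ _); rewrite leq_maxr.
by apply: hn; rewrite leq_maxl.
Qed.

Lemma extension_base sigma x y : r sigma x y -> extension x y.
Proof.
move=> rxy e e0; exists [:: sigma], x, y; rewrite !subrr !(cn_0 hN) ltW //; split=> //.
exists [:: (sigma, (x, y))]; rewrite !big_seq1; split=> // p.
by rewrite inE => /eqP -> /=; rewrite inE eqxx.
Qed.

Lemma extensionD x y x' y' : extension x y -> extension x' y' ->
  extension (x + x') (y + y').
Proof.
move=> h h' e e0; have e2 : 0 < e / 2 by rewrite divr_gt0.
have [F [a [b [ab ax bx]]]] := h _ e2; have [F' [a' [b' [ab' ax' bx']]]] := h' _ e2.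
exists (F ++ F'), (a + a'), (b + b'); split.
- apply: extendD; [apply: extend_sub ab|apply: extend_sub ab'] => s;
  by rewrite mem_cat => ->; rewrite ?orbT.
- rewrite opprD addrACA (splitr e); exact: le_trans (cn_triangle hN _ _) (lerD ax ax').
- rewrite opprD addrACA (splitr e); exact: le_trans (cn_triangle hN _ _) (lerD bx bx').
Qed.

Lemma extensionZ (c : R[i]) x y : extension x y -> extension (c *: x) (c *: y).
Proof.
move=> h e e0; have c0 : 0 < normc c + 1 by rewrite ltr_wpDl ?normc_ge0.
have [F [a [b [ab ax bx]]]] := h _ (divr_gt0 e0 c0).
have H (z z' : A) : rnorm (z - z') <= e / (normc c + 1) -> rnorm (c *: z - c *: z') <= e.
  move=> hz; rewrite -scalerBr (cn_scale hN) -[leRHS](divfK (lt0r_neq0 c0)) [leRHS]mulrC.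
  by apply: ler_pM; rewrite ?normc_ge0 ?(cn_ge0 hN) // lerDl.
by exists F, (c *: a), (c *: b); split; [apply: extendZ|apply: H|apply: H].
Qed.

Lemma rnorm_mul_close (a a' x x' : A) (e : R) : e <= 1 -> rnorm (a - x) <= e ->
  rnorm (a' - x') <= e -> rnorm (a * a' - x * x') <= (rnorm x + rnorm x' + 1) * e.
Proof.
move=> e1 h h'.
have -> : a * a' - x * x' = (a - x) * a' + x * (a' - x').
  by rewrite mulrBl mulrBr addrA subrK.
apply: le_trans (cn_triangle hN _ _) _.
have na : rnorm a' <= rnorm x' + e.
  by rewrite -(subrK x' a') addrC; apply: le_trans (cn_triangle hN _ _) (lerD _ _).
have := rnormM (a - x) a'; have := rnormM x (a' - x').
have h1 : rnorm (a - x) * rnorm a' <= e * (rnorm x' + e) by apply: ler_pM; rewrite ?(cn_ge0 hN).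
have h2 : rnorm x * rnorm (a' - x') <= rnorm x * e by apply: ler_wpM2l; rewrite ?(cn_ge0 hN).
have : e * e <= e * 1 by apply: ler_wpM2l => //; apply: le_trans h; apply: (cn_ge0 hN).
by move: h1 h2; lra.
Qed.

Lemma extensionM x y x' y' : extension x y -> extension x' y' ->
  extension (x * x') (y * y').
Proof.
move=> h h' e e0.
pose K := rnorm x + rnorm x' + rnorm y + rnorm y' + 1.
have xs := (cn_ge0 hN x, cn_ge0 hN x', cn_ge0 hN y, cn_ge0 hN y').
have K0 : 0 < K by rewrite ltr_wpDl // !addr_ge0 // xs.
have d0 : 0 < Num.min 1 (e / K) by rewrite lt_min ltr01 divr_gt0.
have d1 : Num.min 1 (e / K) <= 1 by rewrite ge_min lexx.
have dK : K * Num.min 1 (e / K) <= e.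
  by rewrite mulrC -ler_pdivlMr // ge_min lexx orbT.
set d := Num.min _ _ in d0 d1 dK.
have [F [a [b [ab ax bx]]]] := h _ d0; have [F' [a' [b' [ab' ax' bx']]]] := h' _ d0.
exists (sumset F F'), (a * a'), (b * b'); split; first exact: extendM.
- apply: le_trans (rnorm_mul_close d1 ax ax') (le_trans _ dK).
  by rewrite ler_pM2r // /K; move: xs => [[[]]]; lra.
- apply: le_trans (rnorm_mul_close d1 bx bx') (le_trans _ dK).
  by rewrite ler_pM2r // /K; move: xs => [[[]]]; lra.
Qed.

Lemma extensionS x y : extension x y -> extension (star x) (star y).
Proof.
move=> h e e0; have [F [a [b [ab ax bx]]]] := h _ e0.
exists [seq - s | s <- F], (star a), (star b).
by rewrite -!starB !rnorm_star; split=> //; apply: extendS.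
Qed.

Lemma extension_alpha g x y : extension x y -> extension (alpha g x) (alpha g y).
Proof.
move=> h e e0; have [F [a [b [ab ax bx]]]] := h _ e0.
exists F, (alpha g a), (alpha g b).
by rewrite -!(alphaB alpha_dyn) !(rnorm_alpha alpha_dyn); split=> //; apply: extend_alpha.
Qed.

End Iso.

Lemma extension_sym r x y : extension r x y -> extension (fun s a b => r s b a) y x.
Proof.
move=> h e e0; have [F [a [b [[l [hl ax bx]] ab' bb']]]] := h _ e0.
exists F, b, a; split=> //; exists [seq (p.1, (p.2.2, p.2.1)) | p <- l].
by rewrite !big_map; split=> // _ /mapP[p /hl pl ->].
Qed.

(** Injectivity and surjectivity are uniqueness and totality of the extension of the swapped
    relation. *)
Lemma graded_iso_automorphism r : graded_iso r -> exists f : A -> A,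
  [/\ star_automorphism setT f, forall sigma x y, r sigma x y -> f x = y &
      forall g x, f (alpha g x) = alpha g (f x)].
Proof.
move=> hr; have hr' := graded_iso_sym hr.
have [f hf] := choice (extension_total hr).
have fE x y : extension r x y -> f x = y.
  exact: (extension_unique hr (hf x)).
exists f; split.
- split.
  + split=> //.
    * move=> x x' _ _ e.
      apply: (extension_unique hr' (x := f x)); first exact/extension_sym.
      by rewrite e; exact/extension_sym.
    * move=> y _; have [x hx] := extension_total hr' y.
      by exists x => //; apply: fE; exact: (extension_sym hx).
  + move=> a x y _ _; apply: fE; apply: (extensionD) => //.
    exact: extensionZ.
  + by move=> x y _ _; apply: fE; apply: extensionM.
  + by move=> x _; apply: fE; apply: extensionS.
- by move=> sigma x y rxy; apply: fE; apply: (extension_base rxy).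
- by move=> g x; apply: fE; apply: extension_alpha.
Qed.

End GradedRelation.

(** * Frames and the cocycle *)

Section Algebra.
Variables (R : realType) (G : topologicalZmodType).
Variables (A : cstarAlgType R) (alpha : G -> A -> A).
Hypothesis alpha_dyn : dynamical_system alpha.
Implicit Types (x y z b : A) (sigma pi rho : dualGroup R G).
Local Notation D := (dualGroup R G).
Local Notation B := (fixed_algebra alpha).
Local Notation UZ := (central_unitaries B).
Local Notation spec := (spec alpha).
Let hB := fixed_closed_subalgebra alpha_dyn.

Lemma spec_mul_star sigma x y : spec sigma x -> spec sigma y -> B (x * star y).
Proof.
by move=> hx hy; apply/spec0; rewrite -(subrr sigma); apply: (specM alpha_dyn) => //;
  apply: (specS alpha_dyn).
Qed.

Lemma spec_star_mul sigma x y : spec sigma x -> spec sigma y -> B (star x * y).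
Proof.
by move=> hx hy; apply/spec0; rewrite -(addNr sigma); apply: (specM alpha_dyn) => //;
  apply: (specS alpha_dyn).
Qed.

Lemma spec_mull sigma b x : B b -> spec sigma x -> spec sigma (b * x).
Proof. by move=> /spec0 hb hx; rewrite -[sigma]add0r; apply: specM. Qed.

Lemma spec_mulr sigma b x : B b -> spec sigma x -> spec sigma (x * b).
Proof. by move=> /spec0 hb hx; rewrite -[sigma]addr0; apply: specM. Qed.

Lemma UZ_mul b b' : UZ b -> UZ b' -> UZ (b * b').
Proof.
move=> [Bb b1 b2 bc] [Bb' b1' b2' bc']; split.
- exact: (csubM hB).
- by rewrite starM mulrA -[star b' * _ * _]mulrA b1 mulr1.
- by rewrite starM mulrA -[b * b' * _]mulrA b2' mulr1.
- by move=> x Bx; rewrite -mulrA bc' // mulrA bc // mulrA.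
Qed.

Lemma UZ_star b : UZ b -> UZ (star b).
Proof.
move=> [Bb b1 b2 bc]; split; rewrite ?starK //; first exact: (csubS hB).
move=> x Bx; rewrite -[star b * x]mulr1 -b2 mulrA -[_ * x * b]mulrA -bc //.
by rewrite mulrA b1 mul1r.
Qed.

Lemma UZ1 : UZ 1.
Proof.
split; rewrite ?star1 ?mulr1 //; first exact: (csub1 hB).
by move=> b _; rewrite mul1r mulr1.
Qed.

Lemma UZ_in b : UZ b -> B b. Proof. by case. Qed.

Lemma UZ_comm b b' : UZ b -> B b' -> b * b' = b' * b.
Proof. by case=> _ _ _; apply. Qed.

(** Inserting [p i * star (p j)] for [q i * star (q j)] in [q i * u] and summing gives [p i];
    unitarity follows by symmetry. For centrality, u b is expanded as the sum of
    [star (q i) * p i * b * star (p j) * p j], and the middle is rewritten with q. *)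
Lemma intertwiner (I : finType) tau (p q : I -> A) :
  (forall i, spec tau (p i)) -> (forall i, spec tau (q i)) ->
  \sum_i star (p i) * p i = 1 -> \sum_i star (q i) * q i = 1 ->
  (forall b i j, B b -> q i * b * star (q j) = p i * b * star (p j)) ->
  UZ (\sum_i star (q i) * p i) /\ forall i, q i * (\sum_j star (q j) * p j) = p i.
Proof.
move=> sp sq p1 q1 pq.
have B1 := csub1 hB.
have pq1 i j : q i * star (q j) = p i * star (p j) by have := pq 1 i j B1; rewrite !mulr1.
set u := \sum_i _.
have uS : star u = \sum_i star (p i) * q i.
  by rewrite star_sum; apply: eq_bigr => i _; rewrite starM starK.
have qu i : q i * u = p i.
  rewrite mulr_sumr; under eq_bigr do rewrite mulrA pq1 -mulrA.
  by rewrite -mulr_sumr p1 mulr1.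
have pu i : p i * star u = q i.
  rewrite uS mulr_sumr; under eq_bigr do rewrite mulrA -pq1 -mulrA.
  by rewrite -mulr_sumr q1 mulr1.
split=> //; split.
- by apply: (csub_sum hB) => i _; apply: spec_star_mul (sq i) (sp i).
- by rewrite uS mulr_suml -[RHS]p1; apply: eq_bigr => i _; rewrite -mulrA qu.
- by rewrite mulr_suml -[RHS]q1; apply: eq_bigr => i _; rewrite -mulrA pu.
- move=> b Bb; transitivity (\sum_i \sum_j star (q i) * (q i * b * star (q j)) * p j).
    rewrite mulr_suml; apply: eq_bigr => i _.
    under eq_bigr do rewrite pq // -[star (q i) * _ * _]mulrA -[p i * b * _ * _]mulrA.
    by rewrite -mulr_sumr -mulr_sumr p1 mulr1 mulrA.
  rewrite exchange_big mulr_sumr; apply: eq_bigr => j _.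
  under eq_bigr do rewrite !mulrA.
  by rewrite -!mulr_suml q1 mul1r mulrA.
Qed.

Section Frames.
Variable d : D -> nat.
Implicit Type s t : forall sigma : D, 'I_(d sigma) -> A.

(** Coordinates of a family of isometric columns with prescribed degrees, abstracting both s and v
    s. *)
Record frame s : Prop := {
  frame1 : forall sigma, \sum_i star (s sigma i) * s sigma i = 1 ;
  frame_spec : forall sigma i, spec sigma (s sigma i)
}.

Lemma frame_expand s sigma x : frame s -> x = \sum_i x * star (s sigma i) * s sigma i.
Proof.
move=> hs; under eq_bigr do rewrite -mulrA.
by rewrite -mulr_sumr frame1 // mulr1.
Qed.

Lemma frame_cancel s sigma b : frame s -> (forall i, s sigma i * b = 0) -> b = 0.
Proof.
move=> hs h; rewrite -[b]mul1r -(frame1 hs sigma) mulr_suml big1 // => i _.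
by rewrite -mulrA h mulr0.
Qed.

Lemma frame_mul s sigma pi : frame s ->
  \sum_(k : 'I_(d sigma) * 'I_(d pi))
    star (s sigma k.1 * s pi k.2) * (s sigma k.1 * s pi k.2) = 1.
Proof.
move=> hs; transitivity (\sum_i \sum_j star (s sigma i * s pi j) * (s sigma i * s pi j)).
  by rewrite pair_bigA.
rewrite exchange_big -[RHS](frame1 hs pi); apply: eq_bigr => j _.
under eq_bigr do rewrite starM -mulrA [star (s sigma _) * _]mulrA.
by rewrite -mulr_sumr -mulr_suml frame1 // mul1r.
Qed.

Section Frohlich.
Variable s : forall sigma : D, 'I_(d sigma) -> A.
Arguments s : clear implicits.
Hypothesis hs : frame s.

Definition frohlich_sum sigma b := \sum_i star (s sigma i) * b * s sigma i.

(** In the frame expansion of x the coefficients [x * star (s sigma i)] lie in the fixed algebra, so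
    a central b passes them. *)
Lemma frohlich_sum_comm sigma b x : UZ b -> spec sigma x -> b * x = x * frohlich_sum sigma b.
Proof.
move=> ub hx; rewrite {1}(frame_expand sigma x hs) /frohlich_sum !mulr_sumr; apply: eq_bigr => i _.
rewrite mulrA (UZ_comm ub); last exact: spec_mul_star hx (frame_spec hs i).
by rewrite !mulrA.
Qed.

Lemma frohlich_sum1 sigma : frohlich_sum sigma 1 = 1.
Proof. by rewrite -[RHS](frame1 hs sigma) /frohlich_sum; apply: eq_bigr => i _; rewrite mulr1. Qed.

Lemma frohlich_sum_mul sigma b b' : UZ b -> UZ b' -> frohlich_sum sigma (b * b') = frohlich_sum sigma b * frohlich_sum sigma b'.
Proof.
move=> ub ub'; rewrite {1 2}/frohlich_sum mulr_suml; apply: eq_bigr => i _.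
by rewrite !mulrA -!mulrA (frohlich_sum_comm ub' (frame_spec hs i)) !mulrA.
Qed.

Lemma frohlich_sum_star sigma b : star (frohlich_sum sigma b) = frohlich_sum sigma (star b).
Proof.
by rewrite star_sum; apply: eq_bigr => i _; rewrite !starM starK mulrA.
Qed.

Lemma frohlich_sum_UZ sigma b : UZ b -> UZ (frohlich_sum sigma b).
Proof.
move=> ub; have [Bb b1 b2 bc] := ub; split.
- apply: (csub_sum hB) => i _; rewrite -mulrA.
  by apply: spec_star_mul (frame_spec hs i) (spec_mull Bb (frame_spec hs i)).
- by rewrite frohlich_sum_star -frohlich_sum_mul ?b1 ?frohlich_sum1 //; apply: UZ_star.
- by rewrite frohlich_sum_star -frohlich_sum_mul ?b2 ?frohlich_sum1 //; apply: UZ_star.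
- move=> x Bx; rewrite mulr_suml -[RHS]mul1r -(frame1 hs sigma) mulr_suml.
  apply: eq_bigr => i _; rewrite -!mulrA; congr (_ * _).
  have sx := spec_mulr Bx (frame_spec hs i).
  by rewrite (frohlich_sum_comm ub sx) !mulrA.
Qed.

End Frohlich.

(** Entrywise form of the relation that v conjugates gamma into its beta-twist, with t in place of v
    s and the argument [beta b]. *)
Definition twisted s t (beta : A -> A) := forall sigma i j b, B b ->
  t sigma i * beta b * star (t sigma j) = beta (s sigma i * b * star (s sigma j)).

Section Twist.
Variables (beta : A -> A) (s t : forall sigma : D, 'I_(d sigma) -> A).
Arguments s : clear implicits.
Arguments t : clear implicits.
Hypotheses (hbeta : star_automorphism B beta) (hs : frame s) (ht : frame t).
Hypothesis hst : twisted s t beta.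

Lemma twisted_sym : twisted t s (inv_on B beta).
Proof.
move=> sigma i j b Bb.
have [c Bc <-] := auto_surj hbeta Bb.
rewrite hst // !(invonK hbeta) //.
rewrite -[c]starK -mulrA -starM; apply: spec_mul_star (frame_spec hs i) _.
exact: spec_mulr (csubS hB Bc) (frame_spec hs j).
Qed.

Definition phi sigma x := \sum_i beta (x * star (s sigma i)) * t sigma i.

Let spec_BS sigma x i : spec sigma x -> B (x * star (s sigma i)).
Proof. by move=> hx; apply: spec_mul_star hx (frame_spec hs i). Qed.

Lemma phi_spec sigma x : spec sigma x -> spec sigma (phi sigma x).
Proof.
move=> hx; apply: (spec_sum alpha_dyn) => i _; apply: spec_mull (frame_spec ht i).
by apply: (auto_in hbeta); apply: spec_BS.
Qed.

Lemma phiD sigma x y : spec sigma x -> spec sigma y ->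
  phi sigma (x + y) = phi sigma x + phi sigma y.
Proof.
move=> hx hy; rewrite -big_split; apply: eq_bigr => i _ /=.
by rewrite mulrDl (auto_add hbeta) ?mulrDl //; apply: spec_BS.
Qed.

Lemma phiZ sigma (c : R[i]) x : spec sigma x -> phi sigma (c *: x) = c *: phi sigma x.
Proof.
move=> hx; rewrite scaler_sumr; apply: eq_bigr => i _.
by rewrite -scalerAl (auto_scale hB hbeta) ?scalerAl //; apply: spec_BS.
Qed.

Lemma phi_mull sigma b x : B b -> spec sigma x -> phi sigma (b * x) = beta b * phi sigma x.
Proof.
move=> Bb hx; rewrite mulr_sumr; apply: eq_bigr => i _.
by rewrite -mulrA (auto_mul hbeta) ?mulrA //; apply: spec_BS.
Qed.

Lemma t_beta sigma i b : B b ->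
  t sigma i * beta b = \sum_j beta (s sigma i * b * star (s sigma j)) * t sigma j.
Proof.
move=> Bb; rewrite {1}(frame_expand sigma (t sigma i * beta b) ht).
by apply: eq_bigr => j _; rewrite hst.
Qed.

Lemma phi_mulr sigma b x : B b -> spec sigma x -> phi sigma (x * b) = phi sigma x * beta b.
Proof.
move=> Bb hx; rewrite /phi mulr_suml.
under [RHS]eq_bigr do rewrite -mulrA t_beta // mulr_sumr.
rewrite exchange_big; apply: eq_bigr => j _ /=.
under eq_bigr => i _.
  rewrite mulrA -(auto_mul hbeta); first last.
  - rewrite -[b]starK -mulrA -starM; apply: spec_mul_star (frame_spec hs i) _.
    exact: spec_mulr (csubS hB Bb) (frame_spec hs j).
  - exact: spec_BS.
  over.
rewrite -mulr_suml -(auto_sum hB hbeta); last first.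
  move=> i _; apply: (csubM hB); first exact: spec_BS.
  rewrite -[b]starK -mulrA -starM; apply: spec_mul_star (frame_spec hs i) _.
  exact: spec_mulr (csubS hB Bb) (frame_spec hs j).
congr (beta _ * _); rewrite [in LHS](frame_expand sigma x hs) !mulr_suml.
by apply: eq_bigr => i _; rewrite !mulrA.
Qed.

Let ts_mul sigma i j : t sigma i * star (t sigma j) = beta (s sigma i * star (s sigma j)).
Proof.
have := hst i j (csub1 hB).
by rewrite (auto1 hB hbeta) !mulr1.
Qed.

(** With [phi_starr], phi preserves both inner products valued in the fixed algebra up to beta: it
    is an isomorphism of Hilbert bimodules covering beta. *)
Lemma phi_starl sigma x y : spec sigma x -> spec sigma y ->
  star (phi sigma x) * phi sigma y = beta (star x * y).
Proof.
move=> hx hy.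
have e i j : star (beta (x * star (s sigma i)) * t sigma i) * (beta (y * star (s sigma j)) * t sigma j)
   = star (t sigma i) * t sigma i * beta (star x * y) * (star (t sigma j) * t sigma j).
  transitivity (star (t sigma i) * beta (s sigma i * (star x * y) * star (s sigma j)) * t sigma j); last first.
    by rewrite -hst ?mulrA //; exact: spec_star_mul hx hy.
  rewrite starM -(auto_star hbeta); last exact: spec_BS.
  rewrite starM starK -!mulrA; congr (_ * _).
  rewrite [beta _ * (beta _ * _)]mulrA -(auto_mul hbeta); first by rewrite !mulrA.
    exact: spec_mul_star (frame_spec hs i) hx.
  exact: spec_BS.
rewrite /phi star_sum mulr_suml.
under eq_bigr do rewrite mulr_sumr.
under eq_bigr => i _ do under eq_bigr => j _ do rewrite e.
under eq_bigr => i _ do rewrite -mulr_sumr frame1 // mulr1.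
by rewrite -mulr_suml frame1 // mul1r.
Qed.

Lemma phi_starr sigma x y : spec sigma x -> spec sigma y ->
  phi sigma x * star (phi sigma y) = beta (x * star y).
Proof.
move=> hx hy.
have e i j : beta (x * star (s sigma i)) * t sigma i * star (beta (y * star (s sigma j)) * t sigma j)
   = beta (x * star (s sigma i) * s sigma i * (star (s sigma j) * s sigma j * star y)).
  rewrite starM -(auto_star hbeta); last exact: spec_BS.
  rewrite starM starK -!mulrA [t _ _ * _]mulrA ts_mul.
  have B1 := spec_BS i hx.
  have B2 := spec_mul_star (frame_spec hs i) (frame_spec hs j).
  have B3 := spec_mul_star (frame_spec hs j) hy.
  rewrite -(auto_mul hbeta) // -(auto_mul hbeta) //; last exact: (csubM hB).
  by rewrite !mulrA.
have Bx i : spec sigma (x * star (s sigma i) * s sigma i).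
  exact: spec_mull (spec_BS i hx) (frame_spec hs i).
have By j : spec sigma (y * star (s sigma j) * s sigma j).
  exact: spec_mull (spec_BS j hy) (frame_spec hs j).
have yS j : star (s sigma j) * s sigma j * star y = star (y * star (s sigma j) * s sigma j).
  by rewrite !starM starK mulrA.
rewrite /phi star_sum mulr_suml; under eq_bigr do rewrite mulr_sumr.
under eq_bigr => i _ do under eq_bigr => j _ do rewrite e yS.
under eq_bigr => i _.
  rewrite -(auto_sum hB hbeta) => [|j _]; last exact: spec_mul_star (Bx i) (By j).
  over.
rewrite -(auto_sum hB hbeta); last first.
  by move=> i _; apply: (csub_sum hB) => j _; apply: spec_mul_star (Bx i) (By j).
congr (beta _); under eq_bigr do rewrite -mulr_sumr.
by rewrite -mulr_suml -star_sum -!frame_expand.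
Qed.

Lemma phi_s sigma i : phi sigma (s sigma i) = t sigma i.
Proof.
rewrite /phi; under eq_bigr do rewrite -ts_mul.
by rewrite -frame_expand.
Qed.

Lemma phi0 x : B x -> (forall i, t 0 i = 1) -> (forall i, s 0 i = 1) -> phi 0 x = beta x.
Proof.
move=> Bx t1 s1; rewrite /phi; under eq_bigr do rewrite t1 s1 star1 !mulr1.
rewrite -[RHS]mulr1 -(frame1 ht 0) mulr_sumr; apply: eq_bigr => i _.
by rewrite t1 star1 !mulr1.
Qed.

End Twist.

End Frames.
End Algebra.

Section Cocycle.
Variables (R : realType) (G : topologicalZmodType).
Variables (A : cstarAlgType R) (alpha : G -> A -> A).
Hypothesis alpha_dyn : dynamical_system alpha.
Implicit Types (x y z b : A) (sigma pi rho : dualGroup R G).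
Local Notation D := (dualGroup R G).
Local Notation B := (fixed_algebra alpha).
Local Notation UZ := (central_unitaries B).
Local Notation spec := (spec alpha).
Variable d : D -> nat.
Let hB := fixed_closed_subalgebra alpha_dyn.

(** Exchanging s with t and beta with its inverse inverts phi, since phi sends each [s sigma i] to
    [t sigma i] and is left linear over beta. *)
Lemma phiK (beta beta' : A -> A) (s t : forall sigma : D, 'I_(d sigma) -> A) sigma x :
  star_automorphism B beta -> star_automorphism B beta' ->
  frame alpha s -> frame alpha t -> twisted alpha s t beta -> twisted alpha t s beta' ->
  (forall b, B b -> beta' (beta b) = b) ->
  spec sigma x -> phi beta' t s sigma (phi beta s t sigma x) = x.
Proof.
move=> hb hb' hs ht st ts bb hx.
rewrite [RHS](frame_expand sigma x hs).
have Bi i : B (x * star (s sigma i)) by apply: (spec_mul_star alpha_dyn hx (frame_spec hs i)).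
have ti i : phi beta' t s sigma (t sigma i) = s sigma i by apply: (phi_s alpha_dyn hb' hs ts).
have step i : phi beta' t s sigma (beta (x * star (s sigma i)) * t sigma i) =
    x * star (s sigma i) * s sigma i.
  rewrite (phi_mull alpha_dyn _ hb' ht) ?ti ?bb //; first exact: (auto_in hb).
  exact: (frame_spec ht).
under [RHS]eq_bigr do rewrite -step.
have s1 i : spec sigma (beta (x * star (s sigma i)) * t sigma i).
  exact: (spec_mull alpha_dyn (auto_in hb (Bi i)) (frame_spec ht i)).
rewrite {2}/phi.
(* Additivity of phi is available only within a spectral subspace, so the sum is taken apart one
   term at a time. *)
elim: (index_enum _) => [|i r IH]; last first.
  by rewrite !big_cons (phiD alpha_dyn _ hb' ht) // ?IH //; apply: (spec_sum alpha_dyn).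
rewrite !big_nil /phi big1 // => i _.
by rewrite mul0r (auto0 hB hb') mul0r.
Qed.

Variables (beta : A -> A) (s t : forall sigma : D, 'I_(d sigma) -> A).
Arguments s : clear implicits.
Arguments t : clear implicits.
Hypotheses (hbeta : star_automorphism B beta) (hs : frame alpha s) (ht : frame alpha t).
Hypothesis hst : twisted alpha s t beta.
Let betaV := inv_on B beta.
Let hbetaV : star_automorphism B betaV := invon_auto hB hbeta.
Let hts : twisted alpha t s betaV := twisted_sym alpha_dyn hbeta hs hst.
Let bK b : B b -> betaV (beta b) = b. Proof. exact: (invonK hbeta). Qed.
Let bVK b : B b -> beta (betaV b) = b. Proof. exact: (invonKV hbeta). Qed.

Let ph sigma x := phi beta s t sigma x.
Let ph' sigma x := phi betaV t s sigma x.

Let phK' sigma x : spec sigma x -> ph sigma (ph' sigma x) = x.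
Proof. exact: phiK hbetaV hbeta ht hs hts hst bVK. Qed.

(** The intertwiner between two frames of degree pi + sigma: products of entries of s, and the
    preimages under phi of the products of entries of t. *)
Definition ucocycle sigma pi : A :=
  \sum_(k : 'I_(d pi) * 'I_(d sigma))
    star (phi (inv_on B beta) t s (pi + sigma) (t pi k.1 * t sigma k.2)) *
    (s pi k.1 * s sigma k.2).
Local Notation u := ucocycle.

Let spec_ss sigma pi (k : 'I_(d pi) * 'I_(d sigma)) : spec (pi + sigma) (s pi k.1 * s sigma k.2).
Proof. by apply: (specM alpha_dyn); apply: (frame_spec hs). Qed.

Let spec_tt sigma pi (k : 'I_(d pi) * 'I_(d sigma)) : spec (pi + sigma) (t pi k.1 * t sigma k.2).
Proof. by apply: (specM alpha_dyn); apply: (frame_spec ht). Qed.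

Let spec_sbs pi i j b : B b -> B (s pi i * b * star (s pi j)).
Proof.
move=> Bb; rewrite -[b]starK -mulrA -starM.
apply: (spec_mul_star alpha_dyn (frame_spec hs i) _).
exact: (spec_mulr alpha_dyn (csubS hB Bb) (frame_spec hs j)).
Qed.

Let u_intertwines sigma pi : UZ (u sigma pi) /\
  forall k, ph' (pi + sigma) (t pi k.1 * t sigma k.2) * u sigma pi = s pi k.1 * s sigma k.2.
Proof.
apply: (intertwiner alpha_dyn (tau := pi + sigma)) => //.
- move=> k; exact: (phi_spec alpha_dyn hbetaV ht hs).
- exact: (frame_mul _ _ hs).
- rewrite -[RHS](auto1 hB hbetaV) -(frame_mul pi sigma ht) (auto_sum hB hbetaV).
    by apply: eq_bigr => k _; rewrite (phi_starl alpha_dyn hbetaV ht hs hts).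
  by move=> k _; apply: (spec_star_mul alpha_dyn (spec_tt k) (spec_tt k)).
- move=> b k l Bb.
  have Bbb := auto_in hbeta Bb.
  rewrite -{1}(bK Bb) -(phi_mulr alpha_dyn hbetaV ht hs hts) //.
  rewrite (phi_starr alpha_dyn hbetaV ht hts) //; last exact: (spec_mulr alpha_dyn).
  have -> : t pi k.1 * t sigma k.2 * beta b * star (t pi l.1 * t sigma l.2) =
      t pi k.1 * (t sigma k.2 * beta b * star (t sigma l.2)) * star (t pi l.1).
    by rewrite starM !mulrA.
  rewrite hst // hst; last exact: spec_sbs.
  rewrite bK; first by rewrite starM !mulrA.
  by apply: spec_sbs; apply: spec_sbs.
Qed.

Lemma ucocycle_UZ sigma pi : UZ (u sigma pi).
Proof. by have [] := u_intertwines sigma pi. Qed.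

Let u_B sigma pi : B (u sigma pi). Proof. by have [] := ucocycle_UZ sigma pi. Qed.

(** Expand x y in the product frame. By [u_intertwines] phi sends [s pi * s sigma] to
    [t pi * t sigma] times [beta (u sigma pi)], and the coefficients are those of [phi x * phi y] in
    the product frame of t. *)
Lemma phi_mul sigma pi x y : spec pi x -> spec sigma y ->
  phi beta s t (pi + sigma) (x * y) =
  phi beta s t pi x * phi beta s t sigma y * beta (u sigma pi).
Proof.
move=> hx hy; have hxy := specM alpha_dyn hx hy.
have [_ qu] := u_intertwines sigma pi.
have Bk (k : 'I_(d pi) * 'I_(d sigma)) : B (x * y * star (s pi k.1 * s sigma k.2)).
  exact: (spec_mul_star alpha_dyn hxy (spec_ss k)).
have e1 : ph (pi + sigma) (x * y) =
    \sum_(k : 'I_(d pi) * 'I_(d sigma)) beta (x * y * star (s pi k.1 * s sigma k.2)) *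
       (t pi k.1 * t sigma k.2 * beta (u sigma pi)).
  have e0 : x * y = \sum_(k : 'I_(d pi) * 'I_(d sigma))
      (x * y * star (s pi k.1 * s sigma k.2)) * (s pi k.1 * s sigma k.2).
    under eq_bigr do rewrite -mulrA.
    by rewrite -mulr_sumr (frame_mul _ _ hs) mulr1.
  transitivity (\sum_(k : 'I_(d pi) * 'I_(d sigma))
      ph (pi + sigma) ((x * y * star (s pi k.1 * s sigma k.2)) * (s pi k.1 * s sigma k.2))).
    rewrite {1}e0; elim: (index_enum _) => [|k r IH]; last first.
      rewrite !big_cons -IH /ph (phiD alpha_dyn _ hbeta hs) //.
        exact: (spec_mull alpha_dyn).
      by apply: (spec_sum alpha_dyn) => l _; apply: (spec_mull alpha_dyn).
    rewrite !big_nil /ph /phi big1 // => i _.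
    by rewrite mul0r (auto0 hB hbeta) mul0r.
  apply: eq_bigr => k _.
  rewrite /ph (phi_mull alpha_dyn _ hbeta hs) //; congr (_ * _).
  rewrite -[s pi k.1 * _]qu (phi_mulr alpha_dyn hbeta hs ht hst) //.
    by rewrite -/(ph _ _) phK'.
  exact: (phi_spec alpha_dyn hbetaV ht hs).
rewrite -/(ph _ _) e1.
have e2 (k : 'I_(d pi) * 'I_(d sigma)) : ph pi x * ph sigma y * star (t pi k.1 * t sigma k.2) =
    beta (x * y * star (s pi k.1 * s sigma k.2)).
  rewrite !starM -!mulrA [ph sigma y * _]mulrA.
  rewrite -{1}(phi_s alpha_dyn hbeta ht hst k.2) /ph.
  rewrite (phi_starr alpha_dyn hbeta hs hst) //; last exact: (frame_spec hs).
  have Byk : B (y * star (s sigma k.2)).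
    exact: (spec_mul_star alpha_dyn hy (frame_spec hs k.2)).
  rewrite mulrA -(phi_mulr alpha_dyn hbeta hs ht hst) //.
  rewrite -(phi_s alpha_dyn hbeta ht hst k.1).
  rewrite (phi_starr alpha_dyn hbeta hs hst); first by rewrite !mulrA.
    exact: (spec_mulr alpha_dyn Byk hx).
  exact: (frame_spec hs).
under eq_bigr do rewrite -e2 mulrA -[ph pi x * _ * _ * _]mulrA.
rewrite -mulr_suml -mulr_sumr; congr (_ * _).
by rewrite (frame_mul _ _ ht) mulr1.
Qed.

Lemma phi_frohlich sigma b x : UZ b -> spec sigma x ->
  beta b * phi beta s t sigma x = phi beta s t sigma x * beta (frohlich_sum s sigma b).
Proof.
move=> ub hx; have Bb := UZ_in ub.
have BD := UZ_in (frohlich_sum_UZ alpha_dyn hs sigma ub).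
rewrite -(phi_mull alpha_dyn _ hbeta hs) // -(phi_mulr alpha_dyn hbeta hs ht hst) //.
by rewrite (frohlich_sum_comm alpha_dyn hs ub hx).
Qed.

(** Phi of a threefold product of entries of s is computed with both bracketings. In one of them
    [beta (u pi rho)] has to pass [t sigma], which produces the Fröhlich map; the three frames of t
    are then cancelled on the left. *)
Lemma ucocycle_cocycle sigma pi rho :
  u (sigma + pi) rho * u sigma pi = u sigma (pi + rho) * frohlich_sum s sigma (u pi rho).
Proof.
have UD := frohlich_sum_UZ alpha_dyn hs sigma (ucocycle_UZ pi rho).
set L := (u (sigma + pi) rho * _); set E := (u sigma (pi + rho) * _).
have BL : B L by apply: (csubM hB).
have BE : B E by apply: (csubM hB) => //; apply: UZ_in.
suff : beta L = beta E by apply: (auto_inj hbeta).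
apply/eqP; rewrite -subr_eq0; apply/eqP.
apply: (frame_cancel (sigma := sigma) ht) => k.
apply: (frame_cancel (sigma := pi) ht) => j.
apply: (frame_cancel (sigma := rho) ht) => i.
have [[si sj] sk] := (frame_spec hs i, frame_spec hs j, frame_spec hs k).
suff e : t rho i * (t pi j * (t sigma k * beta L)) = t rho i * (t pi j * (t sigma k * beta E)).
  by rewrite !mulrBr e subrr.
have e1 : ph (rho + pi + sigma) (s rho i * s pi j * s sigma k) =
    t rho i * (t pi j * (t sigma k * beta E)).
  rewrite /ph phi_mul //; last exact: (specM alpha_dyn).
  rewrite phi_mul // !(phi_s alpha_dyn hbeta ht hst).
  rewrite -[_ * beta _ * t sigma k]mulrA -(phi_s alpha_dyn hbeta ht hst k).
  rewrite (phi_frohlich (ucocycle_UZ _ _)) // (phi_s alpha_dyn hbeta ht hst).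
  rewrite -!mulrA; do 3 congr (_ * _).
  rewrite -(auto_mul hbeta) //; last exact: UZ_in.
  by rewrite (UZ_comm UD) // [rho + pi]addrC.
rewrite -e1 -addrA -mulrA /ph phi_mul //; last exact: (specM alpha_dyn).
rewrite (phi_mul sj sk) !(phi_s alpha_dyn hbeta ht hst).
rewrite -!mulrA; do 3 congr (_ * _).
rewrite -(auto_mul hbeta) // [pi + sigma]addrC.
by rewrite (UZ_comm (ucocycle_UZ _ _)).
Qed.

End Cocycle.

(** * Lifts and coboundaries *)

Section Lifting.
Variables (R : realType) (G : topologicalZmodType).
Hypothesis tb : totally_bounded G.
Variables (A : cstarAlgType R) (alpha : G -> A -> A).
Hypothesis alpha_dyn : dynamical_system alpha.
Implicit Types (x y z b : A) (sigma pi rho : dualGroup R G).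
Local Notation D := (dualGroup R G).
Local Notation B := (fixed_algebra alpha).
Local Notation UZ := (central_unitaries B).
Local Notation spec := (spec alpha).
Variable d : D -> nat.
Let hB := fixed_closed_subalgebra alpha_dyn.
Let hN := complete_rnorm A.

Variables (beta : A -> A) (s t : forall sigma : D, 'I_(d sigma) -> A).
Arguments s : clear implicits.
Arguments t : clear implicits.
Hypotheses (hbeta : star_automorphism B beta) (hs : frame alpha s) (ht : frame alpha t).
Hypothesis hst : twisted alpha s t beta.
Local Notation u := (ucocycle alpha beta s t).
Let ph sigma x := phi beta s t sigma x.

Lemma auto_UZ (f : A -> A) b : star_automorphism B f -> UZ b -> UZ (f b).
Proof.
move=> hf [Bb b1 b2 bc]; have BS := csubS hB Bb; split.
- exact: (auto_in hf).
- by rewrite -(auto_star hf) // -(auto_mul hf) // b1 (auto1 hB hf).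
- by rewrite -(auto_star hf) // -(auto_mul hf) // b2 (auto1 hB hf).
- move=> x Bx; have [z Bz <-] := auto_surj hf Bx.
  by rewrite -!(auto_mul hf) // bc.
Qed.

Let phi_frohlich sigma b x : UZ b -> spec sigma x ->
  beta b * ph sigma x = ph sigma x * beta (frohlich_sum s sigma b).
Proof.
exact: (phi_frohlich alpha_dyn hbeta hs ht hst).
Qed.

Let phi_mul sigma pi x y : spec pi x -> spec sigma y ->
  ph (pi + sigma) (x * y) = ph pi x * ph sigma y * beta (u sigma pi).
Proof. exact: (phi_mul alpha_dyn hbeta hs ht hst). Qed.

Let u_UZ sigma pi : UZ (u sigma pi).
Proof. exact: (ucocycle_UZ alpha_dyn hbeta hs ht hst). Qed.

(** A lift sends the frame s to a frame that implements the same twist as t, so [intertwiner] yields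
    the central unitaries. Multiplicativity of the lift on products of entries is the coboundary
    equation. *)
Lemma lift_coboundary : lifts alpha beta -> B2 UZ (frohlich_sum s) u.
Proof.
move=> [bh [hbh ext comm]].
have hT : closed_subalgebra [set: A] by [].
have p_spec sigma i : spec sigma (bh (s sigma i)).
  by move=> g; rewrite -comm (frame_spec hs) (auto_scale hT hbh).
pose c' sigma := \sum_i star (t sigma i) * bh (s sigma i).
have hc sigma : UZ (c' sigma) /\ forall i, t sigma i * c' sigma = bh (s sigma i).
  apply: (intertwiner alpha_dyn (tau := sigma)) => //.
  - by move=> i; apply: (frame_spec ht).
  - under eq_bigr do rewrite -(auto_star hbh) // -(auto_mul hbh) //.
    by rewrite -(auto_sum hT hbh) // (frame1 hs) (auto1 hT hbh).
  - exact: (frame1 ht).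
  move=> b i j Bb; have [b' Bb' <-] := auto_surj hbeta Bb.
  rewrite hst // -ext; last first.
    rewrite -[b']starK -mulrA -starM.
    apply: (spec_mul_star alpha_dyn (frame_spec hs i)).
    exact: (spec_mulr alpha_dyn (csubS hB Bb') (frame_spec hs j)).
  by rewrite !(auto_mul hbh) // (auto_star hbh) // (ext _ Bb').
have bhE sigma x : spec sigma x -> bh x = ph sigma x * c' sigma.
  move=> hx; rewrite {1}(frame_expand sigma x hs) (auto_sum hT hbh) //.
  rewrite /ph /phi mulr_suml; apply: eq_bigr => i _.
  rewrite (auto_mul hbh) // ext; last exact: (spec_mul_star alpha_dyn hx (frame_spec hs i)).
  by rewrite -mulrA; have [_ ->] := hc sigma.
pose c sigma := inv_on B beta (c' sigma).
have cE sigma : beta (c sigma) = c' sigma.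
  by apply: (invonKV hbeta); have [/UZ_in] := hc sigma.
have cU sigma : UZ (c sigma).
  by apply: auto_UZ; [exact: invon_auto|have [] := hc sigma].
have key sigma pi : u sigma pi * c (pi + sigma) = frohlich_sum s sigma (c pi) * c sigma.
  have UD := frohlich_sum_UZ alpha_dyn hs sigma (cU pi).
  have BL := csubM hB (UZ_in (u_UZ sigma pi)) (UZ_in (cU (pi + sigma))).
  have BE := csubM hB (UZ_in UD) (UZ_in (cU sigma)).
  suff : beta (u sigma pi * c (pi + sigma)) = beta (frohlich_sum s sigma (c pi) * c sigma).
    exact: (auto_inj hbeta).
  apply/eqP; rewrite -subr_eq0; apply/eqP.
  apply: (frame_cancel (sigma := sigma) ht) => j.
  apply: (frame_cancel (sigma := pi) ht) => i.
  have [si sj] := (frame_spec hs i, frame_spec hs j).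
  suff e : t pi i * (t sigma j * beta (u sigma pi * c (pi + sigma))) =
           t pi i * (t sigma j * beta (frohlich_sum s sigma (c pi) * c sigma)).
    by rewrite !mulrBr e subrr.
  rewrite !(auto_mul hbeta); try exact: UZ_in.
  have := bhE _ _ (specM alpha_dyn si sj).
  rewrite (auto_mul hbh) // (bhE _ _ si) (bhE _ _ sj) -!cE phi_mul //.
  rewrite -[ph pi _ * _ * _]mulrA [beta (c pi) * _]mulrA (phi_frohlich (cU pi) sj).
  by rewrite /ph !(phi_s alpha_dyn hbeta ht hst) -!mulrA => ->.
exists c => // sigma pi.
have [_ _ c2 _] := cU (pi + sigma).
by rewrite [sigma + pi]addrC -key -mulrA c2 mulr1.
Qed.

Hypotheses (s1 : forall i, s 0 i = 1) (t1 : forall i, t 0 i = 1).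

Let phi_0 x : B x -> ph 0 x = beta x.
Proof. by move=> Bx; apply: (phi0 beta ht). Qed.

Let frohlich_sum_0 b : frohlich_sum s 0 b = b.
Proof.
rewrite -[RHS]mulr1 -(frame1 hs 0) mulr_sumr; apply: eq_bigr => i _.
by rewrite s1 star1 mul1r !mulr1.
Qed.

Let spec1 : spec 0 1. Proof. by apply/spec0; apply: (csub1 hB). Qed.

Lemma ucocycle00 : u 0 0 = 1.
Proof.
have B1 := csub1 hB.
have := phi_mul spec1 spec1; rewrite addr0 mulr1 phi_0 // (auto1 hB hbeta) !mul1r.
move=> e; apply: (auto_inj hbeta) => //; first exact: UZ_in (u_UZ 0 0).
by rewrite -e (auto1 hB hbeta).
Qed.

Section Coboundary.
Variable c : D -> A.
Hypotheses (cU : forall sigma, UZ (c sigma))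
  (uc : forall sigma pi, u sigma pi = frohlich_sum s sigma (c pi) * c sigma * star (c (sigma + pi))).

Let psi sigma x := ph sigma x * beta (c sigma).

(** At (0, 0) the coboundary formula reduces to [c 0], and u is 1 there by the normalisation of s
    and t. Hence psi restricts to beta in degree 0. *)
Let c0 : c 0 = 1.
Proof.
have [_ _ c2 _] := cU 0.
by have := ucocycle00; rewrite uc frohlich_sum_0 addr0 -mulrA c2 mulr1.
Qed.

Let bcU sigma : UZ (beta (c sigma)). Proof. exact: auto_UZ. Qed.

Let psi_spec sigma x : spec sigma x -> spec sigma (psi sigma x).
Proof.
move=> hx; apply: (spec_mulr alpha_dyn (UZ_in (bcU sigma))).
exact: (phi_spec alpha_dyn hbeta hs ht).
Qed.

Let psi_0 b : B b -> psi 0 b = beta b.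
Proof. by move=> Bb; rewrite /psi c0 (auto1 hB hbeta) mulr1 phi_0. Qed.

Let psi_mul sigma pi x y : spec sigma x -> spec pi y ->
  psi (sigma + pi) (x * y) = psi sigma x * psi pi y.
Proof.
move=> hx hy; rewrite /psi phi_mul // -mulrA -(auto_mul hbeta); try exact: UZ_in.
have [_ c1 _ _] := cU (sigma + pi).
rewrite uc [pi + sigma]addrC -[_ * star _ * _]mulrA c1 mulr1.
rewrite -[RHS]mulrA [beta (c sigma) * _]mulrA (phi_frohlich (cU sigma) hy).
rewrite (auto_mul hbeta); [by rewrite !mulrA| |exact: UZ_in].
exact: UZ_in (frohlich_sum_UZ alpha_dyn hs pi (cU sigma)).
Qed.

Let psi_starl sigma x y : spec sigma x -> spec sigma y ->
  star (psi sigma x) * psi sigma y = beta (star x * y).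
Proof.
move=> hx hy; have [_ c1 _ cc] := bcU sigma.
rewrite /psi starM -mulrA [star (ph _ _) * _]mulrA (phi_starl alpha_dyn hbeta hs ht hst) //.
rewrite -cc ?mulrA ?c1 ?mul1r //; apply: (auto_in hbeta).
exact: (spec_star_mul alpha_dyn hx hy).
Qed.

(** The difference w of the two sides kills every [psi sigma y] by multiplicativity and [psi_starl].
    But 1 is a sum of products with left factors of this form, taken from the frame at - sigma, so w
    = w 1 = 0. *)
Let psi_star sigma x : spec sigma x -> psi (- sigma) (star x) = star (psi sigma x).
Proof.
move=> hx; apply/eqP; rewrite -subr_eq0; apply/eqP; set w := _ - _.
have wy y : spec sigma y -> w * psi sigma y = 0.
  move=> hy; rewrite mulrBl psi_starl // -psi_mul //; last exact: (specS alpha_dyn).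
  by rewrite addNr psi_0 ?subrr //; apply: (spec_star_mul alpha_dyn hx hy).
have sy i : spec sigma (star (s (- sigma) i)).
  by rewrite -[X in spec X]opprK; apply: (specS alpha_dyn); apply: (frame_spec hs).
have e i : psi sigma (star (s (- sigma) i)) * psi (- sigma) (s (- sigma) i) =
    beta (star (s (- sigma) i) * s (- sigma) i).
  rewrite -psi_mul //; last exact: (frame_spec hs).
  rewrite subrr psi_0 //; exact: (spec_star_mul alpha_dyn (frame_spec hs i) (frame_spec hs i)).
rewrite -[w]mulr1 -(auto1 hB hbeta) -(frame1 hs (- sigma)) (auto_sum hB hbeta); last first.
  by move=> i _; exact: (spec_star_mul alpha_dyn (frame_spec hs i) (frame_spec hs i)).
rewrite mulr_sumr big1 // => i _.
by rewrite -e mulrA wy // mul0r.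
Qed.

Lemma rnorm_auto b : B b -> rnorm (beta b) = rnorm b.
Proof.
move=> Bb; apply/eqP; rewrite eq_le (auto_le hB hbeta) //=.
have := auto_le hB (invon_auto hB hbeta) (auto_in hbeta Bb).
by rewrite (invonK hbeta).
Qed.

Lemma coboundary_graded_iso :
  graded_iso alpha (fun sigma x y => spec sigma x /\ y = psi sigma x).
Proof.
split.
- by move=> sigma x y [hx ->]; split=> //; apply: psi_spec.
- move=> sigma x y x' y' [hx ->] [hx' ->]; split; first exact: (specD alpha_dyn).
  by rewrite /psi -mulrDl /ph (phiD alpha_dyn _ hbeta hs).
- move=> sigma k x y [hx ->]; split; first exact: (specZ alpha_dyn).
  by rewrite /psi scalerAl /ph (phiZ alpha_dyn _ hbeta hs).
- move=> sigma pi x y x' y' [hx ->] [hx' ->]; split; first exact: (specM alpha_dyn).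
  by rewrite psi_mul.
- move=> sigma x y [hx ->]; split; first exact: (specS alpha_dyn).
  by rewrite psi_star.
- move=> sigma x y [hx ->].
  (* The C*-identity reduces the norm in degree sigma to the fixed algebra, where beta is
     isometric. *)
  have e : rnorm (psi sigma x) ^+ 2 = rnorm x ^+ 2.
    rewrite -!rnorm_starM psi_starl // rnorm_auto //.
    exact: (spec_star_mul alpha_dyn hx hx).
  by apply/eqP; rewrite -(@eqrXn2 _ 2) ?(cn_ge0 hN) // e.
- by move=> sigma x hx; exists (psi sigma x).
- move=> sigma y hy; have [Bc c1 _ _] := bcU sigma.
  have hyc := spec_mulr alpha_dyn (csubS hB Bc) hy.
  exists (phi (inv_on B beta) t s sigma (y * star (beta (c sigma)))).
  split; first exact: (phi_spec alpha_dyn (invon_auto hB hbeta) ht hs).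
  rewrite /psi /ph (phiK alpha_dyn (invon_auto hB hbeta) hbeta ht hs) //.
  + by rewrite -mulrA c1 mulr1.
  + exact: (twisted_sym alpha_dyn hbeta hs hst).
  + by move=> b Bb; apply: (invonKV hbeta).
Qed.

Lemma coboundary_lifts : lifts alpha beta.
Proof.
have [f [hf fr comm]] := graded_iso_automorphism tb alpha_dyn coboundary_graded_iso.
exists f; split=> // b Bb.
by rewrite -(psi_0 Bb); apply: (fr 0); split=> //; apply/spec0.
Qed.

End Coboundary.

Lemma coboundary_lift : B2 UZ (frohlich_sum s) u -> lifts alpha beta.
Proof. by move=> [c cU uc]; apply: coboundary_lifts cU uc. Qed.

Lemma ucocycle_Z2 : Z2 UZ (frohlich_sum s) u.
Proof.
by split=> [|sigma pi rho]; [exact: u_UZ|exact: (ucocycle_cocycle alpha_dyn hbeta hs ht hst)].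
Qed.

Lemma B2_1 : B2 UZ (frohlich_sum s) (fun _ _ => 1).
Proof.
exists (fun=> 1) => [_|sigma pi]; first exact: (UZ1 alpha_dyn).
by rewrite (frohlich_sum1 hs) star1 !mulr1.
Qed.

Lemma B2_mul w w' : B2 UZ (frohlich_sum s) w -> B2 UZ (frohlich_sum s) w' ->
  B2 UZ (frohlich_sum s) (fun sigma pi => w sigma pi * w' sigma pi).
Proof.
move=> [c cU wE] [c' c'U w'E]; exists (fun sigma => c sigma * c' sigma).
  by move=> sigma; apply: (UZ_mul alpha_dyn).
move=> sigma pi; rewrite wE w'E (frohlich_sum_mul alpha_dyn hs) // starM.
have D1 := frohlich_sum_UZ alpha_dyn hs sigma (cU pi); have D2 := frohlich_sum_UZ alpha_dyn hs sigma (c'U pi).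
have S1 := UZ_star alpha_dyn (cU (sigma + pi)).
have S2 := UZ_star alpha_dyn (c'U (sigma + pi)).
rewrite -!mulrA; congr (_ * _).
rewrite [star (c _) * (frohlich_sum _ _ _ * _)]mulrA (UZ_comm S1 (UZ_in D2)) -[frohlich_sum _ _ _ * _ * _]mulrA.
rewrite [c sigma * (frohlich_sum _ _ _ * _)]mulrA (UZ_comm (cU sigma) (UZ_in D2)) -[frohlich_sum _ _ _ * _ * _]mulrA.
congr (_ * (_ * _)).
rewrite [LHS]mulrA (UZ_comm S1 (UZ_in (c'U sigma))) -[LHS]mulrA; congr (_ * _).
by rewrite (UZ_comm S1 (UZ_in S2)).
Qed.

Lemma B2_star w : B2 UZ (frohlich_sum s) w -> B2 UZ (frohlich_sum s) (fun sigma pi => star (w sigma pi)).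
Proof.
move=> [c cU wE]; exists (fun sigma => star (c sigma)).
  by move=> sigma; apply: (UZ_star alpha_dyn).
move=> sigma pi; rewrite wE !starM !starK frohlich_sum_star.
have D1 := UZ_star alpha_dyn (frohlich_sum_UZ alpha_dyn hs sigma (cU pi)); rewrite frohlich_sum_star in D1.
have S1 := UZ_star alpha_dyn (cU sigma).
rewrite (UZ_comm S1 (UZ_in D1)).
by rewrite (UZ_comm (cU _)) //; apply: UZ_in; apply: (UZ_mul alpha_dyn).
Qed.

Lemma B2_UZ w sigma pi : B2 UZ (frohlich_sum s) w -> UZ (w sigma pi).
Proof.
move=> [c cU ->]; apply: (UZ_mul alpha_dyn); last exact: (UZ_star alpha_dyn).
by apply: (UZ_mul alpha_dyn) => //; apply: (frohlich_sum_UZ alpha_dyn).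
Qed.

(** The classes are cosets given as sets: w lies in its own class, and B2 is closed under products
    and adjoints because all values commute. *)
Lemma H2_vanishesP w : Z2 UZ (frohlich_sum s) w -> H2_vanishes UZ (frohlich_sum s) w <-> B2 UZ (frohlich_sum s) w.
Proof.
move=> hw; split=> [H|hB2].
  have : H2_class UZ (frohlich_sum s) w w.
    by split=> //; exists (fun _ _ => 1); [exact: B2_1|move=> sigma pi; rewrite mulr1].
  rewrite H => -[_ [b hb wb]].
  have -> : w = b by apply: funext => sigma; apply: funext => pi; rewrite wb mul1r.
  exact: hb.
apply/seteqP; split=> v [hv [b hb vE]]; split=> //.
  exists (fun sigma pi => w sigma pi * b sigma pi); first exact: B2_mul.
  by move=> sigma pi; rewrite mul1r.
exists (fun sigma pi => star (w sigma pi) * b sigma pi).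
  by apply: B2_mul => //; apply: B2_star.
move=> sigma pi; have [_ _ w2 _] := B2_UZ sigma pi hB2.
by rewrite mulrA w2 vE.
Qed.

End Lifting.

(** * From matrices to frames *)

Section MatrixEntries.
Variables (R : realType) (A : cstarAlgType R).

Lemma adjmxE m n (x : 'M[A]_(m, n)) i j : adjmx x i j = star (x j i).
Proof. by rewrite !mxE. Qed.

Lemma adjmxK m n (x : 'M[A]_(m, n)) : adjmx (adjmx x) = x.
Proof. by apply/matrixP => i j; rewrite !adjmxE starK. Qed.

Lemma adjmxM m n p (x : 'M[A]_(m, n)) (y : 'M[A]_(n, p)) :
  adjmx (x *m y) = adjmx y *m adjmx x.
Proof.
apply/matrixP => i j; rewrite adjmxE !mxE star_sum; apply: eq_bigr => k _.
by rewrite starM !adjmxE.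
Qed.

Lemma rank_one_entry m n (x : 'cV[A]_m) (y : 'cV[A]_n) b i j :
  (x *m b%:M *m adjmx y) i j = x i 0 * b * star (y j 0).
Proof.
rewrite mxE big_ord1 adjmxE; congr (_ * _).
by rewrite mxE big_ord1 mxE eqxx mulr1n.
Qed.

Lemma sandwich_entry n (x y : 'cV[A]_n) b :
  (adjmx x *m b%:M *m y) 0 0 = \sum_i star (x i 0) * b * y i 0.
Proof.
rewrite mxE; apply: eq_bigr => k _; congr (_ * _).
rewrite mxE (bigD1 k) //= big1 ?addr0 => [|j jk].
  by rewrite adjmxE [b%:M _ _]mxE eqxx mulr1n.
by rewrite [b%:M _ _]mxE (negbTE jk) mulr0n mulr0.
Qed.

Lemma sum_mxtens m n (F : 'I_m * 'I_n -> A) :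
  \sum_(p < m * n) F (mxtens_unindex p) = \sum_p F p.
Proof.
rewrite [RHS](reindex (@mxtens_unindex m n)) //=.
by exists (@mxtens_index m n) => p _; rewrite ?mxtens_indexK ?mxtens_unindexK.
Qed.

End MatrixEntries.

Section Glue.
Variables (R : realType) (G : topologicalZmodType).
Variables (A : cstarAlgType R) (alpha : G -> A -> A).
Hypothesis alpha_dyn : dynamical_system alpha.
Variables (beta : A -> A) (d : dualGroup R G -> nat).
Variable s : forall sigma : dualGroup R G, 'cV[A]_(d sigma).
Variable v : forall sigma : dualGroup R G, 'M[A]_(d sigma).
Hypothesis beta_aut : star_automorphism (fixed_algebra alpha) beta.
Hypothesis s_iso : equivariant_isometries alpha s.
Hypothesis v_conj : conjugating alpha s beta v.
Local Notation B := (fixed_algebra alpha).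
Let hB := fixed_closed_subalgebra alpha_dyn.

Definition sframe (sigma : dualGroup R G) (i : 'I_(d sigma)) : A := s sigma i 0.
Definition tframe (sigma : dualGroup R G) (i : 'I_(d sigma)) : A := (v sigma *m s sigma) i 0.
Arguments sframe : clear implicits.
Arguments tframe : clear implicits.

Lemma frame_sframe : frame alpha sframe.
Proof.
split=> [sigma|sigma i g].
  have := congr1 (fun x : 'M[A]_(1, 1) => x 0 0) (iso_isometry s_iso sigma).
  rewrite !mxE eqxx mulr1n => <-; apply: eq_bigr => i _.
  by rewrite adjmxE.
have := congr1 (fun x : 'cV[A]_(d sigma) => x i 0) (iso_equivariant s_iso sigma g).
by rewrite !mxE.
Qed.

(** The initial projection of v is the range projection of s, so v s remains isometric. *)
Lemma frame_tframe : frame alpha tframe.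
Proof.
split=> [sigma|sigma i].
  have e : adjmx (v sigma *m s sigma) *m (v sigma *m s sigma) = 1%:M.
    have si := iso_isometry s_iso sigma.
    rewrite adjmxM -mulmxA [adjmx (v _) *m _]mulmxA (conj_initial v_conj) /fs_gamma.
    by rewrite mulmx1 -mulmxA si mulmx1 si.
  have := congr1 (fun x : 'M[A]_(1, 1) => x 0 0) e.
  rewrite [in X in _ = X -> _]mxE eqxx mulr1n => <-; rewrite mxE; apply: eq_bigr => i _.
  by rewrite adjmxE.
rewrite /tframe mxE; apply: (spec_sum alpha_dyn) => j _.
apply: (spec_mull alpha_dyn (conj_base v_conj i j)).
exact: (frame_spec frame_sframe).
Qed.

Lemma twisted_frames : twisted alpha sframe tframe beta.
Proof.
move=> sigma i j b Bb.
have := congr1 (fun x : 'M[A]_(d sigma) => x i j)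
  (conj_gamma_beta v_conj sigma (auto_in beta_aut Bb)).
rewrite /fs_gamma_beta /= (invonK beta_aut) // mxE /fs_gamma rank_one_entry => ->.
by rewrite /tframe -rank_one_entry adjmxM !mulmxA.
Qed.

Lemma sframe0 i : sframe 0 i = 1.
Proof. by rewrite /sframe (iso0 s_iso) mxE. Qed.

Lemma tframe0 i : tframe 0 i = 1.
Proof. by rewrite /tframe (conj0 v_conj) mul1mx (iso0 s_iso) mxE. Qed.

Lemma frohlichE sigma b : frohlich s sigma b = frohlich_sum sframe sigma b.
Proof. exact: sandwich_entry. Qed.

Lemma smulE sigma pi p : smul s sigma pi p 0 =
  sframe sigma (mxtens_unindex p).1 * sframe pi (mxtens_unindex p).2.
Proof.
by rewrite /smul mxE /sframe; congr (_ * _); congr (fun_of_matrix _ _ _); apply: ord1.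
Qed.

(** The factor [star (s pi) * s pi] hidden between the product and [fs_gamma] sums to 1. What is
    left moves [star (v sigma)] next to the adjoint of [s sigma], so the expression collapses to the
    adjoint of [t pi * t sigma]. *)
Lemma leg_entry sigma pi p :
  (adjmx (smul s pi sigma) *m apply_leg (fs_gamma s pi) (adjmx (v sigma)) *m
     (adjmx (v pi) *t (1%:M : 'M[A]_(d sigma)))) 0 p =
  star (tframe pi (mxtens_unindex p).1 * tframe sigma (mxtens_unindex p).2).
Proof.
have row q : (adjmx (smul s pi sigma) *m apply_leg (fs_gamma s pi) (adjmx (v sigma))) 0 q =
    star (tframe sigma (mxtens_unindex q).2) * star (sframe pi (mxtens_unindex q).1).
  set q1 := (mxtens_unindex q).1; set q2 := (mxtens_unindex q).2.
  rewrite mxE.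
  pose F (r : 'I_(d pi) * 'I_(d sigma)) := star (sframe pi r.1 * sframe sigma r.2) *
    (sframe pi r.1 * star (v sigma q2 r.2) * star (sframe pi q1)).
  transitivity (\sum_(r < d pi * d sigma) F (mxtens_unindex r)).
    apply: eq_bigr => r _; rewrite adjmxE smulE; congr (_ * _).
    by rewrite mxE adjmxE rank_one_entry.
  rewrite (sum_mxtens F) -(pair_bigA _ (fun i j => F (i, j))) /F /=.
  rewrite exchange_big /tframe mxE star_sum mulr_suml; apply: eq_bigr => j _ /=.
  under eq_bigr do rewrite starM -!mulrA [star (sframe pi _) * _]mulrA.
  rewrite -mulr_sumr -mulr_suml (frame1 frame_sframe) mul1r starM.
  by rewrite !mulrA.
rewrite mxE.
pose F (q : 'I_(d pi) * 'I_(d sigma)) := star (tframe sigma q.2) * star (sframe pi q.1) *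
  (star (v pi (mxtens_unindex p).1 q.1) * (q.2 == (mxtens_unindex p).2)%:R).
transitivity (\sum_(q < d pi * d sigma) F (mxtens_unindex q)).
  by apply: eq_bigr => q _; rewrite row /F; congr (_ * _); rewrite mxE adjmxE [1%:M _ _]mxE.
rewrite (sum_mxtens F) -(pair_bigA _ (fun i j => F (i, j))) /F /=.
rewrite starM [tframe pi _]mxE star_sum mulr_sumr; apply: eq_bigr => i _.
rewrite (bigD1 (mxtens_unindex p).2) //= eqxx mulr1 big1 ?addr0 => [|j /negbTE ->].
  by rewrite starM mulrA.
by rewrite !mulr0.
Qed.

Lemma lift_cocycleE sigma pi :
  lift_cocycle alpha s beta v sigma pi = ucocycle alpha beta sframe tframe sigma pi.
Proof.
have hV := invon_auto hB beta_aut.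
rewrite /lift_cocycle; set W := _ *m _ *m _ *m _.
(* The matrix under the inverse of beta has rank one: omega contributes s at pi + sigma times an
   adjoint of products, and [leg_entry] absorbs the rest. Its adjoint entries are the coefficients
   of [phi] for the inverse of beta. *)
have WE k p : W k p = tframe (pi + sigma) k *
    star (tframe pi (mxtens_unindex p).1 * tframe sigma (mxtens_unindex p).2).
  rewrite -leg_entry /W /fs_omega adjmxM adjmxK mulmxA -!mulmxA [v _ *m (_ *m _)]mulmxA.
  by rewrite mxE big_ord1 !mulmxA.
rewrite mxE.
pose F (p : 'I_(d pi) * 'I_(d sigma)) :=
  star (phi (inv_on B beta) tframe sframe (pi + sigma) (tframe pi p.1 * tframe sigma p.2)) *
  (sframe pi p.1 * sframe sigma p.2).
rewrite -[RHS]/(\sum_p F p) -sum_mxtens.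
apply: eq_bigr => p _; rewrite smulE; congr (_ * _).
rewrite mxE /phi star_sum; apply: eq_bigr => k _.
rewrite adjmxE starM mxE WE; congr (_ * _).
rewrite -(auto_star hV) ?starM ?starK //.
apply: (spec_mul_star alpha_dyn _ (frame_spec frame_tframe k)).
by apply: (specM alpha_dyn); apply: (frame_spec frame_tframe).
Qed.

End Glue.

Theorem theorem5p5 (R : realType) (G : topologicalZmodType)
    (G_compact : compact [set: G]) (G_hausdorff : hausdorff_space G)
    (A : cstarAlgType R) (alpha : G -> A -> A)
    (alpha_dyn : dynamical_system alpha) (alpha_free : free_action alpha)
    (beta : A -> A)
    (beta_aut : star_automorphism (fixed_algebra alpha) beta)
    (d : dualGroup R G -> nat)
    (s : forall sigma : dualGroup R G, 'cV[A]_(d sigma))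
    (s_iso : equivariant_isometries alpha s)
    (v : forall sigma : dualGroup R G, 'M[A]_(d sigma))
    (v_conj : conjugating alpha s beta v) :
  let UZ := central_unitaries (fixed_algebra alpha) in
  let Delta := frohlich s in
  let u := lift_cocycle alpha s beta v in
  Z2 UZ Delta u /\ (lifts alpha beta <-> H2_vanishes UZ Delta u).
Proof.
move=> UZ Delta u.
have tb := compact_totally_bounded G_compact.
have hs := frame_sframe s_iso.
have ht := frame_tframe alpha_dyn s_iso v_conj.
have hst := twisted_frames beta_aut v_conj.
have -> : Delta = frohlich_sum (sframe s).
  by apply: funext => sigma; apply: funext => b; apply: frohlichE.
have -> : u = ucocycle alpha beta (sframe s) (tframe s v).
  apply: funext => sigma; apply: funext => pi.
  exact: (lift_cocycleE alpha_dyn beta_aut s_iso v_conj).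
have z2 := ucocycle_Z2 alpha_dyn beta_aut hs ht hst.
split=> //; split.
- move=> /(lift_coboundary alpha_dyn beta_aut hs ht hst).
  by move=> h; apply/(H2_vanishesP alpha_dyn hs z2).
- move=> /(H2_vanishesP alpha_dyn hs z2).
  apply: (coboundary_lift tb alpha_dyn beta_aut hs ht hst).
  + exact: sframe0 s_iso.
  + exact: tframe0 s_iso v_conj.
Qed.
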